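(* Let $q$ be a positive integer, $\psi$ a primitive Dirichlet character modulo $q$, $\ell$ a positive integer, $h$ an integer with $(h,\ell q)=1$, and $\xi \in \mathbb{C}$. Let $\overline{h}$ denote an integer with $h\overline{h} \equiv 1 \pmod{\ell q}$. Then, as meromorphic functions of $s \in \mathbb{C}$, \begin{multline*} D_{\psi}(s, \xi; h/\ell q) = \psi(-\overline{h})(2\pi)^{2s-\xi-2}(\ell q)^{\xi-2s+1} \Gamma(1-s) \Gamma(1+\xi-s)\\ \times \Big[\big\{e(\xi/4)+\psi(-1) e(-\xi/4) \big\} D_{\psi}(1+\xi-s, \xi; \overline{h}/\ell q) - \big\{e((2s-\xi)/4)+\psi(-1) e(-(2s-\xi)/4) \big\} D_{\psi}(1+\xi-s, \xi; -\overline{h}/\ell q) \Big]. \end{multline*}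
   Context: Write $e(z)=\exp(2\pi i z)$. For $n \in \mathbb{N}$ define the twisted divisor function $\sigma_{\xi}(n,\psi)=\sum_{d\mid n}\psi(d)d^{\xi}$. For integers $h$ coprime to $\ell q$, the twisted Estermann zeta function is \begin{equation*} D_{\psi}(s,\xi;h/\ell q)=\sum_{n=1}^{\infty}\sigma_{\xi}(n,\psi)\, e\!\left(\frac{hn}{\ell q}\right) n^{-s}, \end{equation*} defined by this absolutely convergent series for $\Re(s)$ sufficiently large and extended meromorphically to all $s\in\mathbb{C}$ (it depends on $h$ only modulo $\ell q$, so $D_\psi(\cdot,\xi;\pm\overline{h}/\ell q)$ is well defined). *)

(* Defs.v *)
From Stdlib Require Import Reals ZArith List.
From Coquelicot Require Import Coquelicot.
Open Scope R_scope.

Definition cexp (z : C) : C :=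
  (exp (Re z) * cos (Im z), exp (Re z) * sin (Im z)).

Definition cpowR (x : R) (s : C) : C := cexp (Cmult (RtoC (ln x)) s).

Definition e (z : C) : C := cexp (Cmult (Cmult (RtoC (2 * PI)) Ci) z).

(** Gamma function, via Gauss's limit formula
    Gamma(s) = lim_{n->oo} n! n^s / (s (s+1) ... (s+n)),
    valid for every s not in {0,-1,-2,...} (junk value at the poles). *)
Fixpoint poch (s : C) (n : nat) : C :=
  match n with
  | O => s
  | S m => Cmult (poch s m) (Cplus s (RtoC (INR (S m))))
  end.

Definition gauss_seq (s : C) (n : nat) : C :=
  Cdiv (Cmult (RtoC (INR (fact n))) (cpowR (INR n) s)) (poch s n).

Definition Gamma (s : C) : C :=
  (real (Lim_seq (fun n => Re (gauss_seq s n))),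
   real (Lim_seq (fun n => Im (gauss_seq s n)))).

Definition dirichlet_char (q : Z) (psi : Z -> C) : Prop :=
  (0 < q)%Z /\
  psi 1%Z = RtoC 1 /\
  (forall m n : Z, psi (m * n)%Z = Cmult (psi m) (psi n)) /\
  (forall n : Z, psi (n + q)%Z = psi n) /\
  (forall n : Z, Z.gcd n q <> 1%Z -> psi n = RtoC 0) /\
  (forall n : Z, Z.gcd n q = 1%Z -> psi n <> RtoC 0).

(** Primitive: psi is not induced by any character of modulus d | q, d < q,
    i.e. for every such d, psi is not d-periodic on integers coprime to q. *)
Definition primitive_char (q : Z) (psi : Z -> C) : Prop :=
  dirichlet_char q psi /\
  forall d : Z, (0 < d < q)%Z -> (d | q)%Z ->
    exists a b : Z, Z.gcd a q = 1%Z /\ Z.gcd b q = 1%Z /\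
      (a mod d = b mod d)%Z /\ psi a <> psi b.

Definition sigma_tw (xi : C) (psi : Z -> C) (n : nat) : C :=
  fold_right Cplus (RtoC 0)
    (map (fun d => if (n mod d =? 0)%nat
                   then Cmult (psi (Z.of_nat d)) (cpowR (INR d) xi)
                   else RtoC 0)
         (seq 1 n)).

Definition est_coeff (psi : Z -> C) (xi : C) (a N : Z) (n : nat) : C :=
  Cmult (sigma_tw xi psi n)
        (e (RtoC (IZR a * INR n / IZR N))).

Definition locally_finite (E : C -> Prop) : Prop :=
  forall z : C, exists r : R, 0 < r /\ exists L : list C,
    forall w : C, Cmod (Cminus w z) < r -> E w -> In w L.

Definition estermann_continuation (psi : Z -> C) (xi : C) (a N : Z)
    (D : C -> C) : Prop :=
  (exists P : C -> Prop, locally_finite P /\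
     forall s : C, ~ P s -> @ex_derive C_AbsRing C_NormedModule D s) /\
  (exists sigma0 : R, forall s : C, sigma0 < Re s ->
     @is_series C_AbsRing C_NormedModule
       (fun n : nat => Cmult (est_coeff psi xi a N (S n))
                             (cpowR (INR (S n)) (Copp s)))
       (D s)).

(* Main.v *)
Require Import Defs.
From Stdlib Require Import Reals ZArith List Lra Lia.
From Stdlib Require Import Classical ClassicalEpsilon FunctionalExtensionality.
From Coquelicot Require Import Coquelicot.
Open Scope R_scope.

(** Let N = l q and let A_n(w) = w(w+1)...(w+n-1)/n! be the Taylor coefficients of (1-z)^(-w); Gauss's
    formula says A_n(w) n^(1-w) -> 1/Gamma(w).  For Re w < 0, a discrete Fourier transform over the
    N m-th roots of unity expresses the sum of A_(m n)(w) over n = u mod N as a finite sum of values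
    (1 - zeta)^(-w), which is entire in w.  After multiplication by m^(1-w) and as m -> oo, the
    left-hand side tends to (1/Gamma(w)) sum n^(w-1) over n = u mod N when Re w < 0, and the finite sum
    tends to (1/N) sum_k (2 pi k/N)^(-w) (e(w/4) e(-u k/N) + e(-w/4) e(u k/N)) when Re w > 1.  Both
    limits are uniform on vertical lines against a Gaussian weight, so by the three lines theorem the
    finite sums converge to an entire function of w: this is Hurwitz's formula, with neither Gamma
    integrals nor contour deformations.

    Let T(s) be the sum over u, v mod N of psi(u) e(h u v/N) times these entire functions at
    w = 1 + xi - s (class u) and w = 1 - s (class v).  Far to the right,
    T(s) = D1(s) / (Gamma(1-s) Gamma(1+xi-s)); far to the left, orthogonality of additive characters
    turns T(s) into the combination of D2 and D3.  The identity theorem spreads both equalities.  The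
    continuations are only assumed complex differentiable, so it is derived from Goursat's lemma. *)

(** The obstacle is the strip between the two half-planes: the series side of a finite sum is
    controlled for [Re w <= -1], the dual side for [3 <= Re w], and neither says anything in
    between. Interpolation works because each approximation carries an explicit error, a constant
    times exp(10(1 + |w|^2))/m. A difference of two finite sums is entire, so multiplying by exp(20
    w^2), whose modulus decays like exp(-20 (Im w)^2), spreads a bound O(1/m + 1/m') from two
    vertical lines to the strip, hence to discs.

    Working with 1/Gamma keeps both factors entire, so no residue is computed; poles matter only
    when the Gamma factors are divided out at the end. The Estermann function is a double series
    over a divisor and its cofactor, and apart from the two powers its terms depend only on their
    classes mod N. It therefore splits into products of partial zeta functions, and finite Fourier
    analysis does the rest. In a product of two dual series the four choices of signs give the four
    exponential factors: opposite signs lead to [hbar], equal signs to [- hbar]. *)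

Lemma Ceq (x y : C) : Re x = Re y -> Im x = Im y -> x = y.
Proof. destruct x, y; simpl; intros; subst; reflexivity. Qed.

Lemma INR_ge1 n : (1 <= n)%nat -> 1 <= INR n.
Proof. exact (le_INR 1 n). Qed.

Lemma inv_INR_pos n : (1 <= n)%nat -> 0 < / INR n.
Proof. intros h. now apply Rinv_0_lt_compat, lt_0_INR. Qed.

Lemma lt_Rmin x a b : x < Rmin a b -> x < a /\ x < b.
Proof.
  intros h. split; eapply Rlt_le_trans; [exact h|apply Rmin_l|exact h|apply Rmin_r].
Qed.

Lemma Cmod_diag (z : C) : Cmod (z - z) = 0.
Proof. replace (z - z)%C with (RtoC 0) by ring. apply Cmod_0. Qed.

Lemma Cmod_le_abs (z : C) : Cmod z <= Rabs (Re z) + Rabs (Im z).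
Proof.
  assert (H : z = (RtoC (Re z) + RtoC (Im z) * Ci)%C) by (apply Ceq; simpl; ring).
  rewrite H at 1. eapply Rle_trans; [apply Cmod_triangle|].
  rewrite Cmod_mult, Cmod_Ci, !Cmod_R. lra.
Qed.

Lemma im_le_Cmod (z : C) : Rabs (Im z) <= Cmod z.
Proof. eapply Rle_trans; [|apply Rmax_Cmod]; apply Rmax_r. Qed.

Lemma Cmod_sub_sym (x y : C) : Cmod (x - y) = Cmod (y - x).
Proof. rewrite <- Cmod_opp. f_equal. ring. Qed.

Lemma Cmod_sub_ge (x y : C) : Cmod x - Cmod y <= Cmod (x - y).
Proof.
  assert (H := Cmod_triangle (x - y) y). replace (x - y + y)%C with x in H by ring. lra.
Qed.

Lemma Cmod_sub_le (x y : C) : Cmod (x - y) <= Cmod x + Cmod y.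
Proof. unfold Cminus. rewrite <- (Cmod_opp y). apply Cmod_triangle. Qed.

Lemma Cmod_sub_tri (x y z : C) : Cmod (x - z) <= Cmod (x - y) + Cmod (y - z).
Proof.
  replace (x - z)%C with ((x - y) + (y - z))%C by ring. apply Cmod_triangle.
Qed.

Lemma C_sub_0 (x y : C) : (x - y)%C = RtoC 0 -> x = y.
Proof. intros H. replace x with (x - y + y)%C by ring. rewrite H. ring. Qed.

Lemma C_eq_eps (x y : C) : (forall eps, 0 < eps -> Cmod (x - y) <= eps) -> x = y.
Proof.
  intros H. apply C_sub_0, Cmod_eq_0.
  destruct (Rle_lt_or_eq_dec _ _ (Cmod_ge_0 (x - y))) as [h|h]; [|auto].
  specialize (H (Cmod (x - y) / 2) ltac:(lra)). lra.
Qed.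

(** * Continuity and complex differentiability *)

(** Stated with [Cmod] discs, as in [ex_derive] over [C_AbsRing]. Integrals and series use the
    product structure on C instead; the passage between the two is confined to a few lemmas. *)
Definition cont (f : C -> C) (z : C) : Prop :=
  forall eps, 0 < eps -> exists d, 0 < d /\
    forall w, Cmod (w - z) < d -> Cmod (f w - f z) < eps.

Lemma cont_const c z : cont (fun _ => c) z.
Proof.
  intros e he. exists 1; split; [lra|]. intros w _.
  now rewrite Cmod_diag.
Qed.

Lemma cont_id z : cont (fun w => w) z.
Proof. intros e he. exists e; split; [lra|]. auto. Qed.

Lemma cont_plus f g z : cont f z -> cont g z -> cont (fun w => f w + g w)%C z.
Proof.
  intros hf hg e he.
  destruct (hf (e/2) ltac:(lra)) as [d1 [hd1 h1]].
  destruct (hg (e/2) ltac:(lra)) as [d2 [hd2 h2]].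
  exists (Rmin d1 d2); split; [now apply Rmin_pos|]. intros w hw.
  specialize (h1 w (Rlt_le_trans _ _ _ hw (Rmin_l _ _))).
  specialize (h2 w (Rlt_le_trans _ _ _ hw (Rmin_r _ _))).
  replace (f w + g w - (f z + g z))%C with ((f w - f z) + (g w - g z))%C by ring.
  eapply Rle_lt_trans; [apply Cmod_triangle|lra].
Qed.

Lemma cont_mult f g z : cont f z -> cont g z -> cont (fun w => f w * g w)%C z.
Proof.
  intros hf hg e he.
  set (A := Cmod (f z)). set (B := Cmod (g z)).
  assert (hA : 0 <= A) by apply Cmod_ge_0. assert (hB : 0 <= B) by apply Cmod_ge_0.
  set (k := Rmin 1 (e / (A + B + 2))).
  assert (hk : 0 < k) by (apply Rmin_pos; [lra|apply Rdiv_lt_0_compat; lra]).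
  assert (hk1 : k <= 1) by apply Rmin_l.
  assert (hk2 : k * (A + B + 2) <= e).
  { assert (k <= e / (A + B + 2)) by apply Rmin_r.
    apply Rmult_le_compat_r with (r := A + B + 2) in H; [|lra].
    replace (e / (A + B + 2) * (A + B + 2)) with e in H by (field; lra). lra. }
  destruct (hf k hk) as [d1 [hd1 h1]].
  destruct (hg k hk) as [d2 [hd2 h2]].
  exists (Rmin d1 d2); split; [now apply Rmin_pos|]. intros w hw.
  specialize (h1 w (Rlt_le_trans _ _ _ hw (Rmin_l _ _))).
  specialize (h2 w (Rlt_le_trans _ _ _ hw (Rmin_r _ _))).
  replace (f w * g w - f z * g z)%C with
    ((f w - f z) * (g w - g z) + ((f w - f z) * g z + f z * (g w - g z)))%C by ring.
  eapply Rle_lt_trans; [apply Cmod_triangle|].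
  eapply Rle_lt_trans; [apply Rplus_le_compat_l, Cmod_triangle|].
  rewrite !Cmod_mult. fold A B.
  assert (0 <= Cmod (f w - f z)) by apply Cmod_ge_0.
  assert (0 <= Cmod (g w - g z)) by apply Cmod_ge_0.
  nra.
Qed.

Lemma cont_inv f z : cont f z -> f z <> 0 -> cont (fun w => / f w)%C z.
Proof.
  intros hf hz e he.
  assert (hA : 0 < Cmod (f z)) by now apply Cmod_gt_0.
  set (A := Cmod (f z)) in *.
  destruct (hf (Rmin (A / 2) (e * (A * A / 2)))) as [d [hd h]].
  { apply Rmin_pos; [lra|]. apply Rmult_lt_0_compat; nra. }
  exists d; split; [auto|]. intros w hw. specialize (h w hw).
  destruct (lt_Rmin _ _ _ h) as [h1 h2].
  assert (h3 : A / 2 < Cmod (f w)).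
  { assert (h3 := Cmod_sub_ge (f z) (f w)). rewrite Cmod_sub_sym in h3. fold A in h3. lra. }
  assert (hw0 : f w <> 0) by (apply Cmod_gt_0; lra).
  replace (/ f w - / f z)%C with (- (f w - f z) / (f w * f z))%C by (field; auto).
  rewrite Cmod_div by (now apply Cmult_neq_0). rewrite Cmod_opp, Cmod_mult. fold A.
  apply Rmult_lt_reg_r with (Cmod (f w) * A); [nra|].
  unfold Rdiv. rewrite Rmult_assoc, Rinv_l by nra. rewrite Rmult_1_r.
  eapply Rlt_trans; [exact h2|].
  apply Rmult_lt_compat_l; nra.
Qed.

Lemma cont_comp f g z : cont g z -> cont f (g z) -> cont (fun w => f (g w)) z.
Proof.
  intros hg hf e he. destruct (hf e he) as [d [hd h]].
  destruct (hg d hd) as [d' [hd' h']]. exists d'; split; auto.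
Qed.

Lemma cont_ext f g z : (forall w, f w = g w) -> cont f z -> cont g z.
Proof. intros h. now rewrite (functional_extensionality f g h). Qed.

(* Caratheodory's form of complex differentiability. *)
Definition holo (f : C -> C) (z : C) : Prop :=
  exists phi : C -> C, cont phi z /\ forall w, f w = (f z + phi w * (w - z))%C.

(** The difference quotient, completed by [l] at the point itself, is the required continuous
    factor. *)
Lemma holo_of_eps f z (l : C) :
  (forall eps, 0 < eps -> exists d, 0 < d /\ forall w, Cmod (w - z) < d ->
     Cmod (f w - f z - l * (w - z)) <= eps * Cmod (w - z)) -> holo f z.
Proof.
  intros H.
  exists (fun w => if excluded_middle_informative (w = z) then l else (f w - f z) / (w - z))%C.
  split.
  - intros e he. destruct (H (e/2) ltac:(lra)) as [d [hd h]]. exists d; split; auto.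
    intros w hw. destruct (excluded_middle_informative (z = z)) as [_|]; [|congruence].
    destruct (excluded_middle_informative (w = z)) as [|hwz].
    + rewrite Cmod_diag; lra.
    + assert (h0 : (w - z)%C <> 0) by (intros h0; apply hwz; now apply C_sub_0).
      replace ((f w - f z) / (w - z) - l)%C with ((f w - f z - l * (w - z)) / (w - z))%C
        by (field; auto).
      rewrite Cmod_div by auto.
      assert (h1 : 0 < Cmod (w - z)) by now apply Cmod_gt_0.
      apply Rle_lt_trans with (e/2); [|lra].
      apply Rmult_le_reg_r with (Cmod (w - z)); auto.
      unfold Rdiv. rewrite Rmult_assoc, Rinv_l by lra. rewrite Rmult_1_r. now apply h.
  - intros w. destruct (excluded_middle_informative (w = z)) as [->|hwz]; [ring|].
    field. intros h0; apply hwz; now apply C_sub_0.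
Qed.

Lemma holo_eps f z : holo f z -> exists l : C,
  forall eps, 0 < eps -> exists d, 0 < d /\ forall w, Cmod (w - z) < d ->
     Cmod (f w - f z - l * (w - z)) <= eps * Cmod (w - z).
Proof.
  intros [phi [hc hphi]]. exists (phi z). intros e he.
  destruct (hc e he) as [d [hd h]]. exists d; split; auto. intros w hw.
  rewrite (hphi w).
  replace (f z + phi w * (w - z) - f z - phi z * (w - z))%C
    with ((phi w - phi z) * (w - z))%C by ring.
  rewrite Cmod_mult. apply Rmult_le_compat_r; [apply Cmod_ge_0|].
  apply Rlt_le, h, hw.
Qed.

Lemma holo_cont f z : holo f z -> cont f z.
Proof.
  intros [phi [hc hphi]].
  apply cont_ext with (fun w => f z + phi w * (w - z))%C; [intros; symmetry; apply hphi|].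
  apply cont_plus; [apply cont_const|]. apply cont_mult; auto.
  apply cont_plus; [apply cont_id|apply cont_const].
Qed.

Lemma holo_const c z : holo (fun _ => c) z.
Proof. exists (fun _ => RtoC 0). split; [apply cont_const|]. intros; ring. Qed.

Lemma holo_id z : holo (fun w => w) z.
Proof. exists (fun _ => RtoC 1). split; [apply cont_const|]. intros; ring. Qed.

Lemma holo_plus f g z : holo f z -> holo g z -> holo (fun w => f w + g w)%C z.
Proof.
  intros [p [hp h]] [p' [hp' h']]. exists (fun w => p w + p' w)%C.
  split; [now apply cont_plus|]. intros w. rewrite (h w), (h' w). ring.
Qed.

Lemma holo_mult f g z : holo f z -> holo g z -> holo (fun w => f w * g w)%C z.
Proof.
  intros hf hg. assert (cf := holo_cont _ _ hf).
  destruct hf as [p [hp h]], hg as [p' [hp' h']].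
  exists (fun w => p w * g z + f w * p' w)%C.
  split.
  - apply cont_plus; apply cont_mult; auto. apply cont_const.
  - intros w. rewrite (h' w), (h w). ring.
Qed.

(** The natural factor -p(w)/(f(w) f(z)) satisfies the global identity only where [f] does not
    vanish, because of the default value of the inverse at 0. Passing through [holo_of_eps]
    restricts the check to a disc free of zeros. *)
Lemma holo_inv f z : holo f z -> f z <> 0 -> holo (fun w => / f w)%C z.
Proof.
  intros hf hz. destruct (holo_eps _ _ hf) as [l hl].
  assert (hi := cont_inv _ _ (holo_cont _ _ hf) hz).
  destruct (holo_cont _ _ hf (Cmod (f z)) ltac:(now apply Cmod_gt_0)) as [d0 [hd0 h0]].
  assert (hnz : forall w, Cmod (w - z) < d0 -> f w <> 0).
  { intros w hw hz0. specialize (h0 w hw). rewrite hz0 in h0.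
    replace (0 - f z)%C with (- f z)%C in h0 by ring. rewrite Cmod_opp in h0. lra. }
  destruct hf as [p [hp h]].
  assert (hq : cont (fun w => - (p w) * (/ f w * / f z))%C z).
  { apply cont_mult; [|apply cont_mult; auto; apply cont_const].
    apply cont_ext with (fun w => (-1) * p w)%C; [intros; ring|].
    apply cont_mult; auto; apply cont_const. }
  apply holo_of_eps with (- (p z) * (/ f z * / f z))%C.
  intros e he. destruct (hq e he) as [d [hd hh]].
  exists (Rmin d d0); split; [now apply Rmin_pos|]. intros w hw.
  specialize (hh w (Rlt_le_trans _ _ _ hw (Rmin_l _ _))).
  specialize (hnz w (Rlt_le_trans _ _ _ hw (Rmin_r _ _))).
  replace (/ f w - / f z)%C with ((- p w * (/ f w * / f z)) * (w - z))%C.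
  2:{ assert (hh' := h w). replace (p w * (w-z))%C with (f w - f z)%C.
      - transitivity (- (p w * (w - z)) * (/ f w * / f z))%C; [ring|].
        replace (p w * (w-z))%C with (f w - f z)%C by (rewrite hh' at 1; ring).
        field; auto.
      - rewrite hh' at 1; ring. }
  match goal with |- Cmod ?x <= _ => replace x with
    ((- p w * (/ f w * / f z) - - p z * (/ f z * / f z)) * (w - z))%C by ring end.
  rewrite Cmod_mult. apply Rmult_le_compat_r; [apply Cmod_ge_0|lra].
Qed.

Lemma holo_comp f g z : holo g z -> holo f (g z) -> holo (fun w => f (g w)) z.
Proof.
  intros hg hf. assert (cg := holo_cont _ _ hg).
  destruct hg as [p [hp h]], hf as [p' [hp' h']].
  exists (fun w => p' (g w) * p w)%C. split.
  - apply cont_mult; auto. now apply cont_comp.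
  - intros w. rewrite (h' (g w)).
    replace (g w - g z)%C with (p w * (w - z))%C by (rewrite (h w); ring). ring.
Qed.

Lemma holo_ext f g z : (forall w, f w = g w) -> holo f z -> holo g z.
Proof. intros h. now rewrite (functional_extensionality f g h). Qed.

Lemma holo_loc f g z d : 0 < d -> (forall w, Cmod (w - z) < d -> f w = g w) ->
  holo f z -> holo g z.
Proof.
  intros hd heq hf. destruct (holo_eps _ _ hf) as [l hl]. apply holo_of_eps with l.
  intros e he. destruct (hl e he) as [d' [hd' h]].
  exists (Rmin d d'); split; [now apply Rmin_pos|]. intros w hw.
  rewrite <- !heq.
  - apply h. eapply Rlt_le_trans; [exact hw|apply Rmin_r].
  - rewrite Cmod_diag; lra.
  - eapply Rlt_le_trans; [exact hw|apply Rmin_l].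
Qed.

Lemma holo_opp f z : holo f z -> holo (fun w => - f w)%C z.
Proof.
  intros h. apply holo_ext with (fun w => (-1) * f w)%C; [intros; ring|].
  apply holo_mult; auto; apply holo_const.
Qed.

Lemma holo_minus f g z : holo f z -> holo g z -> holo (fun w => f w - g w)%C z.
Proof. intros hf hg. apply holo_plus; auto. now apply holo_opp. Qed.

Lemma holo_pow f z n : holo f z -> holo (fun w => f w ^ n)%C z.
Proof.
  intros h. induction n.
  - apply holo_ext with (fun _ => RtoC 1); [intros; reflexivity|apply holo_const].
  - apply holo_ext with (fun w => f w * f w ^ n)%C; [intros; reflexivity|].
    now apply holo_mult.
Qed.

Lemma ex_derive_holo (f : C -> C) (z : C) :
  @ex_derive C_AbsRing C_NormedModule f z -> holo f z.
Proof.
  intros [l hl]. apply holo_of_eps with l. intros e he.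
  destruct hl as [_ hl].
  (* The domination in [is_derive] is stated at every limit of the neighbourhood filter of [z]; the
     identity shows that [z] is one. *)
  specialize (hl z (fun P H => H)).
  specialize (hl (mkposreal e he)).
  destruct hl as [d hd].
  exists d. split; [apply cond_pos|]. intros w hw.
  assert (hb : @ball (AbsRing_UniformSpace C_AbsRing) z d w) by exact hw.
  specialize (hd w hb).
  unfold minus, plus, opp, scal in hd; simpl in hd. unfold norm in hd; simpl in hd.
  unfold mult in hd; simpl in hd.
  replace (f w - f z - l * (w - z))%C with (f w + - f z + - ((w + - z) * l))%C by ring.
  exact hd.
Qed.

(** * Integrals along segments *)

(** The integrand is a function on C restricted to the unit segment, so that a single notion of
    continuity serves throughout. *)
Definition cint (F : C -> C) : C :=
  RInt (V := C_R_CompleteNormedModule) (fun t : R => F (RtoC t)) 0 1.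

Definition cont_unit (F : C -> C) : Prop := forall t : R, 0 <= t <= 1 -> cont F (RtoC t).

Lemma cont_unit_ex_RInt F a b : cont_unit F -> 0 <= a <= 1 -> 0 <= b <= 1 ->
  ex_RInt (V := C_R_NormedModule) (fun t : R => F (RtoC t)) a b.
Proof.
  intros h ha hb.
  apply (ex_RInt_continuous (V := C_R_CompleteNormedModule)). intros t ht.
  assert (ht1 : 0 <= t <= 1).
  { split; [apply Rle_trans with (Rmin a b)|apply Rle_trans with (Rmax a b)]; try apply ht;
    [apply Rmin_glb|apply Rmax_lub]; lra. }
  apply filterlim_locally. intros eps.
  destruct (h t ht1 eps (cond_pos eps)) as [d [hd hh]].
  exists (mkposreal d hd). intros t' ht'.
  assert (hbd : Cmod (RtoC t' - RtoC t) < d).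
  { rewrite <- RtoC_minus, Cmod_R. exact ht'. }
  specialize (hh _ hbd).
  split; (eapply Rle_lt_trans; [|exact hh]).
  - apply (re_le_Cmod (F (RtoC t') - F (RtoC t))).
  - apply (im_le_Cmod (F (RtoC t') - F (RtoC t))).
Qed.

Lemma cint_is F : cont_unit F ->
  is_RInt (V := C_R_NormedModule) (fun t : R => F (RtoC t)) 0 1 (cint F).
Proof.
  intros h. apply (RInt_correct (V := C_R_CompleteNormedModule)).
  apply cont_unit_ex_RInt; auto; lra.
Qed.

Lemma cint_uniq F l :
  is_RInt (V := C_R_NormedModule) (fun t : R => F (RtoC t)) 0 1 l -> cint F = l.
Proof. intros h. now apply (is_RInt_unique (V := C_R_CompleteNormedModule)). Qed.

Lemma cint_ext F G : (forall t : R, 0 <= t <= 1 -> F (RtoC t) = G (RtoC t)) ->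
  cint F = cint G.
Proof.
  intros h. apply (RInt_ext (V := C_R_CompleteNormedModule)).
  rewrite Rmin_left, Rmax_right by lra. intros; apply h; lra.
Qed.

Lemma cint_plus F G : cont_unit F -> cont_unit G -> cint (fun z => F z + G z)%C = (cint F + cint G)%C.
Proof.
  intros hF hG. apply cint_uniq.
  apply (is_RInt_plus (V := C_R_NormedModule)); now apply cint_is.
Qed.

(** A complex factor is not a scalar of the real normed module in which the integral lives, so the
    two real components are combined by hand. *)
Lemma cint_scal c F : cont_unit F -> cint (fun z => c * F z)%C = (c * cint F)%C.
Proof.
  intros hF. apply cint_uniq. assert (h := cint_is F hF).
  assert (h1 := is_RInt_fct_extend_fst (U := R_NormedModule) (V := R_NormedModule) _ _ _ _ h).
  assert (h2 := is_RInt_fct_extend_snd (U := R_NormedModule) (V := R_NormedModule) _ _ _ _ h).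
  assert (k : forall a b, is_RInt (V := R_NormedModule)
     (fun t => a * fst (F (RtoC t)) + b * snd (F (RtoC t))) 0 1
     (a * fst (cint F) + b * snd (cint F))).
  { intros a b. apply (is_RInt_plus (V := R_NormedModule));
    now apply (is_RInt_scal (V := R_NormedModule)). }
  replace (c * cint F)%C with
    (fst c * fst (cint F) + - snd c * snd (cint F), snd c * fst (cint F) + fst c * snd (cint F))
    by (apply Ceq; simpl; ring).
  apply (is_RInt_fct_extend_pair (U := R_NormedModule) (V := R_NormedModule)).
  - eapply is_RInt_ext; [|apply (k (fst c) (- snd c))]. intros; simpl; ring.
  - eapply is_RInt_ext; [|apply (k (snd c) (fst c))]. intros; simpl; ring.
Qed.

Lemma cint_bound F M : cont_unit F -> (forall t : R, 0 <= t <= 1 -> Cmod (F (RtoC t)) <= M) ->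
  Cmod (cint F) <= M.
Proof.
  intros hF hM. rewrite Cmod_norm.
  replace M with ((1 - 0) * M) by ring.
  apply (norm_RInt_le_const (V := C_R_NormedModule) (fun t => F (RtoC t)) 0 1); [lra| |now apply cint_is].
  intros t ht. specialize (hM t ht). rewrite Cmod_norm in hM. exact hM.
Qed.

Lemma cint_Im_ge F m : cont_unit F -> (forall t : R, 0 <= t <= 1 -> m <= Im (F (RtoC t))) ->
  m <= Im (cint F).
Proof.
  intros hF hm.
  assert (h2 := is_RInt_fct_extend_snd (U := R_NormedModule) (V := R_NormedModule) _ _ _ _ (cint_is F hF)).
  replace m with ((1 - 0) * m) by ring.
  apply (is_RInt_le (fun _ => m) (fun t => Im (F (RtoC t))) 0 1); [lra| |exact h2|].
  - apply (is_RInt_const (V := R_NormedModule) 0 1 m).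
  - intros; apply hm; lra.
Qed.

Lemma cont_unit_affine F a b : (forall t, 0 <= t <= 1 -> 0 <= a * t + b <= 1) -> cont_unit F ->
  cont_unit (fun z => F (RtoC a * z + RtoC b)%C).
Proof.
  intros hab hF t ht. apply (cont_comp F).
  - apply cont_plus; [apply cont_mult; [apply cont_const|apply cont_id]|apply cont_const].
  - rewrite <- RtoC_mult, <- RtoC_plus. apply hF, hab, ht.
Qed.

Lemma cint_lin F u v : cont_unit F -> 0 <= v <= 1 -> 0 <= u + v <= 1 ->
  (RtoC u * cint (fun z => F (RtoC u * z + RtoC v)))%C =
  RInt (V := C_R_CompleteNormedModule) (fun t : R => F (RtoC t)) v (u + v).
Proof.
  intros hF hv huv.
  assert (hc : cont_unit (fun z => F (RtoC u * z + RtoC v)%C)).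
  { apply cont_unit_affine; auto. intros; nra. }
  rewrite <- cint_scal by auto.
  assert (h := RInt_comp_lin (V := C_R_CompleteNormedModule) (fun t : R => F (RtoC t)) u v 0 1).
  rewrite Rmult_0_r, Rmult_1_r, Rplus_0_l in h. rewrite <- h by (apply cont_unit_ex_RInt; auto).
  apply (RInt_ext (V := C_R_CompleteNormedModule)). intros x _.
  rewrite RtoC_plus, RtoC_mult. symmetry. apply scal_R_Cmult.
Qed.

Lemma RtoC_m1 : RtoC (-1) = (- (1))%C.
Proof. apply Ceq; simpl; ring. Qed.

Lemma RtoC2_neq0 : RtoC 2 <> 0.
Proof. intros h; apply (f_equal fst) in h; simpl in h; lra. Qed.

Lemma cint_rev F : cont_unit F -> cint (fun z => F (1 - z)%C) = cint F.
Proof.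
  intros hF. assert (h := cint_lin F (-1) 1 hF ltac:(lra) ltac:(lra)).
  replace (-1 + 1) with 0 in h by ring.
  assert (h2 : RInt (V := C_R_CompleteNormedModule) (fun t : R => F (RtoC t)) 1 0 = (- cint F)%C).
  { apply (is_RInt_unique (V := C_R_CompleteNormedModule)).
    apply (is_RInt_swap (V := C_R_NormedModule)). now apply cint_is. }
  rewrite h2 in h.
  rewrite (cint_ext _ (fun z => F (RtoC (-1) * z + RtoC 1)%C)).
  - replace (cint F) with (- (RtoC (-1) * cint (fun z => F (RtoC (-1) * z + RtoC 1))))%C
      by (rewrite h; ring).
    rewrite RtoC_m1. ring.
  - intros t _. f_equal. rewrite RtoC_m1. ring.
Qed.

Lemma cint_mid F : cont_unit F ->
  cint F = (/ 2 * cint (fun z => F (/ 2 * z)) + / 2 * cint (fun z => F (/ 2 * z + / 2)))%C.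
Proof.
  intros hF.
  assert (h0 := cint_lin F (/2) 0 hF ltac:(lra) ltac:(lra)).
  assert (h1 := cint_lin F (/2) (/2) hF ltac:(lra) ltac:(lra)).
  rewrite Rplus_0_r in h0. replace (/2 + /2) with 1 in h1 by field.
  assert (h := RInt_Chasles (V := C_R_CompleteNormedModule) (fun t : R => F (RtoC t)) 0 (/2) 1
    ltac:(apply cont_unit_ex_RInt; auto; lra) ltac:(apply cont_unit_ex_RInt; auto; lra)).
  rewrite <- h0, <- h1 in h. unfold cint at 1. rewrite <- h.
  rewrite RtoC_inv by lra.
  rewrite (cint_ext (fun z => F (/ 2 * z + 0)%C) (fun z => F (/ 2 * z)%C)); [reflexivity|].
  intros t _. f_equal. ring.
Qed.

Lemma cint_const c : cint (fun _ => c) = c.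
Proof.
  apply cint_uniq.
  assert (h := is_RInt_const (V := C_R_NormedModule) 0 1 c).
  assert (E : scal (V := C_R_NormedModule) (1 - 0) c = c).
  { rewrite Rminus_0_r. apply (scal_one (V := C_R_NormedModule)). }
  exact (eq_ind _ (fun l : C => is_RInt (V := C_R_NormedModule) (fun _ => c) 0 1 l) h _ E).
Qed.

Lemma cont_unit_of F : (forall z, cont F z) -> cont_unit F.
Proof. intros h t _; apply h. Qed.

(** The reflection t -> 1 - t gives I = 1 - I, which avoids a primitive. *)
Lemma cint_id : cint (fun z => z) = (/ 2)%C.
Proof.
  assert (h := cint_rev (fun z => z) (cont_unit_of _ cont_id)).
  rewrite (cint_ext _ (fun z => 1 + (-1) * z)%C) in h by (intros; ring).
  rewrite cint_plus, cint_scal, cint_const in h; try apply cont_unit_of; intros;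
    repeat first [apply cont_const|apply cont_id|apply cont_mult].
  assert (h' : (2 * cint (fun z => z) = 1)%C).
  { transitivity (cint (fun z => z) + cint (fun z => z))%C; [ring|]. rewrite <- h at 1. ring. }
  transitivity (/ 2 * (2 * cint (fun z => z)))%C; [field; apply RtoC2_neq0|rewrite h'; ring].
Qed.

Definition seg_int (f : C -> C) (a b : C) : C :=
  cint (fun t => (b - a) * f (a + t * (b - a)))%C.

Definition cont_seg (f : C -> C) (a b : C) : Prop :=
  forall t : R, 0 <= t <= 1 -> cont f (a + t * (b - a))%C.

Lemma cont_seg_unit f a b : cont_seg f a b -> cont_unit (fun t => f (a + t * (b - a)))%C.
Proof.
  intros h t ht. apply (cont_comp f); [|now apply h].
  apply cont_plus; [apply cont_const|apply cont_mult; [apply cont_id|apply cont_const]].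
Qed.

Lemma cont_seg_unit_scal f a b : cont_seg f a b -> cont_unit (fun t => (b - a) * f (a + t * (b - a)))%C.
Proof.
  intros h t ht. apply cont_mult; [apply cont_const|]. now apply (cont_seg_unit f a b).
Qed.

Lemma seg_int_rev f a b : cont_seg f a b -> seg_int f b a = (- seg_int f a b)%C.
Proof.
  intros h. unfold seg_int.
  rewrite <- (cint_rev (fun t => (b - a) * f (a + t * (b - a)))%C) by (now apply cont_seg_unit_scal).
  replace (- cint (fun z => (b - a) * f (a + (1 - z) * (b - a))))%C
    with ((-1) * cint (fun z => (b - a) * f (a + (1 - z) * (b - a))))%C by ring.
  assert (hc : cont_unit (fun z => (b - a) * f (a + (1 - z) * (b - a)))%C).
  { intros t ht. apply cont_mult; [apply cont_const|]. apply (cont_comp f).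
    - apply cont_plus; [apply cont_const|]. apply cont_mult; [|apply cont_const].
      apply cont_ext with (fun w => 1 + (-1) * w)%C; [intros; ring|].
      apply cont_plus; [apply cont_const|apply cont_mult; [apply cont_const|apply cont_id]].
    - rewrite <- RtoC_minus. apply h; lra. }
  rewrite <- cint_scal by auto. apply cint_ext. intros t _.
  replace (a + (1 - t) * (b - a))%C with (b + t * (a - b))%C by ring. ring.
Qed.

Lemma seg_int_mid f a b : cont_seg f a b ->
  seg_int f a b = (seg_int f a ((a + b) / 2) + seg_int f ((a + b) / 2) b)%C.
Proof.
  intros h. unfold seg_int.
  assert (h2 := RtoC2_neq0).
  assert (hc := cont_seg_unit_scal f a b h).
  assert (i2 : (/ 2)%C = RtoC (/ 2)) by (rewrite RtoC_inv by lra; reflexivity).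
  assert (r1 : forall t, 0 <= t <= 1 -> 0 <= / 2 * t + 0 <= 1) by (intros; lra).
  assert (r2 : forall t, 0 <= t <= 1 -> 0 <= / 2 * t + / 2 <= 1) by (intros; lra).
  assert (c1 := cont_unit_affine _ (/2) 0 r1 hc).
  assert (c2 := cont_unit_affine _ (/2) (/2) r2 hc).
  rewrite cint_mid by auto. f_equal; rewrite <- cint_scal.
  - apply cint_ext. intros t _.
    replace (a + / 2 * t * (b - a))%C with (a + t * ((a + b) / 2 - a))%C by (field; exact h2).
    field; exact h2.
  - intros t ht. eapply cont_ext; [|apply (c1 t ht)]. intros w. simpl. rewrite <- i2.
    replace (/ 2 * w + 0)%C with (/ 2 * w)%C by ring. reflexivity.
  - apply cint_ext. intros t _.
    replace (a + (/ 2 * t + / 2) * (b - a))%C with ((a + b) / 2 + t * (b - (a + b) / 2))%C by (field; exact h2).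
    field; exact h2.
  - intros t ht. eapply cont_ext; [|apply (c2 t ht)]. intros w. simpl. rewrite <- i2. reflexivity.
Qed.

Lemma seg_int_bound f a b M : cont_seg f a b ->
  (forall t : R, 0 <= t <= 1 -> Cmod (f (a + t * (b - a))%C) <= M) ->
  Cmod (seg_int f a b) <= M * Cmod (b - a).
Proof.
  intros h hM. apply cint_bound; [now apply cont_seg_unit_scal|]. intros t ht.
  rewrite Cmod_mult, Rmult_comm. apply Rmult_le_compat_r; [apply Cmod_ge_0|auto].
Qed.

Lemma seg_int_plus f g a b : cont_seg f a b -> cont_seg g a b ->
  seg_int (fun z => f z + g z)%C a b = (seg_int f a b + seg_int g a b)%C.
Proof.
  intros hf hg. unfold seg_int. rewrite <- cint_plus by (now apply cont_seg_unit_scal).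
  apply cint_ext. intros; ring.
Qed.

Lemma seg_int_scal c f a b : cont_seg f a b -> seg_int (fun z => c * f z)%C a b = (c * seg_int f a b)%C.
Proof.
  intros hf. unfold seg_int. rewrite <- cint_scal by (now apply cont_seg_unit_scal).
  apply cint_ext. intros; ring.
Qed.

Lemma seg_int_ext f g a b :
  (forall t : R, 0 <= t <= 1 -> f (a + t * (b - a))%C = g (a + t * (b - a))%C) ->
  seg_int f a b = seg_int g a b.
Proof. intros h. apply cint_ext. intros t ht. now rewrite h. Qed.

(** Differences of a primitive telescope around a closed polygon: this is why the tangent map
    disappears in Goursat's lemma. *)
Lemma seg_int_affine u v a b :
  seg_int (fun z => u + v * z)%C a b = (u * (b - a) + v * (b * b - a * a) / 2)%C.
Proof.
  unfold seg_int.
  assert (h2 := RtoC2_neq0).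
  rewrite (cint_ext _ (fun t => (b - a) * (u + v * a) + ((b - a) * (v * (b - a))) * t)%C)
    by (intros; ring).
  rewrite (cint_plus (fun _ => (b - a) * (u + v * a))%C (fun t => ((b - a) * (v * (b - a))) * t)%C),
    (cint_scal _ (fun t => t)), cint_const, cint_id; try apply cont_unit_of; intros;
    repeat first [apply cont_const|apply cont_id|apply cont_mult].
  field; auto.
Qed.

(** * Limits of complex sequences *)

Definition clim (u : nat -> C) (l : C) : Prop :=
  forall eps, 0 < eps -> exists n0, forall n, (n0 <= n)%nat -> Cmod (u n - l) < eps.

Lemma clim_cauchy (u : nat -> C) :
  (forall eps, 0 < eps -> exists n0, forall n m, (n0 <= n)%nat -> (n0 <= m)%nat ->
     Cmod (u n - u m) < eps) -> exists l, clim u l.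
Proof.
  intros H.
  assert (hr : Cauchy_crit (fun n => Re (u n))).
  { intros e he. destruct (H e he) as [n0 h]. exists n0. intros n m hn hm.
    eapply Rle_lt_trans; [apply (re_le_Cmod (u n - u m))|]. apply h; lia. }
  assert (hi : Cauchy_crit (fun n => Im (u n))).
  { intros e he. destruct (H e he) as [n0 h]. exists n0. intros n m hn hm.
    eapply Rle_lt_trans; [apply (im_le_Cmod (u n - u m))|]. apply h; lia. }
  destruct (Rcomplete.R_complete _ hr) as [x hx]. destruct (Rcomplete.R_complete _ hi) as [y hy].
  exists (x, y). intros e he.
  destruct (hx (e/2) ltac:(lra)) as [n1 h1]. destruct (hy (e/2) ltac:(lra)) as [n2 h2].
  exists (max n1 n2). intros n hn.
  eapply Rle_lt_trans; [apply Cmod_le_abs|].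
  specialize (h1 n ltac:(lia)). specialize (h2 n ltac:(lia)). unfold Rdist in *.
  change (Re (u n - (x, y))) with (Re (u n) - x). change (Im (u n - (x, y))) with (Im (u n) - y).
  lra.
Qed.

Lemma clim_le_dist (u : nat -> C) l a M :
  clim u l -> (exists n0, forall n, (n0 <= n)%nat -> Cmod (u n - a) <= M) -> Cmod (l - a) <= M.
Proof.
  intros hl [n0 h]. apply Rnot_lt_le. intros hc.
  destruct (hl (Cmod (l - a) - M) ltac:(lra)) as [n1 h1].
  specialize (h (Nat.max n0 n1) (Nat.le_max_l _ _)). specialize (h1 (Nat.max n0 n1) (Nat.le_max_r _ _)).
  assert (ht := Cmod_sub_tri l (u (Nat.max n0 n1)) a). rewrite (Cmod_sub_sym l (u _)) in ht. lra.
Qed.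

(** Tailored to the vertices of nested triangles, whose perimeters are halved at each step; the
    factor 2 is the sum of the geometric series. *)
Lemma clim_half (u : nat -> C) (P : R) :
  (forall n, Cmod (u (S n) - u n) <= P * (/ 2) ^ n) ->
  exists l, clim u l /\ forall n, Cmod (l - u n) <= 2 * P * (/ 2) ^ n.
Proof.
  intros H.
  assert (hp : forall n, 0 < (/ 2) ^ n) by (intros; apply pow_lt; lra).
  assert (hP : 0 <= P).
  { specialize (H O). assert (h := Cmod_ge_0 (u 1%nat - u O)). simpl in H. lra. }
  assert (h : forall n k, Cmod (u (n + k)%nat - u n) <= 2 * P * (/ 2) ^ n - 2 * P * (/ 2) ^ (n + k)).
  { intros n k. induction k.
    - rewrite Nat.add_0_r. replace (u n - u n)%C with (RtoC 0) by ring. rewrite Cmod_0. lra.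
    - eapply Rle_trans; [apply (Cmod_sub_tri _ (u (n + k)%nat))|].
      rewrite Nat.add_succ_r. specialize (H (n + k)%nat). simpl. lra. }
  assert (h' : forall n m, (n <= m)%nat -> Cmod (u m - u n) <= 2 * P * (/ 2) ^ n).
  { intros n m hm. replace m with (n + (m - n))%nat by lia. eapply Rle_trans; [apply h|].
    specialize (hp (n + (m - n))%nat). nra. }
  destruct (clim_cauchy u) as [l hl].
  - intros e he.
    destruct (pow_lt_1_zero (/2) ltac:(rewrite Rabs_pos_eq; lra) (e / (4 * P + 1)))
      as [n0 hn0]; [apply Rdiv_lt_0_compat; lra|].
    exists n0. intros n m hn hm.
    specialize (hn0 n0 (le_n _)). rewrite Rabs_pos_eq in hn0 by (apply Rlt_le, hp).
    apply Rmult_lt_compat_r with (r := 4 * P + 1) in hn0; [|lra].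
    replace (e / (4 * P + 1) * (4 * P + 1)) with e in hn0 by (field; lra).
    assert (a1 := h' n0 n hn). assert (a2 := h' n0 m hm).
    assert (a3 := Cmod_sub_tri (u n) (u n0) (u m)). rewrite (Cmod_sub_sym (u n0) (u m)) in a3.
    specialize (hp n0). nra.
  - exists l. split; auto. intros n. apply (clim_le_dist u); auto. exists n. intros; now apply h'.
Qed.

(** * Goursat's lemma and Cauchy's formula for rectangles *)

Definition rect (x1 x2 y1 y2 : R) (z : C) : Prop :=
  x1 <= Re z <= x2 /\ y1 <= Im z <= y2.

Lemma rect_seg x1 x2 y1 y2 a b t : rect x1 x2 y1 y2 a -> rect x1 x2 y1 y2 b ->
  0 <= t <= 1 -> rect x1 x2 y1 y2 (a + RtoC t * (b - a))%C.
Proof.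
  intros [ha1 ha2] [hb1 hb2] ht. unfold rect. destruct a as [ax ay], b as [bx by_]; simpl in *.
  repeat split; nra.
Qed.

Lemma rect_cont_seg x1 x2 y1 y2 f a b : (forall z, rect x1 x2 y1 y2 z -> cont f z) ->
  rect x1 x2 y1 y2 a -> rect x1 x2 y1 y2 b -> cont_seg f a b.
Proof. intros h ha hb t ht. apply h. now apply rect_seg. Qed.

Lemma rect_mid x1 x2 y1 y2 a b : rect x1 x2 y1 y2 a -> rect x1 x2 y1 y2 b ->
  rect x1 x2 y1 y2 ((a + b) / 2)%C.
Proof.
  intros ha hb. replace ((a + b) / 2)%C with (a + RtoC (/2) * (b - a))%C.
  - apply rect_seg; auto. lra.
  - rewrite RtoC_inv by lra. field.
Qed.

Lemma rect_clim x1 x2 y1 y2 u l : clim u l -> (forall n, rect x1 x2 y1 y2 (u n)) ->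
  rect x1 x2 y1 y2 l.
Proof.
  intros hl hu.
  assert (H : forall eps, 0 < eps -> rect (x1 - eps) (x2 + eps) (y1 - eps) (y2 + eps) l).
  { intros e he. destruct (hl e he) as [n h]. specialize (h n (le_n _)).
    destruct (hu n) as [h1 h2].
    assert (a1 := re_le_Cmod (u n - l)). assert (a2 := im_le_Cmod (u n - l)).
    change (Re (u n - l)) with (Re (u n) - Re l) in a1.
    change (Im (u n - l)) with (Im (u n) - Im l) in a2.
    apply Rle_lt_trans with (2 := h) in a1. apply Rle_lt_trans with (2 := h) in a2.
    apply Rabs_def2 in a1. apply Rabs_def2 in a2. unfold rect. lra. }
  unfold rect. repeat split; apply le_epsilon; intros e he; destruct (H e he); lra.
Qed.

Definition tri_int (f : C -> C) (a b c : C) : C := (seg_int f a b + seg_int f b c + seg_int f c a)%C.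

Definition perimeter (a b c : C) : R := Cmod (b - a) + Cmod (c - b) + Cmod (a - c).

Lemma perimeter_ge_0 a b c : 0 <= perimeter a b c.
Proof.
  unfold perimeter. assert (h1 := Cmod_ge_0 (b - a)). assert (h2 := Cmod_ge_0 (c - b)).
  assert (h3 := Cmod_ge_0 (a - c)). lra.
Qed.

Lemma tri_int_bound f a b c M : cont_seg f a b -> cont_seg f b c -> cont_seg f c a ->
  (forall z, Cmod (z - a) <= perimeter a b c -> Cmod (f z) <= M) -> Cmod (tri_int f a b c) <= M * perimeter a b c.
Proof.
  intros h1 h2 h3 hM. unfold tri_int.
  assert (k1 := Cmod_ge_0 (b - a)). assert (k2 := Cmod_ge_0 (c - b)).
  assert (k3 := Cmod_ge_0 (a - c)).
  assert (b1 : Cmod (seg_int f a b) <= M * Cmod (b - a)).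
  { apply seg_int_bound; auto. intros t ht. apply hM.
    replace (a + t * (b - a) - a)%C with (t * (b - a))%C by ring.
    rewrite Cmod_mult, Cmod_R, Rabs_pos_eq by lra. unfold perimeter. nra. }
  assert (b2 : Cmod (seg_int f b c) <= M * Cmod (c - b)).
  { apply seg_int_bound; auto. intros t ht. apply hM.
    replace (b + t * (c - b) - a)%C with ((b - a) + t * (c - b))%C by ring.
    eapply Rle_trans; [apply Cmod_triangle|].
    rewrite Cmod_mult, Cmod_R, Rabs_pos_eq by lra. unfold perimeter. nra. }
  assert (b3 : Cmod (seg_int f c a) <= M * Cmod (a - c)).
  { apply seg_int_bound; auto. intros t ht. apply hM.
    replace (c + t * (a - c) - a)%C with ((1 - t)%R * (c - a))%C by (rewrite RtoC_minus; ring).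
    rewrite Cmod_mult, Cmod_R, Rabs_pos_eq, (Cmod_sub_sym c) by lra. unfold perimeter. nra. }
  eapply Rle_trans; [apply Cmod_triangle|].
  assert (h := Cmod_triangle (seg_int f a b) (seg_int f b c)). unfold perimeter. lra.
Qed.

Section Goursat.
Variables (x1 x2 y1 y2 : R) (f : C -> C).
Let K := rect x1 x2 y1 y2.
Hypothesis hf : forall z, K z -> holo f z.

Let hct : forall a b, K a -> K b -> cont_seg f a b.
Proof. intros a b. apply rect_cont_seg. intros; now apply holo_cont, hf. Qed.

(** All four half-size triangles inherit the orientation of the large one, so the three inner edges
    are traversed once in each direction and cancel. *)
Lemma tri_int_split a b c : K a -> K b -> K c ->
  let m1 := ((a + b) / 2)%C in let m2 := ((b + c) / 2)%C in let m3 := ((c + a) / 2)%C in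
  tri_int f a b c = (tri_int f a m1 m3 + tri_int f m1 b m2 + tri_int f m3 m2 c + tri_int f m2 m3 m1)%C.
Proof.
  intros ha hb hc m1 m2 m3.
  assert (h1 : K m1) by now apply rect_mid.
  assert (h2 : K m2) by now apply rect_mid.
  assert (h3 : K m3) by now apply rect_mid.
  unfold tri_int. rewrite (seg_int_mid f a b), (seg_int_mid f b c), (seg_int_mid f c a) by (apply hct; auto).
  fold m1 m2 m3.
  assert (r1 : seg_int f m3 m1 = (- seg_int f m1 m3)%C) by (apply seg_int_rev, hct; auto).
  assert (r2 : seg_int f m2 m1 = (- seg_int f m1 m2)%C) by (apply seg_int_rev, hct; auto).
  assert (r3 : seg_int f m3 m2 = (- seg_int f m2 m3)%C) by (apply seg_int_rev, hct; auto).
  rewrite r1, r2, r3. ring.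
Qed.

Record triangle := { ta : C; tb : C; tc : C }.
Let inK t := K (ta t) /\ K (tb t) /\ K (tc t).
Let pr t := perimeter (ta t) (tb t) (tc t).
Let bad eps t := inK t /\ eps * (pr t * pr t) < Cmod (tri_int f (ta t) (tb t) (tc t)).

(** The threshold scales with the square of the perimeter. Four children of half the perimeter share
    exactly the threshold of the parent, so one of them must exceed its own. The bound on the
    displacement of the vertex makes the chosen triangles converge. *)
Lemma bad_child eps t : 0 < eps -> bad eps t -> exists t', bad eps t' /\ pr t' = pr t / 2 /\
  Cmod (ta t' - ta t) <= pr t.
Proof.
  destruct t as [a b c]. intros he [[ha [hb hc]] hbad]. unfold bad, inK, pr in *; simpl in *.
  set (m1 := ((a + b) / 2)%C). set (m2 := ((b + c) / 2)%C). set (m3 := ((c + a) / 2)%C).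
  assert (h1 : K m1) by now apply rect_mid.
  assert (h2 : K m2) by now apply rect_mid.
  assert (h3 : K m3) by now apply rect_mid.
  assert (hs := tri_int_split a b c ha hb hc). simpl in hs. fold m1 m2 m3 in hs.
  set (P := perimeter a b c) in *.
  assert (half : forall z w : C, z = (w / 2)%C -> Cmod z = Cmod w / 2).
  { intros z w ->. rewrite Cmod_div by apply RtoC2_neq0. rewrite Cmod_R, Rabs_pos_eq; lra. }
  assert (half' : forall z w : C, z = (- (w / 2))%C -> Cmod z = Cmod w / 2).
  { intros z w ->. rewrite Cmod_opp. now apply half. }
  assert (d1 := Cmod_ge_0 (b - a)). assert (d2 := Cmod_ge_0 (c - b)). assert (d3 := Cmod_ge_0 (a - c)).
  assert (p2 := RtoC2_neq0).
  assert (q1 : perimeter a m1 m3 = P / 2).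
  { unfold P, perimeter. rewrite (half (m1 - a)%C (b - a)%C), (half (m3 - m1)%C (c - b)%C), (half (a - m3)%C (a - c)%C);
      [lra|unfold m1, m3; field; auto ..]. }
  assert (q2 : perimeter m1 b m2 = P / 2).
  { unfold P, perimeter. rewrite (half (b - m1)%C (b - a)%C), (half (m2 - b)%C (c - b)%C), (half (m1 - m2)%C (a - c)%C);
      [lra|unfold m1, m2; field; auto ..]. }
  assert (q3 : perimeter m3 m2 c = P / 2).
  { unfold P, perimeter. rewrite (half (m2 - m3)%C (b - a)%C), (half (c - m2)%C (c - b)%C), (half (m3 - c)%C (a - c)%C);
      [lra|unfold m3, m2; field; auto ..]. }
  assert (q4 : perimeter m2 m3 m1 = P / 2).
  { unfold P, perimeter. rewrite (half' (m3 - m2)%C (b - a)%C), (half' (m1 - m3)%C (c - b)%C), (half' (m2 - m1)%C (a - c)%C);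
      [lra|unfold m1, m3, m2; field; auto ..]. }
  destruct (Rle_lt_dec (Cmod (tri_int f a m1 m3)) (eps * (P/2 * (P/2)))) as [g1|g1].
  2:{ exists {| ta := a; tb := m1; tc := m3 |}; simpl. rewrite q1. repeat split; auto; try apply h1; try apply h3; try apply ha.
      rewrite Cmod_diag. apply perimeter_ge_0. }
  destruct (Rle_lt_dec (Cmod (tri_int f m1 b m2)) (eps * (P/2 * (P/2)))) as [g2|g2].
  2:{ exists {| ta := m1; tb := b; tc := m2 |}; simpl. rewrite q2. repeat split; auto; try apply h1; try apply h2; try apply hb.
      rewrite (half (m1 - a)%C (b - a)%C) by (unfold m1; field; auto). unfold P, perimeter. lra. }
  destruct (Rle_lt_dec (Cmod (tri_int f m3 m2 c)) (eps * (P/2 * (P/2)))) as [g3|g3].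
  2:{ exists {| ta := m3; tb := m2; tc := c |}; simpl. rewrite q3. repeat split; auto; try apply h3; try apply h2; try apply hc.
      rewrite (half' (m3 - a)%C (a - c)%C) by (unfold m3; field; auto). unfold P, perimeter. lra. }
  destruct (Rle_lt_dec (Cmod (tri_int f m2 m3 m1)) (eps * (P/2 * (P/2)))) as [g4|g4].
  2:{ exists {| ta := m2; tb := m3; tc := m1 |}; simpl. rewrite q4. repeat split; auto; try apply h3; try apply h2; try apply h1.
      replace (m2 - a)%C with ((m2 - m1) + (m1 - a))%C by ring.
      eapply Rle_trans; [apply Cmod_triangle|].
      rewrite (half (m1 - a)%C (b - a)%C) by (unfold m1; field; auto).
      rewrite (half' (m2 - m1)%C (a - c)%C) by (unfold m1, m2; field; auto). unfold P, perimeter. lra. }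
  exfalso. rewrite hs in hbad.
  assert (k1 := Cmod_triangle (tri_int f a m1 m3 + tri_int f m1 b m2 + tri_int f m3 m2 c) (tri_int f m2 m3 m1)).
  assert (k2 := Cmod_triangle (tri_int f a m1 m3 + tri_int f m1 b m2) (tri_int f m3 m2 c)).
  assert (k3 := Cmod_triangle (tri_int f a m1 m3) (tri_int f m1 b m2)).
  lra.
Qed.

Lemma goursat a b c : K a -> K b -> K c -> tri_int f a b c = 0.
Proof.
  intros ha hb hc. apply C_eq_eps. intros e he.
  replace (tri_int f a b c - 0)%C with (tri_int f a b c) by ring.
  set (P := perimeter a b c). assert (hP : 0 <= P) by apply perimeter_ge_0.
  (* The added 1 covers a degenerate triangle of perimeter 0. *)
  set (eps := e / (P * P + 1)).
  assert (heps : 0 < eps) by (apply Rdiv_lt_0_compat; nra).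
  apply Rnot_lt_le. intros hbad0.
  assert (hb0 : bad eps {| ta := a; tb := b; tc := c |}).
  { split; [repeat split; apply ha || apply hb || apply hc|]. unfold pr; simpl. fold P.
    eapply Rle_lt_trans; [|exact hbad0]. unfold eps.
    apply Rmult_le_reg_r with (P * P + 1); [nra|].
    replace (e / (P * P + 1) * (P * P) * (P * P + 1)) with (e * (P * P)) by (field; nra). nra. }
  (* Choice turns the existence of a bad child into a function, which is then iterated. *)
  set (nx := fun t : {t | bad eps t} =>
    let s := constructive_indefinite_description _ (bad_child eps (proj1_sig t) heps (proj2_sig t)) in
    exist (bad eps) (proj1_sig s) (proj1 (proj2_sig s))).
  assert (hnx : forall t, pr (proj1_sig (nx t)) = pr (proj1_sig t) / 2 /\
     Cmod (ta (proj1_sig (nx t)) - ta (proj1_sig t)) <= pr (proj1_sig t)).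
  { intros t. unfold nx; simpl.
    destruct (constructive_indefinite_description _ _) as [s [hs1 hs2]]. exact hs2. }
  set (sq := fix sq n := match n with O => exist (bad eps) _ hb0 | S n => nx (sq n) end).
  assert (hpr : forall n, pr (proj1_sig (sq n)) = P * (/ 2) ^ n).
  { induction n; [unfold pr; simpl; fold P; ring|].
    transitivity (P * (/ 2) ^ n / 2); [|simpl; field].
    eapply eq_trans; [exact (proj1 (hnx (sq n)))|exact (f_equal (fun x => x / 2) IHn)]. }
  destruct (clim_half (fun n => ta (proj1_sig (sq n))) P) as [p [hp1 hp2]].
  { intros n. eapply Rle_trans; [exact (proj2 (hnx (sq n)))|]. right. exact (hpr n). }
  assert (hpK : K p).
  { eapply rect_clim; [exact hp1|]. intros n. destruct (proj2_sig (sq n)) as [[h _] _]. exact h. }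
  destruct (holo_eps _ _ (hf p hpK)) as [l hl].
  destruct (hl (eps / 4) ltac:(lra)) as [d [hd hh]].
  destruct (pow_lt_1_zero (/2) ltac:(rewrite Rabs_pos_eq; lra) (d / (3 * P + 1)))
      as [n hn]; [apply Rdiv_lt_0_compat; lra|].
  specialize (hn n (le_n _)). assert (hp : 0 < (/ 2) ^ n) by (apply pow_lt; lra).
  rewrite Rabs_pos_eq in hn by lra.
  apply Rmult_lt_compat_r with (r := 3 * P + 1) in hn; [|lra].
  replace (d / (3 * P + 1) * (3 * P + 1)) with d in hn by (field; lra).
  destruct (proj2_sig (sq n)) as [[k1 [k2 k3]] hbad]. specialize (hpr n). specialize (hp2 n).
  simpl in hp2.
  destruct (proj1_sig (sq n)) as [a' b' c']; simpl in *. unfold pr in *; simpl in *.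
  set (P' := perimeter a' b' c') in *.
  (* [f] minus its tangent map at the limit point [p]: the triangle integral is unchanged and the
     integrand becomes small. *)
  set (g := fun z => (f z + (- f p + l * p + (- l) * z))%C).
  assert (hg : forall u v, K u -> K v -> seg_int g u v =
    (seg_int f u v + ((- f p + l * p) * (v - u) + (- l) * (v * v - u * u) / 2))%C).
  { intros u v hu hv. unfold g. rewrite seg_int_plus, seg_int_affine; auto.
    intros t _. apply cont_plus; [apply cont_const|apply cont_mult; [apply cont_const|apply cont_id]]. }
  assert (hgt : tri_int g a' b' c' = tri_int f a' b' c').
  { unfold tri_int. rewrite !hg by auto. field. }
  assert (hgc : forall u v, K u -> K v -> cont_seg g u v).
  { intros u v hu hv t ht. apply cont_plus; [now apply hct|].
    apply cont_plus; [apply cont_const|apply cont_mult; [apply cont_const|apply cont_id]]. }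
  (* A boundary point is within P' of the vertex and the vertex within 2 P' of [p], whence 3 P'. The
     product eps/4 * 3 P' * P' stays below the bad threshold eps * P' * P'. *)
  assert (hbd : Cmod (tri_int g a' b' c') <= (eps / 4 * (3 * P')) * perimeter a' b' c').
  { apply tri_int_bound; auto. intros z hz. fold P' in hz.
    assert (hzp : Cmod (z - p) <= 3 * P').
    { assert (ht := Cmod_sub_tri z a' p). rewrite (Cmod_sub_sym a' p) in ht. lra. }
    unfold g. replace (f z + (- f p + l * p + - l * z))%C with (f z - f p - l * (z - p))%C by ring.
    eapply Rle_trans; [apply hh; rewrite hpr in hzp; nra|]. nra. }
  rewrite hgt in hbd. fold P' in hbd. nra.
Qed.

End Goursat.

(** The diagonal from [a] to [c] cuts the contour into two triangles; convexity of the rectangle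
    keeps all segments where [f] is holomorphic. *)
Lemma goursat_quad x1 x2 y1 y2 f a b c d : (forall z, rect x1 x2 y1 y2 z -> holo f z) ->
  rect x1 x2 y1 y2 a -> rect x1 x2 y1 y2 b -> rect x1 x2 y1 y2 c -> rect x1 x2 y1 y2 d ->
  (seg_int f a b + seg_int f b c + seg_int f c d + seg_int f d a = 0)%C.
Proof.
  intros hf ha hb hc hd.
  assert (h1 := goursat x1 x2 y1 y2 f hf a b c ha hb hc).
  assert (h2 := goursat x1 x2 y1 y2 f hf a c d ha hc hd).
  unfold tri_int in *. rewrite (seg_int_rev f a c) in h1.
  - transitivity ((seg_int f a b + seg_int f b c + - seg_int f a c) + (seg_int f a c + seg_int f c d + seg_int f d a))%C;
      [ring|rewrite h1, h2; ring].
  - apply (rect_cont_seg x1 x2 y1 y2); auto. intros; now apply holo_cont, hf.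
Qed.

Section Boundary.
Variables (x1 x2 y1 y2 : R).
Hypothesis hx : x1 < x2.
Hypothesis hy : y1 < y2.

Definition rect_int (g : C -> C) : C :=
  (seg_int g (x1, y1) (x2, y1) + seg_int g (x2, y1) (x2, y2) + seg_int g (x2, y2) (x1, y2) + seg_int g (x1, y2) (x1, y1))%C.

Definition on_boundary (z : C) : Prop :=
  rect x1 x2 y1 y2 z /\ (Re z = x1 \/ Re z = x2 \/ Im z = y1 \/ Im z = y2).

Lemma on_boundary_edges : forall t : R, 0 <= t <= 1 ->
  on_boundary ((x1, y1) + t * ((x2, y1) - (x1, y1)))%C /\ on_boundary ((x2, y1) + t * ((x2, y2) - (x2, y1)))%C /\
  on_boundary ((x2, y2) + t * ((x1, y2) - (x2, y2)))%C /\ on_boundary ((x1, y2) + t * ((x1, y1) - (x1, y2)))%C.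
Proof.
  intros t ht. unfold on_boundary, rect; simpl. repeat split; try nra.
Qed.

Lemma rect_int_cont g : (forall z, on_boundary z -> cont g z) ->
  cont_seg g (x1, y1) (x2, y1) /\ cont_seg g (x2, y1) (x2, y2) /\ cont_seg g (x2, y2) (x1, y2) /\
  cont_seg g (x1, y2) (x1, y1).
Proof.
  intros h. repeat split; intros t ht; apply h; apply on_boundary_edges; auto.
Qed.

Lemma rect_int_plus f g : (forall z, on_boundary z -> cont f z) -> (forall z, on_boundary z -> cont g z) ->
  rect_int (fun z => f z + g z)%C = (rect_int f + rect_int g)%C.
Proof.
  intros hf hg. apply rect_int_cont in hf. apply rect_int_cont in hg.
  unfold rect_int. rewrite !seg_int_plus by tauto. ring.
Qed.

Lemma rect_int_scal c f : (forall z, on_boundary z -> cont f z) -> rect_int (fun z => c * f z)%C = (c * rect_int f)%C.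
Proof.
  intros hf. apply rect_int_cont in hf. unfold rect_int. rewrite !seg_int_scal by tauto. ring.
Qed.

Lemma rect_int_ext f g : (forall z, on_boundary z -> f z = g z) -> rect_int f = rect_int g.
Proof.
  intros h. unfold rect_int. f_equal; [f_equal; [f_equal|]|]; apply seg_int_ext; intros t ht; apply h, on_boundary_edges; auto.
Qed.

Lemma rect_int_bound g M : (forall z, on_boundary z -> cont g z) -> (forall z, on_boundary z -> Cmod (g z) <= M) ->
  Cmod (rect_int g) <= M * (2 * ((x2 - x1) + (y2 - y1))).
Proof.
  intros hg hM. apply rect_int_cont in hg. destruct hg as [c1 [c2 [c3 c4]]].
  assert (b1 := seg_int_bound g _ _ M c1 (fun t ht => hM _ (proj1 (on_boundary_edges t ht)))).
  assert (b2 := seg_int_bound g _ _ M c2 (fun t ht => hM _ (proj1 (proj2 (on_boundary_edges t ht))))).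
  assert (b3 := seg_int_bound g _ _ M c3 (fun t ht => hM _ (proj1 (proj2 (proj2 (on_boundary_edges t ht)))))).
  assert (b4 := seg_int_bound g _ _ M c4 (fun t ht => hM _ (proj2 (proj2 (proj2 (on_boundary_edges t ht)))))).
  replace ((x2, y1) - (x1, y1))%C with (RtoC (x2 - x1)) in b1 by (apply Ceq; simpl; ring).
  replace ((x2, y2) - (x2, y1))%C with (RtoC (y2 - y1) * Ci)%C in b2 by (apply Ceq; simpl; ring).
  replace ((x1, y2) - (x2, y2))%C with (- RtoC (x2 - x1))%C in b3 by (apply Ceq; simpl; ring).
  replace ((x1, y1) - (x1, y2))%C with (- (RtoC (y2 - y1) * Ci))%C in b4 by (apply Ceq; simpl; ring).
  assert (X := Rabs_pos_eq (x2 - x1) ltac:(lra)). assert (Y := Rabs_pos_eq (y2 - y1) ltac:(lra)).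
  rewrite Cmod_R, X in b1. rewrite Cmod_mult, Cmod_Ci, Cmod_R, Y in b2.
  rewrite Cmod_opp, Cmod_R, X in b3. rewrite Cmod_opp, Cmod_mult, Cmod_Ci, Cmod_R, Y in b4.
  unfold rect_int.
  eapply Rle_trans; [apply Cmod_triangle|].
  eapply Rle_trans; [apply Rplus_le_compat_r, Cmod_triangle|].
  eapply Rle_trans; [apply Rplus_le_compat_r, Rplus_le_compat_r, Cmod_triangle|]. lra.
Qed.

Definition inside (w : C) : Prop := x1 < Re w < x2 /\ y1 < Im w < y2.

Lemma on_boundary_dist w : inside w -> exists d, 0 < d /\ forall z, on_boundary z -> d <= Cmod (z - w).
Proof.
  intros [hw1 hw2].
  exists (Rmin (Rmin (Re w - x1) (x2 - Re w)) (Rmin (Im w - y1) (y2 - Im w))). split.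
  { repeat apply Rmin_pos; lra. }
  intros z [hz he].
  assert (m1 := Rmin_l (Rmin (Re w - x1) (x2 - Re w)) (Rmin (Im w - y1) (y2 - Im w))).
  assert (m2 := Rmin_r (Rmin (Re w - x1) (x2 - Re w)) (Rmin (Im w - y1) (y2 - Im w))).
  assert (m3 := Rmin_l (Re w - x1) (x2 - Re w)). assert (m4 := Rmin_r (Re w - x1) (x2 - Re w)).
  assert (m5 := Rmin_l (Im w - y1) (y2 - Im w)). assert (m6 := Rmin_r (Im w - y1) (y2 - Im w)).
  assert (a1 := re_le_Cmod (z - w)). assert (a2 := im_le_Cmod (z - w)).
  change (Re (z - w)) with (Re z - Re w) in a1. change (Im (z - w)) with (Im z - Im w) in a2.
  assert (b1 := Rle_abs (Re z - Re w)). assert (b2 := Rle_abs (- (Re z - Re w))).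
  assert (b3 := Rle_abs (Im z - Im w)). assert (b4 := Rle_abs (- (Im z - Im w))).
  rewrite Rabs_Ropp in b2, b4.
  destruct he as [he|[he|[he|he]]]; lra.
Qed.

Lemma cont_kernel (w z : C) : z <> w -> cont (fun z => / (z - w))%C z.
Proof.
  intros h. apply (cont_inv (fun z => z - w)%C).
  - apply cont_plus; [apply cont_id|apply cont_const].
  - intros h0; apply h, C_sub_0, h0.
Qed.

Lemma on_boundary_neq w z : inside w -> on_boundary z -> z <> w.
Proof. intros [h1 h2] [_ he] ->. destruct he as [he|[he|[he|he]]]; lra. Qed.

(** This is 2 pi i for a point inside, but the value is never computed: Cauchy's formula is simply
    divided by it. *)
Definition winding (w : C) : C := rect_int (fun z => / (z - w))%C.

Lemma seg_int_Im_ge g a b m : cont_seg g a b ->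
  (forall t : R, 0 <= t <= 1 -> m <= Im ((b - a) * g (a + t * (b - a)))%C) -> m <= Im (seg_int g a b).
Proof. intros hg h. apply cint_Im_ge; auto. now apply cont_seg_unit_scal. Qed.

(** Seen from an interior point, every side of the contour turns counterclockwise, so each
    contributes a positive imaginary part and no cancellation can occur. *)
Lemma winding_neq_0 w : inside w -> winding w <> 0.
Proof.
  intros hw. assert (hc : forall z, on_boundary z -> cont (fun z => / (z - w))%C z).
  { intros z hz. apply cont_kernel. now apply on_boundary_neq. }
  apply rect_int_cont in hc. destruct hc as [c1 [c2 [c3 c4]]]. destruct hw as [hw1 hw2].
  destruct w as [u v]; simpl in *.
  set (D := (x2 - x1) * (x2 - x1) + (y2 - y1) * (y2 - y1)).
  assert (hD : 0 < D) by (unfold D; nra).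
  (* [n] is the cross product of the direction of the side with the position relative to the point.
     It is constant along the side, and the imaginary part of (b - a)/(z - w) equals n/|z - w|^2, at
     least n/D with [D] the squared diagonal. *)
  assert (edge : forall (a b : C) n, 0 < n ->
    cont_seg (fun z => / (z - (u, v)))%C a b ->
    (forall t : R, 0 <= t <= 1 ->
      let X := Re (a + t * (b - a))%C - u in let Y := Im (a + t * (b - a))%C - v in
      X * X + Y * Y <= D /\ 0 < X * X + Y * Y /\
      (Im b - Im a) * X - (Re b - Re a) * Y = n) ->
    0 < Im (seg_int (fun z => / (z - (u, v)))%C a b)).
  { intros a b n hn hc h. apply Rlt_le_trans with (n / D); [now apply Rdiv_lt_0_compat|].
    apply seg_int_Im_ge; auto. intros t ht. specialize (h t ht). cbv zeta in h.
    set (z := (a + t * (b - a))%C) in *. destruct h as [h1 [h2 h3]].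
    replace (Im ((b - a) * / (z - (u, v)))%C) with
      (n / ((Re z - u) * (Re z - u) + (Im z - v) * (Im z - v))).
    - apply Rmult_le_compat_l; [lra|]. apply Rinv_le_contravar; lra.
    - rewrite <- h3. clearbody z. destruct a, b, z; simpl in *. field. nra. }
  assert (e1 := edge _ _ ((x2 - x1) * (v - y1)) ltac:(nra) c1).
  assert (e2 := edge _ _ ((y2 - y1) * (x2 - u)) ltac:(nra) c2).
  assert (e3 := edge _ _ ((x2 - x1) * (y2 - v)) ltac:(nra) c3).
  assert (e4 := edge _ _ ((y2 - y1) * (u - x1)) ltac:(nra) c4).
  assert (sq : forall p q, - (x2 - x1) <= p <= x2 - x1 -> - (y2 - y1) <= q <= y2 - y1 -> p * p + q * q <= D).
  { intros p q hp hq. unfold D. nra. }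
  assert (posY : forall p q, q < 0 \/ 0 < q -> 0 < p * p + q * q) by (intros p q [h|h]; nra).
  assert (posX : forall p q, p < 0 \/ 0 < p -> 0 < p * p + q * q) by (intros p q [h|h]; nra).
  assert (p1 : 0 < Im (seg_int (fun z => / (z - (u, v)))%C (x1, y1) (x2, y1))).
  { apply e1. intros t ht. simpl. split; [apply sq; nra|split; [apply posY; left; nra|ring]]. }
  assert (p2 : 0 < Im (seg_int (fun z => / (z - (u, v)))%C (x2, y1) (x2, y2))).
  { apply e2. intros t ht. simpl. split; [apply sq; nra|split; [apply posX; right; nra|ring]]. }
  assert (p3 : 0 < Im (seg_int (fun z => / (z - (u, v)))%C (x2, y2) (x1, y2))).
  { apply e3. intros t ht. simpl. split; [apply sq; nra|split; [apply posY; right; nra|ring]]. }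
  assert (p4 : 0 < Im (seg_int (fun z => / (z - (u, v)))%C (x1, y2) (x1, y1))).
  { apply e4. intros t ht. simpl. split; [apply sq; nra|split; [apply posX; left; nra|ring]]. }
  intros h0. apply (f_equal Im) in h0. unfold winding, rect_int in h0.
  rewrite !im_plus in h0. change (Im 0) with 0 in h0. lra.
Qed.

(* The contour is contracted to [w] by homotheties; the four trapezoids swept by its sides lie in
   rectangles that avoid [w]. *)
Lemma rect_int_shrink f w lam : inside w -> 0 < lam <= 1 ->
  (forall z, rect x1 x2 y1 y2 z -> holo f z) ->
  rect_int (fun z => f (w + RtoC lam * (z - w)) * / (z - w))%C = rect_int (fun z => f z * / (z - w))%C.
Proof.
  intros hw hl hf.
  assert (hl0 : RtoC lam <> 0) by (intros h; apply (f_equal fst) in h; simpl in h; lra).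
  set (g := fun z => (f z * / (z - w))%C).
  set (sc := fun z : C => (w + RtoC lam * (z - w))%C).
  assert (e : forall a b, (forall t : R, 0 <= t <= 1 -> on_boundary (a + t * (b - a))%C) ->
     seg_int (fun z => f (w + RtoC lam * (z - w)) * / (z - w))%C a b = seg_int g (sc a) (sc b)).
  { intros a b hab. unfold seg_int. apply cint_ext. intros t ht. unfold g, sc.
    replace (w + lam * (a - w) + t * (w + lam * (b - w) - (w + lam * (a - w))))%C
      with (w + lam * (a + t * (b - a) - w))%C by ring.
    specialize (hab t ht). set (z := (a + t * (b - a))%C) in *.
    assert (hz : (z - w)%C <> 0) by (intros h; apply (on_boundary_neq w z hw hab), C_sub_0, h).
    replace (w + lam * (z - w) - w)%C with (lam * (z - w))%C by ring.
    field; auto. }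
  assert (hg : forall z, rect x1 x2 y1 y2 z -> z <> w -> holo g z).
  { intros z hz hzw. apply holo_mult; [now apply hf|]. apply holo_inv.
    - apply holo_minus; [apply holo_id|apply holo_const].
    - intros h; apply hzw, C_sub_0, h. }
  unfold rect_int. rewrite !e by (intros t ht; apply on_boundary_edges; auto).
  set (v1 := (x1, y1) : C). set (v2 := (x2, y1) : C). set (v3 := (x2, y2) : C). set (v4 := (x1, y2) : C).
  destruct hw as [hw1 hw2].
  assert (hsub : forall a b c d z, rect a b c d z -> x1 <= a -> b <= x2 -> y1 <= c -> d <= y2 ->
    rect x1 x2 y1 y2 z).
  { unfold rect; intros; lra. }
  (* The trapezoid swept by the bottom side stays at or below the image of that side, whose height
     is strictly less than [Im w] because [lam] is positive. The other three sides are treated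
     alike. *)
  assert (q1 : (seg_int g v1 v2 + seg_int g v2 (sc v2) + seg_int g (sc v2) (sc v1) + seg_int g (sc v1) v1 = 0)%C).
  { apply (goursat_quad x1 x2 y1 (Im w + lam * (y1 - Im w))).
    - intros z hz. apply hg.
      + apply (hsub _ _ _ _ _ hz); nra.
      + intros ->. destruct hz as [_ hz]. nra.
    - unfold rect, v1; simpl; nra.
    - unfold rect, v2; simpl; nra.
    - unfold rect, sc, v2; destruct w; simpl in *; nra.
    - unfold rect, sc, v1; destruct w; simpl in *; nra. }
  assert (q2 : (seg_int g v2 v3 + seg_int g v3 (sc v3) + seg_int g (sc v3) (sc v2) + seg_int g (sc v2) v2 = 0)%C).
  { apply (goursat_quad (Re w + lam * (x2 - Re w)) x2 y1 y2).
    - intros z hz. apply hg.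
      + apply (hsub _ _ _ _ _ hz); nra.
      + intros ->. destruct hz as [hz _]. nra.
    - unfold rect, v2; simpl; nra.
    - unfold rect, v3; simpl; nra.
    - unfold rect, sc, v3; destruct w; simpl in *; nra.
    - unfold rect, sc, v2; destruct w; simpl in *; nra. }
  assert (q3 : (seg_int g v3 v4 + seg_int g v4 (sc v4) + seg_int g (sc v4) (sc v3) + seg_int g (sc v3) v3 = 0)%C).
  { apply (goursat_quad x1 x2 (Im w + lam * (y2 - Im w)) y2).
    - intros z hz. apply hg.
      + apply (hsub _ _ _ _ _ hz); nra.
      + intros ->. destruct hz as [_ hz]. nra.
    - unfold rect, v3; simpl; nra.
    - unfold rect, v4; simpl; nra.
    - unfold rect, sc, v4; destruct w; simpl in *; nra.
    - unfold rect, sc, v3; destruct w; simpl in *; nra. }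
  assert (q4 : (seg_int g v4 v1 + seg_int g v1 (sc v1) + seg_int g (sc v1) (sc v4) + seg_int g (sc v4) v4 = 0)%C).
  { apply (goursat_quad x1 (Re w + lam * (x1 - Re w)) y1 y2).
    - intros z hz. apply hg.
      + apply (hsub _ _ _ _ _ hz); nra.
      + intros ->. destruct hz as [hz _]. nra.
    - unfold rect, v4; simpl; nra.
    - unfold rect, v1; simpl; nra.
    - unfold rect, sc, v1; destruct w; simpl in *; nra.
    - unfold rect, sc, v4; destruct w; simpl in *; nra. }
  assert (hinside : forall z, rect x1 x2 y1 y2 z -> rect x1 x2 y1 y2 (sc z)).
  { unfold rect, sc; intros [a b]; destruct w as [u v]; simpl in *; nra. }
  assert (cr : forall a b, (forall t : R, 0 <= t <= 1 -> rect x1 x2 y1 y2 (a + t * (b - a))%C /\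
     (a + t * (b - a))%C <> w) -> seg_int g b a = (- seg_int g a b)%C).
  { intros a b hab. apply seg_int_rev. intros t ht. destruct (hab t ht). apply holo_cont; auto. }
  (* The spoke from [p] to its image consists of the points w + (1 - t + t lam)(p - w); the factor
     is positive, so [w] is avoided. *)
  assert (hv : forall p, on_boundary p -> seg_int g (sc p) p = (- seg_int g p (sc p))%C).
  { intros p [hp1 hp2]. apply cr. intros t ht. split.
    - apply rect_seg; auto.
    - unfold sc. intros h.
      assert (h' : ((RtoC (1 - t) + RtoC t * RtoC lam) * (p - w) = 0)%C).
      { transitivity (p + t * (w + lam * (p - w) - p) - w)%C; [rewrite RtoC_minus; ring|rewrite h; ring]. }
      rewrite <- RtoC_mult, <- RtoC_plus in h'. revert h'. apply Cmult_neq_0.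
      + intros h'. apply (f_equal fst) in h'. simpl in h'. nra.
      + intros h'. apply C_sub_0 in h'. subst p. destruct hp2 as [hp|[hp|[hp|hp]]]; lra. }
  assert (ho : on_boundary v1 /\ on_boundary v2 /\ on_boundary v3 /\ on_boundary v4).
  { unfold on_boundary, rect; simpl. repeat split; try lra; auto. }
  assert (hs : forall p q : C, on_boundary p -> on_boundary q ->
     (forall t : R, 0 <= t <= 1 -> on_boundary (p + t * (q - p))%C) ->
     seg_int g (sc q) (sc p) = (- seg_int g (sc p) (sc q))%C).
  { intros p q [hp1 hp2] [hq1 hq2] hpq. apply cr. intros t ht. split.
    - apply rect_seg; auto.
    - unfold sc. intros h.
      assert (h' : (lam * (p + t * (q - p) - w) = 0)%C).
      { transitivity (w + lam * (p - w) + t * (w + lam * (q - w) - (w + lam * (p - w))) - w)%C;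
         [ring|rewrite h; ring]. }
      revert h'. apply Cmult_neq_0; auto. intros h'. apply C_sub_0 in h'.
      apply (on_boundary_neq w _ (conj hw1 hw2) (hpq t ht)); auto. }
  destruct ho as [o1 [o2 [o3 o4]]].
  rewrite (hv v1 o1), (hs v1 v2 o1 o2) in q1 by (intros; apply on_boundary_edges; auto).
  rewrite (hv v2 o2), (hs v2 v3 o2 o3) in q2 by (intros; apply on_boundary_edges; auto).
  rewrite (hv v3 o3), (hs v3 v4 o3 o4) in q3 by (intros; apply on_boundary_edges; auto).
  rewrite (hv v4 o4), (hs v4 v1 o4 o1) in q4 by (intros; apply on_boundary_edges; auto).
  symmetry. apply C_sub_0.
  transitivity ((0 + 0) + (0 + 0))%C; [|ring]. rewrite <- q1 at 1. rewrite <- q2 at 1.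
  rewrite <- q3 at 1. rewrite <- q4 at 1. ring.
Qed.

(** Contracting the contour leaves the kernel on the original boundary, where it is at most 1/d, and
    moves only the argument of [f]. Near [w] that argument can be replaced by [w] at a small cost,
    by continuity. *)
Theorem cauchy_rect f w : inside w -> (forall z, rect x1 x2 y1 y2 z -> holo f z) ->
  rect_int (fun z => f z * / (z - w))%C = (f w * winding w)%C.
Proof.
  intros hw hf. apply C_eq_eps. intros e he.
  destruct (on_boundary_dist w hw) as [d [hd hdd]].
  set (L := 2 * ((x2 - x1) + (y2 - y1))). assert (hL : 0 < L) by (unfold L; lra).
  assert (hKw : rect x1 x2 y1 y2 w) by (destruct hw; unfold rect; lra).
  destruct (holo_cont _ _ (hf w hKw) (e * d / L)) as [r [hr hh]].
  { apply Rdiv_lt_0_compat; nra. }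
  set (diam := (x2 - x1) + (y2 - y1)).
  (* [diam] dominates |z - w| on the boundary, so this ratio puts every contracted point within [r]
     of [w]. *)
  set (lam := Rmin 1 (r / (2 * diam))).
  assert (hdi : 0 < diam) by (unfold diam; lra).
  assert (hl : 0 < lam <= 1).
  { split; [|apply Rmin_l]. apply Rmin_pos; [lra|apply Rdiv_lt_0_compat; lra]. }
  assert (hl2 : lam * diam < r).
  { assert (h : lam <= r / (2 * diam)) by apply Rmin_r.
    apply Rmult_le_compat_r with (r := diam) in h; [|lra].
    replace (r / (2 * diam) * diam) with (r / 2) in h by (field; lra). lra. }
  rewrite <- (rect_int_shrink f w lam) by auto.
  assert (hin : forall z, on_boundary z -> rect x1 x2 y1 y2 (w + lam * (z - w))%C).
  { intros z [hz _]. destruct hw. unfold rect in *. destruct w, z; simpl in *. nra. }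
  assert (ck : forall z, on_boundary z -> cont (fun z => / (z - w))%C z).
  { intros z hz. apply cont_kernel. now apply on_boundary_neq. }
  assert (c1 : forall z, on_boundary z -> cont (fun z => f (w + lam * (z - w)) * / (z - w))%C z).
  { intros z hz. apply cont_mult; auto. apply (cont_comp f).
    - apply cont_plus; [apply cont_const|]. apply cont_mult; [apply cont_const|].
      apply cont_plus; [apply cont_id|apply cont_const].
    - apply holo_cont, hf, hin, hz. }
  unfold winding.
  replace (rect_int (fun z => f (w + lam * (z - w)) * / (z - w)) - f w * rect_int (fun z => / (z - w)))%C
    with (rect_int (fun z => f (w + lam * (z - w)) * / (z - w) + (- f w) * / (z - w)))%C.
  2:{ rewrite rect_int_plus, rect_int_scal; auto. ring. intros; apply cont_mult; [apply cont_const|auto]. }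
  apply Rle_trans with (e / L * L); [|right; field; lra].
  apply rect_int_bound.
  - intros z hz. apply cont_plus; auto. apply cont_mult; [apply cont_const|auto].
  - intros z hz.
    replace (f (w + lam * (z - w)) * / (z - w) + - f w * / (z - w))%C with
      ((f (w + lam * (z - w)) - f w) * / (z - w))%C by ring.
    assert (hzw : (z - w)%C <> 0) by (intros h; apply (on_boundary_neq w z hw hz), C_sub_0, h).
    rewrite Cmod_mult, Cmod_inv by auto. specialize (hdd z hz).
    apply Rle_trans with (e * d / L * / d); [|right; field; lra].
    apply Rmult_le_compat; [apply Cmod_ge_0|apply Rlt_le, Rinv_0_lt_compat; lra| |
       apply Rinv_le_contravar; lra].
    apply Rlt_le, hh.
    replace (w + lam * (z - w) - w)%C with (lam * (z - w))%C by ring.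
    rewrite Cmod_mult, Cmod_R, Rabs_pos_eq by lra.
    eapply Rle_lt_trans; [|exact hl2]. apply Rmult_le_compat_l; [lra|].
    eapply Rle_trans; [apply Cmod_le_abs|]. destruct hz as [hz _]. destruct hw.
    unfold rect, diam in *. destruct z, w; simpl in *.
    apply Rplus_le_compat; apply Rabs_le; lra.
Qed.

End Boundary.

Lemma cont_seg_bounded f a b : cont_seg f a b ->
  exists M, forall t : R, 0 <= t <= 1 -> Cmod (f (a + t * (b - a))%C) <= M.
Proof.
  intros h.
  destruct (continuity_ab_maj (fun t => Cmod (f (a + t * (b - a))%C)) 0 1) as [m [hm _]]; [lra| |].
  - intros t ht.
    intros e he. destruct (cont_seg_unit f a b h t ht e he) as [d [hd hh]]. exists d. split; [exact hd|].
    intros x [_ hx]. simpl in *. unfold Rdist in *.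
    specialize (hh (RtoC x)). rewrite <- RtoC_minus, Cmod_R in hh. specialize (hh hx).
    eapply Rle_lt_trans; [|exact hh].
    apply Rabs_le.
    assert (h1 := Cmod_sub_ge (f (a + x * (b - a))%C) (f (a + t * (b - a))%C)).
    assert (h2 := Cmod_sub_ge (f (a + t * (b - a))%C) (f (a + x * (b - a))%C)).
    rewrite Cmod_sub_sym in h2. lra.
  - exists (Cmod (f (a + m * (b - a))%C)). intros t ht. now apply hm.
Qed.

Lemma on_boundary_param x1 x2 y1 y2 z : x1 < x2 -> y1 < y2 -> on_boundary x1 x2 y1 y2 z ->
  exists t : R, 0 <= t <= 1 /\
  (z = ((x1, y1) + t * ((x2, y1) - (x1, y1)))%C \/ z = ((x2, y1) + t * ((x2, y2) - (x2, y1)))%C \/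
   z = ((x2, y2) + t * ((x1, y2) - (x2, y2)))%C \/ z = ((x1, y2) + t * ((x1, y1) - (x1, y2)))%C).
Proof.
  intros hx hy [[h1 h2] h3]. destruct z as [x y]; simpl in *.
  assert (d1 : forall p, 0 <= p <= x2 - x1 -> 0 <= p / (x2 - x1) <= 1).
  { intros p hp. split; [apply Rdiv_le_0_compat; lra|]. apply Rmult_le_reg_r with (x2 - x1); [lra|].
    unfold Rdiv. rewrite Rmult_assoc, Rinv_l; lra. }
  assert (d2 : forall p, 0 <= p <= y2 - y1 -> 0 <= p / (y2 - y1) <= 1).
  { intros p hp. split; [apply Rdiv_le_0_compat; lra|]. apply Rmult_le_reg_r with (y2 - y1); [lra|].
    unfold Rdiv. rewrite Rmult_assoc, Rinv_l; lra. }
  destruct h3 as [h3|[h3|[h3|h3]]]; subst.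
  - exists ((y2 - y) / (y2 - y1)). split; [apply d2; lra|]. do 3 right. apply Ceq; simpl; field; lra.
  - exists ((y - y1) / (y2 - y1)). split; [apply d2; lra|]. right; left. apply Ceq; simpl; field; lra.
  - exists ((x - x1) / (x2 - x1)). split; [apply d1; lra|]. left. apply Ceq; simpl; field; lra.
  - exists ((x2 - x) / (x2 - x1)). split; [apply d1; lra|]. right; right; left. apply Ceq; simpl; field; lra.
Qed.

Lemma rect_int_bounded x1 x2 y1 y2 f : x1 < x2 -> y1 < y2 -> (forall z, on_boundary x1 x2 y1 y2 z -> cont f z) ->
  exists M, 0 < M /\ forall z, on_boundary x1 x2 y1 y2 z -> Cmod (f z) <= M.
Proof.
  intros hx hy h. apply rect_int_cont in h; auto. destruct h as [c1 [c2 [c3 c4]]].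
  apply cont_seg_bounded in c1. apply cont_seg_bounded in c2. apply cont_seg_bounded in c3. apply cont_seg_bounded in c4.
  destruct c1 as [M1 c1], c2 as [M2 c2], c3 as [M3 c3], c4 as [M4 c4].
  exists (Rmax (Rmax 1 (Rmax M1 M2)) (Rmax M3 M4)).
  assert (k1 := Rmax_l (Rmax 1 (Rmax M1 M2)) (Rmax M3 M4)).
  assert (k2 := Rmax_r (Rmax 1 (Rmax M1 M2)) (Rmax M3 M4)).
  assert (k3 := Rmax_l 1 (Rmax M1 M2)). assert (k4 := Rmax_r 1 (Rmax M1 M2)).
  assert (k5 := Rmax_l M1 M2). assert (k6 := Rmax_r M1 M2).
  assert (k7 := Rmax_l M3 M4). assert (k8 := Rmax_r M3 M4).
  split; [lra|]. intros z hz. apply on_boundary_param in hz; auto.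
  destruct hz as [t [ht [->|[->|[->| ->]]]]];
  [specialize (c1 t ht)|specialize (c2 t ht)|specialize (c3 t ht)|specialize (c4 t ht)]; lra.
Qed.

(** With h = v - w, 1/(z - v) = 1/(z - w) + h/(z - w)^2 + h^2/((z - w)^2 (z - v)). Integrated
    against [phi], the last term is quadratic in h, so the middle one gives the derivative. *)
Lemma cauchy_integral_holo x1 x2 y1 y2 phi w : x1 < x2 -> y1 < y2 ->
  (forall z, on_boundary x1 x2 y1 y2 z -> cont phi z) -> inside x1 x2 y1 y2 w ->
  holo (fun w => rect_int x1 x2 y1 y2 (fun z => phi z * / (z - w)))%C w.
Proof.
  intros hx hy hphi hw.
  destruct (on_boundary_dist _ _ _ _ w hw) as [d [hd hdd]].
  destruct (rect_int_bounded _ _ _ _ phi hx hy hphi) as [M [hM0 hM]].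
  set (L := 2 * ((x2 - x1) + (y2 - y1))). assert (hL : 0 < L) by (unfold L; lra).
  assert (ck : forall v, Cmod (v - w) < d / 2 -> forall z, on_boundary x1 x2 y1 y2 z ->
     d / 2 <= Cmod (z - v) /\ cont (fun z => / (z - v))%C z /\ (z - v)%C <> 0).
  { intros v hv z hz. specialize (hdd z hz).
    assert (h1 : d / 2 <= Cmod (z - v)).
    { assert (ht := Cmod_sub_tri z v w). lra. }
    assert (h2 : (z - v)%C <> 0) by (apply Cmod_gt_0; lra).
    split; [auto|split; auto]. apply cont_kernel. intros ->. apply h2; ring. }
  assert (hww : Cmod (w - w) < d / 2).
  { rewrite Cmod_diag; lra. }
  apply holo_of_eps with (rect_int x1 x2 y1 y2 (fun z => phi z * (/ (z - w) * / (z - w))))%C.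
  intros e he.
  set (B := M * (/ d * / d * (2 / d))).
  assert (hB : 0 < B).
  { unfold B. assert (0 < / d) by now apply Rinv_0_lt_compat.
    assert (0 < 2 / d) by (apply Rdiv_lt_0_compat; lra). repeat apply Rmult_lt_0_compat; auto; lra. }
  exists (Rmin (d / 2) (e / (B * L))). split.
  { apply Rmin_pos; [lra|]. apply Rdiv_lt_0_compat; auto. now apply Rmult_lt_0_compat. }
  intros v hv.
  destruct (lt_Rmin _ _ _ hv) as [hv1 hv2].
  set (h := (v - w)%C) in *.
  assert (c0 : forall z, on_boundary x1 x2 y1 y2 z -> cont (fun z => phi z * (/ (z - w) * / (z - w)))%C z).
  { intros z hz. destruct (ck w hww z hz) as [_ [k1 _]]. repeat apply cont_mult; auto. }
  assert (c1 : forall z, on_boundary x1 x2 y1 y2 z ->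
    cont (fun z => phi z * (/ (z - w) * / (z - w)) * / (z - v))%C z).
  { intros z hz. destruct (ck w hww z hz) as [_ [k1 _]]. destruct (ck v hv1 z hz) as [_ [k2 _]].
    repeat apply cont_mult; auto. }
  assert (c2 : forall z, on_boundary x1 x2 y1 y2 z -> cont (fun z => phi z * / (z - w))%C z).
  { intros z hz. destruct (ck w hww z hz) as [_ [k1 _]]. repeat apply cont_mult; auto. }
  assert (e1 : rect_int x1 x2 y1 y2 (fun z => phi z * / (z - v))%C =
    (rect_int x1 x2 y1 y2 (fun z => phi z * / (z - w)) +
     (h * rect_int x1 x2 y1 y2 (fun z => phi z * (/ (z - w) * / (z - w))) +
      (h * h) * rect_int x1 x2 y1 y2 (fun z => phi z * (/ (z - w) * / (z - w)) * / (z - v))))%C).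
  { rewrite <- !rect_int_scal by auto. rewrite <- !rect_int_plus; auto.
    - apply rect_int_ext; auto. intros z hz.
      destruct (ck w hww z hz) as [_ [_ k1]]. destruct (ck v hv1 z hz) as [_ [_ k2]].
      unfold h. field; auto.
    - intros z hz. apply cont_plus; apply cont_mult; auto; apply cont_const.
    - intros z hz. apply cont_mult; auto; apply cont_const.
    - intros z hz. apply cont_mult; auto; apply cont_const. }
  rewrite e1.
  match goal with |- Cmod ?x <= _ => replace x with
   ((h * h) * rect_int x1 x2 y1 y2 (fun z => phi z * (/ (z - w) * / (z - w)) * / (z - v)))%C by ring end.
  rewrite !Cmod_mult.
  assert (hb : Cmod (rect_int x1 x2 y1 y2 (fun z => phi z * (/ (z - w) * / (z - w)) * / (z - v))%C) <= B * L).
  { apply rect_int_bound; auto. intros z hz.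
    destruct (ck w hww z hz) as [_ [_ k1]]. destruct (ck v hv1 z hz) as [k3 [_ k2]].
    rewrite !Cmod_mult, !Cmod_inv by auto. unfold B.
    assert (q1 : / Cmod (z - w) <= / d) by (apply Rinv_le_contravar; auto).
    assert (q2 : / Cmod (z - v) <= 2 / d).
    { replace (2 / d) with (/ (d / 2)) by (field; lra). apply Rinv_le_contravar; auto; lra. }
    assert (p1 : 0 <= / Cmod (z - w)) by (apply Rlt_le, Rinv_0_lt_compat, Cmod_gt_0; auto).
    assert (p2 : 0 <= / Cmod (z - v)) by (apply Rlt_le, Rinv_0_lt_compat, Cmod_gt_0; auto).
    rewrite Rmult_assoc. apply Rmult_le_compat; [apply Cmod_ge_0| |now apply hM|].
    - apply Rmult_le_pos; auto. now apply Rmult_le_pos.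
    - apply Rmult_le_compat; auto; [now apply Rmult_le_pos|]. now apply Rmult_le_compat. }
  assert (hh : 0 <= Cmod h) by apply Cmod_ge_0.
  assert (hBL : 0 < B * L) by now apply Rmult_lt_0_compat.
  assert (hv3 : Cmod h * (B * L) <= e).
  { apply Rlt_le in hv2. apply Rmult_le_compat_r with (r := B * L) in hv2; [|lra].
    replace (e / (B * L) * (B * L)) with e in hv2 by (field; lra). lra. }
  rewrite Rmult_assoc. rewrite Rmult_comm. apply Rmult_le_compat_r; auto.
  eapply Rle_trans; [|exact hv3]. now apply Rmult_le_compat_l.
Qed.

(** * Locally uniform limits, maximum modulus and strips *)

Lemma inside_ball x1 x2 y1 y2 w : inside x1 x2 y1 y2 w -> exists d, 0 < d /\
  forall v, Cmod (v - w) < d -> inside x1 x2 y1 y2 v.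
Proof.
  intros [h1 h2].
  exists (Rmin (Rmin (Re w - x1) (x2 - Re w)) (Rmin (Im w - y1) (y2 - Im w))). split.
  { repeat apply Rmin_pos; lra. }
  intros v hv.
  assert (m1 := Rmin_l (Rmin (Re w - x1) (x2 - Re w)) (Rmin (Im w - y1) (y2 - Im w))).
  assert (m2 := Rmin_r (Rmin (Re w - x1) (x2 - Re w)) (Rmin (Im w - y1) (y2 - Im w))).
  assert (m3 := Rmin_l (Re w - x1) (x2 - Re w)). assert (m4 := Rmin_r (Re w - x1) (x2 - Re w)).
  assert (m5 := Rmin_l (Im w - y1) (y2 - Im w)). assert (m6 := Rmin_r (Im w - y1) (y2 - Im w)).
  assert (a1 := Rle_lt_trans _ _ _ (re_le_Cmod (v - w)) hv).
  assert (a2 := Rle_lt_trans _ _ _ (im_le_Cmod (v - w)) hv).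
  change (Re (v - w)) with (Re v - Re w) in a1. change (Im (v - w)) with (Im v - Im w) in a2.
  apply Rabs_def2 in a1. apply Rabs_def2 in a2. unfold inside. lra.
Qed.

(** The limit is continuous, and Cauchy's formula passes to the limit on a square around the point.
    The limit is thereby a Cauchy integral of a continuous density, up to division by [winding]. *)
Lemma holo_unif_lim (F : nat -> C -> C) (f : C -> C) :
  (forall n z, holo (F n) z) ->
  (forall S eps, 0 < eps -> exists n0, forall n, (n0 <= n)%nat -> forall z, Cmod z <= S ->
     Cmod (F n z - f z) <= eps) ->
  forall w, holo f w.
Proof.
  intros hF hlim w.
  assert (hct : forall z, cont f z).
  { intros z e he. destruct (hlim (Cmod z + 1) (e / 4) ltac:(lra)) as [n hn].
    specialize (hn n (le_n _)).
    destruct (holo_cont _ _ (hF n z) (e / 4) ltac:(lra)) as [d [hd hh]].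
    exists (Rmin d 1). split; [apply Rmin_pos; lra|]. intros v hv.
    destruct (lt_Rmin _ _ _ hv) as [hv1 hv2].
    specialize (hh v hv1).
    assert (g1 := hn z ltac:(lra)).
    assert (g2 := hn v ltac:(assert (ht := Cmod_sub_ge v z); lra)).
    assert (t1 := Cmod_sub_tri (f v) (F n v) (f z)). rewrite (Cmod_sub_sym (f v) (F n v)) in t1.
    assert (t2 := Cmod_sub_tri (F n v) (F n z) (f z)). lra. }
  set (x1 := Re w - 1). set (x2 := Re w + 1). set (y1 := Im w - 1). set (y2 := Im w + 1).
  assert (hx : x1 < x2) by (unfold x1, x2; lra). assert (hy : y1 < y2) by (unfold y1, y2; lra).
  assert (hw : inside x1 x2 y1 y2 w) by (unfold inside, x1, x2, y1, y2; lra).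
  assert (hsz : forall z, on_boundary x1 x2 y1 y2 z -> Cmod z <= Cmod w + 2).
  { intros z [[h1 h2] _]. assert (h3 := Cmod_sub_ge z w). assert (h4 := Cmod_le_abs (z - w)).
    change (Re (z - w)) with (Re z - Re w) in h4. change (Im (z - w)) with (Im z - Im w) in h4.
    assert (Rabs (Re z - Re w) <= 1) by (apply Rabs_le; unfold x1, x2 in *; lra).
    assert (Rabs (Im z - Im w) <= 1) by (apply Rabs_le; unfold y1, y2 in *; lra). lra. }
  assert (rep : forall v, inside x1 x2 y1 y2 v ->
    rect_int x1 x2 y1 y2 (fun z => f z * / (z - v))%C = (f v * winding x1 x2 y1 y2 v)%C).
  { intros v hv. destruct (on_boundary_dist _ _ _ _ v hv) as [d [hd hdd]].
    assert (ck : forall z, on_boundary x1 x2 y1 y2 z -> cont (fun z => / (z - v))%C z).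
    { intros z hz. apply cont_kernel. now apply (on_boundary_neq x1 x2 y1 y2). }
    apply C_eq_eps. intros e he.
    set (L := 2 * ((x2 - x1) + (y2 - y1))). assert (hL : 0 < L) by (unfold L; lra).
    set (W := Cmod (winding x1 x2 y1 y2 v)). assert (hW : 0 <= W) by apply Cmod_ge_0.
    (* Normalises the two errors, e/k * W at the point and e/k * L/d on the contour, to a total of
       [e]. *)
    set (k := L / d + W). assert (hk : 0 < k).
    { unfold k. assert (0 < L / d) by (apply Rdiv_lt_0_compat; lra). lra. }
    destruct (hlim (Cmod w + 2 + Cmod v) (e / k)) as [n hn]; [apply Rdiv_lt_0_compat; lra|].
    specialize (hn n (le_n _)).
    assert (hc := cauchy_rect x1 x2 y1 y2 hx hy (F n) v hv (fun z _ => hF n z)).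
    replace (rect_int x1 x2 y1 y2 (fun z => f z * / (z - v)) - f v * winding x1 x2 y1 y2 v)%C with
     ((F n v - f v) * winding x1 x2 y1 y2 v -
       rect_int x1 x2 y1 y2 (fun z => (F n z * / (z - v) + (- (1)) * (f z * / (z - v)))))%C.
    2:{ rewrite rect_int_plus, rect_int_scal, hc; auto. ring.
        - intros; apply cont_mult; auto.
        - intros; apply cont_mult; auto. now apply holo_cont.
        - intros; apply cont_mult; [apply cont_const|]. apply cont_mult; auto. }
    eapply Rle_trans; [apply Cmod_sub_le|]. rewrite Cmod_mult. fold W.
    assert (b1 : Cmod (F n v - f v) <= e / k).
    { apply hn. assert (h1 := Cmod_ge_0 w). assert (h2 := Cmod_ge_0 v). lra. }
    assert (b2 : Cmod (rect_int x1 x2 y1 y2 (fun z => (F n z * / (z - v) + (- (1)) * (f z * / (z - v))))%C)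
       <= (e / k * / d) * L).
    { apply rect_int_bound; auto.
      - intros z hz. apply cont_plus; [|apply cont_mult; [apply cont_const|]]; apply cont_mult; auto.
        now apply holo_cont.
      - intros z hz.
        replace (F n z * / (z - v) + - (1) * (f z * / (z - v)))%C with
          ((F n z - f z) * / (z - v))%C by ring.
        specialize (hdd z hz). specialize (hsz z hz).
        rewrite Cmod_mult, Cmod_inv by (apply Cmod_gt_0; lra).
        apply Rmult_le_compat; [apply Cmod_ge_0|apply Rlt_le, Rinv_0_lt_compat; lra| |
          apply Rinv_le_contravar; lra].
        apply hn. assert (h2 := Cmod_ge_0 v). lra. }
    apply Rle_trans with (e / k * W + e / k * / d * L).
    - apply Rplus_le_compat; auto. now apply Rmult_le_compat_r.
    - right. unfold k. field. unfold k in hk. split; [lra|].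
      intros h0. assert (L + W * d = k * d) by (unfold k; field; lra). nra. }
  destruct (inside_ball _ _ _ _ w hw) as [d [hd hb]].
  (* [winding] is itself a Cauchy integral, of density 1, hence holomorphic; its non-vanishing
     inside allows the division. *)
  apply (holo_loc (fun v => rect_int x1 x2 y1 y2 (fun z => f z * / (z - v)) * / winding x1 x2 y1 y2 v)%C) with d; auto.
  - intros v hv. rewrite rep by auto. field. apply winding_neq_0; auto.
  - apply holo_mult; [apply cauchy_integral_holo; auto|].
    apply holo_inv; [|apply winding_neq_0; auto].
    apply holo_ext with (fun v => rect_int x1 x2 y1 y2 (fun z => 1 * / (z - v)))%C.
    + intros v. unfold winding. apply rect_int_ext; auto. intros; ring.
    + apply (cauchy_integral_holo x1 x2 y1 y2 (fun _ => RtoC 1)); auto. intros; apply cont_const.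
Qed.

(* Cauchy's formula applied to the powers of [f]. *)
Lemma max_modulus x1 x2 y1 y2 f w eps : x1 < x2 -> y1 < y2 -> inside x1 x2 y1 y2 w ->
  (forall z, rect x1 x2 y1 y2 z -> holo f z) ->
  0 < eps -> (forall z, on_boundary x1 x2 y1 y2 z -> Cmod (f z) <= eps) -> Cmod (f w) <= eps.
Proof.
  intros hx hy hw hf he hb.
  destruct (on_boundary_dist _ _ _ _ w hw) as [d [hd hdd]].
  set (L := 2 * ((x2 - x1) + (y2 - y1))). assert (hL : 0 < L) by (unfold L; lra).
  set (W := Cmod (winding x1 x2 y1 y2 w)).
  assert (hW : 0 < W) by (apply Cmod_gt_0, winding_neq_0; auto).
  (* [W] and L/d do not depend on [n], so they cannot compensate powers of a ratio |f(w)|/eps larger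
     than 1. *)
  assert (key : forall n, Cmod (f w) ^ n * W <= eps ^ n * (L / d)).
  { intros n.
    assert (hc := cauchy_rect x1 x2 y1 y2 hx hy (fun z => f z ^ n)%C w hw
      (fun z hz => holo_pow f z n (hf z hz))).
    unfold W. rewrite <- Cmod_pow, <- Cmod_mult, <- hc.
    replace (eps ^ n * (L / d)) with ((eps ^ n * / d) * L) by (field; lra).
    apply rect_int_bound; auto.
    - intros z hz. apply cont_mult; [|apply cont_kernel; now apply (on_boundary_neq x1 x2 y1 y2)].
      apply holo_cont, holo_pow, hf. apply hz.
    - intros z hz. specialize (hdd z hz). rewrite Cmod_mult, Cmod_inv by (apply Cmod_gt_0; lra).
      rewrite Cmod_pow. apply Rmult_le_compat.
      + apply pow_le, Cmod_ge_0.
      + apply Rlt_le, Rinv_0_lt_compat; lra.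
      + apply pow_incr. split; [apply Cmod_ge_0|auto].
      + apply Rinv_le_contravar; lra. }
  apply Rnot_lt_le. intros hlt.
  destruct (Pow_x_infinity (Cmod (f w) / eps)) with (b := L / d / W + 1) as [n hn].
  { rewrite Rabs_pos_eq.
    - apply Rmult_lt_reg_r with eps; auto. unfold Rdiv. rewrite Rmult_assoc, Rinv_l; lra.
    - apply Rdiv_le_0_compat; lra. }
  specialize (hn n (le_n _)). specialize (key n).
  assert (hep : 0 < eps ^ n) by now apply pow_lt.
  assert (e1 : (Cmod (f w) / eps) ^ n = Cmod (f w) ^ n / eps ^ n).
  { unfold Rdiv. rewrite Rpow_mult_distr, pow_inv. reflexivity. }
  rewrite e1 in hn. rewrite Rabs_pos_eq in hn.
  2:{ apply Rdiv_le_0_compat; auto. apply pow_le, Cmod_ge_0. }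
  apply Rge_le in hn. apply Rmult_le_compat_r with (r := eps ^ n * W) in hn; [|nra].
  replace (Cmod (f w) ^ n / eps ^ n * (eps ^ n * W)) with (Cmod (f w) ^ n * W) in hn by (field; lra).
  replace ((L / d / W + 1) * (eps ^ n * W)) with (eps ^ n * (L / d) + eps ^ n * W) in hn by (field; lra).
  nra.
Qed.

(** With the same bound on both lines, the maximum principle on a tall rectangle suffices. Smallness
    for large imaginary part replaces the usual growth condition; [Y] may depend on everything. *)
Lemma three_lines f S eps : 0 < S -> 0 < eps -> (forall z, holo f z) ->
  (forall z, Rabs (Re z) = S -> Cmod (f z) <= eps) ->
  (exists Y, forall z, Rabs (Re z) <= S -> Y <= Rabs (Im z) -> Cmod (f z) <= eps) ->
  forall w, Rabs (Re w) <= S -> Cmod (f w) <= eps.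
Proof.
  intros hS he hf hb [Y hY] w hw.
  destruct (Req_dec (Rabs (Re w)) S) as [h|h]; [auto|].
  assert (hw' : - S < Re w < S) by (assert (h' : Rabs (Re w) < S) by lra; apply Rabs_def2 in h'; lra).
  set (T := Rabs Y + Rabs (Im w) + 1).
  assert (hY0 := Rabs_pos Y). assert (hY1 := Rle_abs Y).
  assert (hI : - T < Im w < T).
  { assert (h1 := Rle_abs (Im w)). assert (h2 := Rle_abs (- Im w)). rewrite Rabs_Ropp in h2. unfold T. lra. }
  assert (hI0 := Rabs_pos (Im w)).
  apply (max_modulus (- S) S (- T) T); auto; try lra.
  - unfold inside; lra.
  - intros z [[h1 h2] h3].
    assert (h1' : Rabs (Re z) <= S) by (apply Rabs_le; lra).
    destruct h3 as [h3|[h3|[h3|h3]]].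
    + apply hb. rewrite h3, Rabs_Ropp, Rabs_pos_eq; lra.
    + apply hb. rewrite h3, Rabs_pos_eq; lra.
    + apply hY; auto. rewrite h3, Rabs_Ropp, Rabs_pos_eq; unfold T; lra.
    + apply hY; auto. rewrite h3, Rabs_pos_eq; unfold T; lra.
Qed.

(** * The identity theorem *)

(** Since [f] vanishes near [p], dividing it by any power of z - p keeps it holomorphic. The maximum
    principle then bounds |f(w)| by M (|w - p|/h)^n for every n, without power series. With h = r/3,
    the corners of the square are still within [r] of [p]. *)
Lemma ident_ball f p r eta : 0 < r -> 0 < eta ->
  (forall z, Cmod (z - p) < r -> holo f z) ->
  (forall z, Cmod (z - p) < eta -> f z = 0) ->
  forall z, Cmod (z - p) < r / 3 -> f z = 0.
Proof.
  intros hr heta hf h0 w hw.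
  set (h := r / 3). assert (hh : 0 < h) by (unfold h; lra).
  set (x1 := Re p - h). set (x2 := Re p + h). set (y1 := Im p - h). set (y2 := Im p + h).
  assert (hx : x1 < x2) by (unfold x1, x2; lra). assert (hy : y1 < y2) by (unfold y1, y2; lra).
  assert (hrect : forall z, rect x1 x2 y1 y2 z -> Cmod (z - p) < r).
  { intros z [h1 h2]. eapply Rle_lt_trans; [apply Cmod_le_abs|].
    change (Re (z - p)) with (Re z - Re p). change (Im (z - p)) with (Im z - Im p).
    assert (Rabs (Re z - Re p) <= h) by (apply Rabs_le; unfold x1, x2 in *; lra).
    assert (Rabs (Im z - Im p) <= h) by (apply Rabs_le; unfold y1, y2 in *; lra).
    unfold h in *; lra. }
  assert (hin : inside x1 x2 y1 y2 w).
  { assert (a1 := Rle_lt_trans _ _ _ (re_le_Cmod (w - p)) hw).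
    assert (a2 := Rle_lt_trans _ _ _ (im_le_Cmod (w - p)) hw).
    change (Re (w - p)) with (Re w - Re p) in a1. change (Im (w - p)) with (Im w - Im p) in a2.
    apply Rabs_def2 in a1. apply Rabs_def2 in a2. unfold inside, x1, x2, y1, y2, h. lra. }
  destruct (Rle_lt_dec eta (Cmod (w - p))) as [hwe|]; [|now apply h0].
  assert (hob : forall z, on_boundary x1 x2 y1 y2 z -> h <= Cmod (z - p)).
  { intros z [_ hz]. assert (a1 := re_le_Cmod (z - p)). assert (a2 := im_le_Cmod (z - p)).
    change (Re (z - p)) with (Re z - Re p) in a1. change (Im (z - p)) with (Im z - Im p) in a2.
    assert (b1 := Rle_abs (Re z - Re p)). assert (b2 := Rle_abs (- (Re z - Re p))).
    assert (b3 := Rle_abs (Im z - Im p)). assert (b4 := Rle_abs (- (Im z - Im p))).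
    rewrite Rabs_Ropp in b2, b4. unfold x1, x2, y1, y2 in hz.
    destruct hz as [hz|[hz|[hz|hz]]]; lra. }
  destruct (rect_int_bounded x1 x2 y1 y2 f hx hy) as [M [hM0 hM]].
  { intros z [hz _]. apply holo_cont, hf, hrect, hz. }
  assert (hwp : (w - p)%C <> 0) by (apply Cmod_gt_0; lra).
  assert (key : forall n, Cmod (f w) <= M * (Cmod (w - p) / h) ^ n).
  { intros n.
    assert (hg : forall z, rect x1 x2 y1 y2 z -> holo (fun z => f z * (/ (z - p)) ^ n)%C z).
    { intros z hz. destruct (Ceq_dec z p) as [->|hzp].
      (* Around [p] the product is identically 0, whatever value the inverse takes at [p]. *)
      - apply (holo_loc (fun _ => RtoC 0)) with eta; auto; [|apply holo_const].
        intros v hv. rewrite h0 by auto. ring.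
      - apply holo_mult; [apply hf, hrect, hz|]. apply holo_pow, holo_inv.
        + apply holo_minus; [apply holo_id|apply holo_const].
        + intros hz0. apply hzp, C_sub_0, hz0. }
    assert (hm : Cmod (f w * (/ (w - p)) ^ n) <= M * (/ h) ^ n).
    { apply (max_modulus x1 x2 y1 y2 (fun z => f z * (/ (z - p)) ^ n)%C); auto.
      - apply Rmult_lt_0_compat; auto. apply pow_lt, Rinv_0_lt_compat, hh.
      - intros z hz. specialize (hob z hz).
        rewrite Cmod_mult, Cmod_pow, Cmod_inv by (apply Cmod_gt_0; lra).
        apply Rmult_le_compat; [apply Cmod_ge_0| |now apply hM|].
        + apply pow_le, Rlt_le, Rinv_0_lt_compat; lra.
        + apply pow_incr. split; [apply Rlt_le, Rinv_0_lt_compat; lra|apply Rinv_le_contravar; lra]. }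
    rewrite Cmod_mult, Cmod_pow, Cmod_inv in hm by auto.
    assert (hp : 0 < Cmod (w - p) ^ n) by (apply pow_lt; lra).
    apply Rmult_le_compat_r with (r := Cmod (w - p) ^ n) in hm; [|lra].
    rewrite Rmult_assoc, <- Rpow_mult_distr, Rinv_l, pow1, Rmult_1_r in hm by lra.
    unfold Rdiv. rewrite Rpow_mult_distr. lra. }
  apply Cmod_eq_0. apply Rle_antisym; [|apply Cmod_ge_0]. apply le_epsilon. intros e he.
  rewrite Rplus_0_l.
  assert (hq : 0 <= Cmod (w - p) / h < 1).
  { split; [apply Rdiv_le_0_compat; lra|]. apply Rmult_lt_reg_r with h; auto.
    unfold Rdiv at 1. rewrite Rmult_assoc, Rinv_l by lra. fold h in hw. lra. }
  destruct (pow_lt_1_zero (Cmod (w - p) / h)) with (y := e / M) as [n hn].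
  { rewrite Rabs_pos_eq; lra. }
  { apply Rdiv_lt_0_compat; lra. }
  specialize (hn n (le_n _)). rewrite Rabs_pos_eq in hn by (apply pow_le; lra).
  eapply Rle_trans; [apply (key n)|].
  apply Rmult_lt_compat_l with (r := M) in hn; auto.
  replace (M * (e / M)) with e in hn by (field; lra). lra.
Qed.

(** Connectedness of the unit interval in open-and-closed form, by pushing the supremum of the good
    initial segments up to 1; it carries analytic continuation along segments. *)
Lemma interval_connected (Q : R -> Prop) :
  (forall t, 0 <= t <= 1 -> Q t -> exists d, 0 < d /\
     forall t', 0 <= t' <= 1 -> Rabs (t' - t) < d -> Q t') ->
  (forall t, 0 <= t <= 1 -> (forall d, 0 < d -> exists t', 0 <= t' <= 1 /\ Rabs (t' - t) < d /\ Q t') -> Q t) ->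
  Q 0 -> Q 1.
Proof.
  intros ho hc h0.
  set (E := fun t => 0 <= t <= 1 /\ forall s, 0 <= s <= t -> Q s).
  assert (hE0 : E 0). { split; [lra|]. intros s hs. replace s with 0 by lra. auto. }
  destruct (completeness E) as [m [hm1 hm2]].
  - exists 1. intros t [ht _]. lra.
  - now exists 0.
  - assert (hm : 0 <= m <= 1).
    { split; [now apply hm1|]. apply hm2. intros t [ht _]; lra. }
    assert (hlt : forall s, 0 <= s < m -> Q s).
    { intros s hs. apply NNPP. intros hn.
      assert (hub : is_upper_bound E s).
      { intros t [ht1 ht2]. apply Rnot_lt_le. intros hst. apply hn, ht2. lra. }
      specialize (hm2 s hub). lra. }
    assert (hQm : Q m).
    { destruct (Req_dec m 0) as [->|hm0]; auto.
      apply hc; auto. intros d hd. exists (Rmax 0 (m - d / 2)).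
      assert (h1 := Rmax_l 0 (m - d / 2)). assert (h2 := Rmax_r 0 (m - d / 2)).
      assert (h3 : Rmax 0 (m - d / 2) < m) by (apply Rmax_lub_lt; lra).
      split; [lra|]. split; [|apply hlt; lra]. apply Rabs_def1; lra. }
    destruct (ho m hm hQm) as [d [hd hh]].
    destruct (Rle_lt_dec 1 m) as [h1|h1]; [replace 1 with m by lra; auto|].
    exfalso. set (t := Rmin 1 (m + d / 2)).
    assert (ht1 : t <= 1) by apply Rmin_l. assert (ht2 : t <= m + d / 2) by apply Rmin_r.
    assert (ht3 : m < t) by (apply Rmin_glb_lt; lra).
    assert (hE : E t).
    { split; [lra|]. intros s hs. destruct (Rlt_le_dec s m) as [hsm|hsm]; [apply hlt; lra|].
      apply hh; [lra|]. apply Rabs_def1; lra. }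
    specialize (hm1 t hE). lra.
Qed.

Definition zero_near (f : C -> C) (z : C) : Prop :=
  exists r, 0 < r /\ forall w, Cmod (w - z) < r -> f w = 0.

Lemma path_dist a b (t t' : R) :
  Cmod ((a + t' * (b - a)) - (a + t * (b - a)))%C = Rabs (t' - t) * Cmod (b - a).
Proof.
  replace ((a + t' * (b - a)) - (a + t * (b - a)))%C with (RtoC (t' - t) * (b - a))%C
   by (rewrite RtoC_minus; ring).
  now rewrite Cmod_mult, Cmod_R.
Qed.

Lemma zero_propagation f a b :
  (forall t : R, 0 <= t <= 1 -> exists r, 0 < r /\
     forall w, Cmod (w - (a + t * (b - a))) < r -> holo f w) ->
  zero_near f a -> zero_near f b.
Proof.
  intros hf h0.
  set (N := Cmod (b - a) + 1). assert (hN : 0 < N) by (assert (h := Cmod_ge_0 (b - a)); unfold N; lra).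
  assert (hpath : forall (t t' : R) d, Rabs (t' - t) < d / N ->
    Cmod ((a + t' * (b - a)) - (a + t * (b - a)))%C < d).
  { intros t t' d h. rewrite path_dist.
    apply Rmult_lt_compat_r with (r := N) in h; auto.
    replace (d / N * N) with d in h by (field; lra).
    eapply Rle_lt_trans; [|exact h]. apply Rmult_le_compat_l; [apply Rabs_pos|unfold N; lra]. }
  replace b with (a + RtoC 1 * (b - a))%C by ring.
  apply (interval_connected (fun t => zero_near f (a + RtoC t * (b - a))%C)).
  - intros t ht [r [hr hz]]. exists (r / 2 / N). split; [repeat apply Rdiv_lt_0_compat; lra|].
    intros t' _ hd. apply hpath in hd. exists (r / 2). split; [lra|]. intros w hw. apply hz.
    eapply Rle_lt_trans; [apply (Cmod_sub_tri _ (a + t' * (b - a))%C)|]. lra.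
  - intros t ht hcl. destruct (hf t ht) as [r [hr hh]].
    (* The disc of radius r/2 about the nearby point stays in the domain, and [ident_ball] fills a
       third of it: r/6 = r/8 + r/24 covers a disc of radius r/24 about the limit point. *)
    destruct (hcl (r / 8 / N)) as [t' [ht' [hd [eta [heta hz]]]]].
    { repeat apply Rdiv_lt_0_compat; lra. }
    apply hpath in hd. exists (r / 24). split; [lra|]. intros w hw.
    apply (ident_ball f (a + t' * (b - a))%C (r / 2) eta); auto; try lra.
    + intros v hv. apply hh. eapply Rle_lt_trans; [apply (Cmod_sub_tri _ (a + t' * (b - a))%C)|]. lra.
    + eapply Rle_lt_trans; [apply (Cmod_sub_tri _ (a + t * (b - a))%C)|].
      rewrite Cmod_sub_sym in hd. lra.
  - replace (a + RtoC 0 * (b - a))%C with a by ring. auto.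
Qed.

Lemma list_isolated (z : C) (L : list C) : exists r, 0 < r /\
  forall w, In w L -> w <> z -> r <= Cmod (w - z).
Proof.
  induction L as [|a L [r [hr h]]].
  - exists 1. split; [lra|]. intros w [].
  - destruct (Ceq_dec a z) as [->|hn].
    + exists r. split; auto. intros w [<-|hw] hne; [congruence|auto].
    + assert (ha : 0 < Cmod (a - z)) by (apply Cmod_gt_0; intros h0; apply hn, C_sub_0, h0).
      exists (Rmin r (Cmod (a - z))). split; [now apply Rmin_pos|]. intros w [<-|hw] hne.
      * apply Rmin_r.
      * eapply Rle_trans; [apply Rmin_l|auto].
Qed.

Lemma locally_finite_isolated P z : locally_finite P -> exists r, 0 < r /\
  forall w, Cmod (w - z) < r -> w <> z -> ~ P w.
Proof.
  intros h. destruct (h z) as [r [hr [L hL]]]. destruct (list_isolated z L) as [r' [hr' h']].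
  exists (Rmin r r'). split; [now apply Rmin_pos|]. intros w hw hne hP.
  specialize (hL w (Rlt_le_trans _ _ _ hw (Rmin_l _ _)) hP). specialize (h' w hL hne).
  assert (h2 := Rlt_le_trans _ _ _ hw (Rmin_r _ _)). lra.
Qed.

(** A punctured disc is not convex. When the segment from [u] to [w] meets the centre, w - z is a
    negative real multiple of u - z, and the quarter turn [v] of [u] about [z] is visible from both
    ends. *)
Lemma zero_punctured f z r u :
  (forall w, Cmod (w - z) < r -> w <> z -> holo f w) ->
  Cmod (u - z) < r -> u <> z -> zero_near f u ->
  forall w, Cmod (w - z) < r -> w <> z -> zero_near f w.
Proof.
  intros hf hu hne hz.
  assert (step : forall a b, Cmod (a - z) < r -> Cmod (b - z) < r ->
    (forall t : R, 0 <= t <= 1 -> (a + t * (b - a))%C <> z) -> zero_near f a -> zero_near f b).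
  { intros a b ha hb hab. apply zero_propagation. intros t ht.
    set (p := (a + t * (b - a))%C).
    assert (hp : Cmod (p - z) < r).
    { unfold p. replace (a + t * (b - a) - z)%C with (RtoC (1 - t) * (a - z) + RtoC t * (b - z))%C
        by (rewrite RtoC_minus; ring).
      eapply Rle_lt_trans; [apply Cmod_triangle|]. rewrite !Cmod_mult, !Cmod_R, (Rabs_pos_eq (1 - t)), (Rabs_pos_eq t) by lra.
      assert (h1 := Rmax_l (Cmod (a - z)) (Cmod (b - z))).
      assert (h2 := Rmax_r (Cmod (a - z)) (Cmod (b - z))).
      assert (h3 := Rmax_lub_lt _ _ _ ha hb). nra. }
    assert (hpz : 0 < Cmod (p - z)).
    { apply Cmod_gt_0. intros h0. apply (hab t ht), C_sub_0, h0. }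
    exists (Rmin (r - Cmod (p - z)) (Cmod (p - z))). split; [apply Rmin_pos; lra|].
    intros w hw.
    destruct (lt_Rmin _ _ _ hw) as [h1 h2].
    apply hf.
    - eapply Rle_lt_trans; [apply (Cmod_sub_tri _ p)|]. lra.
    - intros ->. rewrite Cmod_sub_sym in h2. lra. }
  intros w hw hwne.
  set (zeta := (u - z)%C).
  assert (hzeta : zeta <> 0) by (intros h0; apply hne, C_sub_0, h0).
  destruct (classic (exists t : R, 0 <= t <= 1 /\ (u + t * (w - u))%C = z)) as [[t [ht htz]]|hn].
  2:{ apply (step u w); auto. intros t ht h0. apply hn. now exists t. }
  set (v := (z + Ci * zeta)%C).
  assert (hv : Cmod (v - z) < r).
  { unfold v. replace (z + Ci * zeta - z)%C with (Ci * zeta)%C by ring.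
    rewrite Cmod_mult, Cmod_Ci. unfold zeta. lra. }
  assert (ht0 : t <> 0).
  { intros ->. apply hne. rewrite <- htz. ring. }
  assert (hk : forall k : C, k <> 0 -> forall p, (p - z)%C = (k * zeta)%C -> p <> z).
  { intros k hk p hp ->. apply (Cmult_neq_0 k zeta); auto. rewrite <- hp. ring. }
  assert (hwz : (w - z)%C = (RtoC (- ((1 - t) / t)) * zeta)%C).
  { assert (e1 : (RtoC t * (w - z))%C = (- (RtoC (1 - t) * zeta))%C).
    { unfold zeta. rewrite RtoC_minus.
      transitivity ((u + t * (w - u)) - z + (1 - t) * (z - u))%C; [ring|rewrite htz; ring]. }
    assert (hc : RtoC t <> 0) by (intros h0; apply (f_equal fst) in h0; simpl in h0; lra).
    transitivity (/ t * (t * (w - z)))%C; [field; auto|]. rewrite e1.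
    rewrite RtoC_opp, RtoC_div by auto. field; auto. }
  assert (ht1 : t <> 1).
  { intros ->. apply hwne. apply C_sub_0. rewrite hwz.
    replace (- ((1 - 1) / 1)) with 0 by field. ring. }
  assert (hkp : 0 < (1 - t) / t) by (apply Rdiv_lt_0_compat; lra).
  apply (step v w); auto.
  - intros s hs. apply (hk (Ci * RtoC (1 - s) + RtoC s * RtoC (- ((1 - t) / t)))%C).
    + intros h0. assert (h1 := f_equal fst h0). assert (h2 := f_equal snd h0). simpl in h1, h2. nra.
    + replace (v + s * (w - v) - z)%C with (RtoC (1 - s) * (v - z) + RtoC s * (w - z))%C
        by (rewrite RtoC_minus; ring).
      rewrite hwz. unfold v. ring.
  - apply (step u v); auto. intros s hs. apply (hk (RtoC (1 - s) + RtoC s * Ci)%C).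
    + intros h0. assert (h1 := f_equal fst h0). assert (h2 := f_equal snd h0). simpl in h1, h2. nra.
    + unfold v, zeta. rewrite RtoC_minus. ring.
Qed.

(** Local finiteness makes every exceptional point isolated, so a horizontal path coming from the
    right may run straight through it: vanishing crosses the point by means of a punctured disc. *)
Theorem identity_right (P : C -> Prop) (f : C -> C) (sigma : R) :
  locally_finite P -> (forall s, ~ P s -> holo f s) ->
  (forall s, sigma < Re s -> ~ P s -> f s = 0) -> forall s, ~ P s -> f s = 0.
Proof.
  intros hP hf h0 s hs.
  (* Values on [P] are ignored, since [f] is arbitrary there; this makes the property meaningful at
     exceptional points of the path as well. *)
  set (AZ := fun z => exists r, 0 < r /\ forall w, Cmod (w - z) < r -> ~ P w -> f w = 0).
  assert (hcl : forall z, (forall d, 0 < d -> exists z', Cmod (z' - z) < d /\ AZ z') -> AZ z).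
  { intros z hz. destruct (locally_finite_isolated P z hP) as [r [hr hiso]].
    destruct (hz (r / 4) ltac:(lra)) as [z' [hz' [r' [hr' hA]]]].
    assert (hu : exists u, u <> z /\ Cmod (u - z') < r' /\ Cmod (u - z) < r).
    { destruct (Ceq_dec z' z) as [->|hne].
      - set (d := Rmin r' (r / 2) / 2).
        assert (hd : 0 < Rmin r' (r / 2)) by (apply Rmin_pos; lra).
        assert (h1 := Rmin_l r' (r / 2)). assert (h2 := Rmin_r r' (r / 2)).
        assert (e : (z + RtoC d - z)%C = RtoC d) by ring.
        exists (z + RtoC d)%C. rewrite e, Cmod_R, Rabs_pos_eq by (unfold d; lra).
        split; [|unfold d; lra]. intros h. apply (f_equal fst) in h. simpl in h. unfold d in h. lra.
      - exists z'. split; auto. replace (z' - z')%C with (RtoC 0) by ring. rewrite Cmod_0. lra. }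
    destruct hu as [u [hu1 [hu2 hu3]]].
    assert (hfz : forall w, Cmod (w - z) < r -> w <> z -> holo f w) by (intros; apply hf, hiso; auto).
    assert (huz : 0 < Cmod (u - z)) by (apply Cmod_gt_0; intros h; apply hu1, C_sub_0, h).
    assert (hzn : zero_near f u).
    { exists (Rmin (r' - Cmod (u - z')) (Rmin (r - Cmod (u - z)) (Cmod (u - z)))).
      split; [repeat apply Rmin_pos; lra|]. intros w hw.
      destruct (lt_Rmin _ _ _ hw) as [h1 h2].
      destruct (lt_Rmin _ _ _ h2) as [h3 h4].
      apply hA; [|apply hiso].
      - assert (h := Cmod_sub_tri w u z'). lra.
      - assert (h := Cmod_sub_tri w u z). lra.
      - intros ->. rewrite Cmod_sub_sym in h4. lra. }
    assert (hall : forall w, Cmod (w - z) < r -> w <> z -> f w = 0).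
    { intros w hw hne. destruct (zero_punctured f z r u hfz hu3 hu1 hzn w hw hne) as [d [hd hh]].
      apply hh. rewrite Cmod_diag. lra. }
    (* At the centre itself, when it is not exceptional, the value is recovered by continuity from
       neighbouring points on the right. *)
    exists r. split; auto. intros w hw hPw. destruct (Ceq_dec w z) as [->|]; [|auto].
    apply C_eq_eps. intros e he. destruct (holo_cont _ _ (hf z hPw) e he) as [d [hd hh]].
    set (k := Rmin d r / 2). assert (hk : 0 < Rmin d r) by now apply Rmin_pos.
    assert (h1 := Rmin_l d r). assert (h2 := Rmin_r d r).
    assert (ek : Cmod (z + RtoC k - z) = k).
    { replace (z + RtoC k - z)%C with (RtoC k) by ring. rewrite Cmod_R, Rabs_pos_eq; unfold k; lra. }
    specialize (hh (z + RtoC k)%C ltac:(rewrite ek; unfold k; lra)).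
    rewrite (hall (z + RtoC k)%C) in hh.
    - rewrite Cmod_sub_sym in hh. lra.
    - rewrite ek; unfold k; lra.
    - intros h. apply (f_equal fst) in h. simpl in h. unfold k in h. lra. }
  assert (hop : forall z, AZ z -> exists d, 0 < d /\ forall z', Cmod (z' - z) < d -> AZ z').
  { intros z [r [hr hA]]. exists (r / 2). split; [lra|]. intros z' hz'. exists (r / 2). split; [lra|].
    intros w hw. apply hA. assert (h := Cmod_sub_tri w z' z). lra. }
  set (T := Rabs (sigma - Re s) + 2).
  assert (hT : 0 < T /\ sigma + 1 < Re s + T).
  { assert (h1 := Rle_abs (sigma - Re s)). assert (h2 := Rabs_pos (sigma - Re s)). unfold T; lra. }
  assert (hAs : AZ s).
  { replace s with ((s + RtoC T) + RtoC 1 * (s - (s + RtoC T)))%C by ring.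
    assert (hd : forall (t t' : R) d, Rabs (t' - t) < d / T ->
      Cmod ((s + RtoC T + t' * (s - (s + RtoC T))) - (s + RtoC T + t * (s - (s + RtoC T))))%C < d).
    { intros t t' d h. rewrite path_dist. replace (s - (s + RtoC T))%C with (- RtoC T)%C by ring.
      rewrite Cmod_opp, Cmod_R, (Rabs_pos_eq T) by lra.
      apply Rmult_lt_compat_r with (r := T) in h; [|lra].
      replace (d / T * T) with d in h by (field; lra). lra. }
    apply (interval_connected (fun t => AZ ((s + RtoC T) + RtoC t * (s - (s + RtoC T)))%C)).
    - intros t ht hA. destruct (hop _ hA) as [d [hd' hh]]. exists (d / T).
      split; [apply Rdiv_lt_0_compat; lra|]. intros t' _ h. apply hh, hd, h.
    - intros t ht h. apply hcl. intros d hd'.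
      destruct (h (d / T)) as [t' [_ [h1 h2]]]; [apply Rdiv_lt_0_compat; lra|].
      eexists. split; [apply hd, h1|exact h2].
    - replace (s + T + 0 * (s - (s + T)))%C with (s + T)%C by ring.
      exists 1. split; [lra|]. intros w hw hPw. apply h0; auto.
      assert (h1 := Rle_lt_trans _ _ _ (re_le_Cmod _) hw). apply Rabs_def2 in h1.
      change (Re (w - (s + T))) with (Re w - (Re s + T)) in h1. lra. }
  destruct hAs as [r [hr hh]]. apply hh; auto.
  rewrite Cmod_diag. lra.
Qed.

Lemma locally_finite_reflect (P : C -> Prop) (a : C) :
  locally_finite P -> locally_finite (fun s => P (a - s)%C).
Proof.
  intros h z. destruct (h (a - z)%C) as [r [hr [L hL]]]. exists r. split; auto.
  exists (map (fun w => a - w)%C L). intros w hw hP.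
  replace w with (a - (a - w))%C by ring. apply (in_map (fun w => a - w)%C). apply hL; auto.
  replace (a - w - (a - z))%C with (- (w - z))%C by ring. now rewrite Cmod_opp.
Qed.

Lemma locally_finite_or (P Q : C -> Prop) :
  locally_finite P -> locally_finite Q -> locally_finite (fun s => P s \/ Q s).
Proof.
  intros h1 h2 z. destruct (h1 z) as [r [hr [L hL]]]. destruct (h2 z) as [r' [hr' [L' hL']]].
  exists (Rmin r r'). split; [now apply Rmin_pos|]. exists (L ++ L'). intros w hw hP.
  apply in_or_app. destruct hP as [hP|hP]; [left; apply hL|right; apply hL']; auto;
  eapply Rlt_le_trans; [exact hw|apply Rmin_l|exact hw|apply Rmin_r].
Qed.

Lemma holo_reflect f a s : holo f (a - s)%C -> holo (fun s => f (a - s)%C) s.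
Proof.
  intros h. apply (holo_comp f); auto. apply holo_minus; [apply holo_const|apply holo_id].
Qed.

Theorem identity_left (P : C -> Prop) (f : C -> C) (sigma : R) :
  locally_finite P -> (forall s, ~ P s -> holo f s) ->
  (forall s, Re s < sigma -> ~ P s -> f s = 0) -> forall s, ~ P s -> f s = 0.
Proof.
  intros hP hf h0 s hs.
  assert (e : forall s : C, (0 - (0 - s))%C = s) by (intros; ring).
  rewrite <- (e s). apply (identity_right (fun s => P (0 - s)%C) (fun s => f (0 - s)%C) (- sigma)).
  - now apply locally_finite_reflect.
  - intros z hz. apply holo_reflect. now apply hf.
  - intros z hz hPz. apply h0; auto. change (Re (0 - z)) with (0 - Re z). lra.
  - now rewrite e.
Qed.

(** * The complex exponential *)

Lemma cexp_plus z w : cexp (z + w) = (cexp z * cexp w)%C.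
Proof.
  unfold cexp. destruct z as [x y], w as [u v]; simpl.
  rewrite exp_plus, cos_plus, sin_plus. apply Ceq; simpl; ring.
Qed.

Lemma cexp_0 : cexp 0 = 1.
Proof. unfold cexp; simpl. rewrite exp_0, cos_0, sin_0. apply Ceq; simpl; ring. Qed.

Lemma cexp_opp_r z : (cexp z * cexp (- z) = 1)%C.
Proof. rewrite <- cexp_plus, <- cexp_0. f_equal. ring. Qed.

Lemma cexp_neq_0 z : cexp z <> 0.
Proof.
  intros h. assert (h1 := cexp_opp_r z). rewrite h in h1.
  apply (f_equal fst) in h1. simpl in h1. lra.
Qed.

Lemma cexp_opp z : cexp (- z) = (/ cexp z)%C.
Proof.
  assert (h := cexp_neq_0 z).
  transitivity (/ cexp z * (cexp z * cexp (- z)))%C; [field; auto|].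
  rewrite cexp_opp_r. ring.
Qed.

Lemma Cmod_cexp z : Cmod (cexp z) = exp (Re z).
Proof.
  unfold cexp, Cmod; simpl.
  replace (exp (Re z) * cos (Im z) * (exp (Re z) * cos (Im z) * 1) +
    exp (Re z) * sin (Im z) * (exp (Re z) * sin (Im z) * 1))
    with (exp (Re z) * exp (Re z) * ((sin (Im z))² + (cos (Im z))²)) by (unfold Rsqr; ring).
  rewrite sin2_cos2, Rmult_1_r. apply sqrt_square. left; apply exp_pos.
Qed.

Lemma cexp_pow z n : (cexp z ^ n)%C = cexp (RtoC (INR n) * z).
Proof.
  induction n.
  - simpl. rewrite <- cexp_0. f_equal. ring.
  - rewrite S_INR, RtoC_plus. change (cexp z ^ S n)%C with (cexp z * cexp z ^ n)%C.
    rewrite IHn, <- cexp_plus. f_equal. ring.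
Qed.

Lemma exp_le x y : x <= y -> exp x <= exp y.
Proof. intros [h| ->]; [left; now apply exp_increasing|lra]. Qed.

Lemma exp_m1_le x : Rabs (exp x - 1) <= Rabs x * exp (Rabs x).
Proof.
  assert (h1 := exp_ineq1_le x). assert (h2 := exp_ineq1_le (- x)).
  assert (hx := exp_pos x). rewrite exp_Ropp in h2.
  assert (h3 : exp x - 1 <= x * exp x).
  { apply Rmult_le_compat_l with (r := exp x) in h2; [|lra]. rewrite Rinv_r in h2; lra. }
  destruct (Rle_lt_dec 0 x) as [h|h].
  - rewrite !Rabs_pos_eq by lra. lra.
  - rewrite (Rabs_left x), Rabs_left1 by nra.
    assert (1 <= exp (- x)) by (rewrite <- exp_0; apply exp_le; lra). nra.
Qed.

(** From x <= exp x - 1 <= x exp x one gets 0 <= exp x - 1 - x <= x (exp x - 1). *)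
Lemma exp_m1_x_le x : Rabs (exp x - 1 - x) <= x * x * exp (Rabs x).
Proof.
  assert (h1 := exp_ineq1_le x). assert (h2 := exp_ineq1_le (- x)).
  assert (hx := exp_pos x). rewrite exp_Ropp in h2.
  assert (h3 : exp x - 1 <= x * exp x).
  { apply Rmult_le_compat_l with (r := exp x) in h2; [|lra]. rewrite Rinv_r in h2; lra. }
  rewrite Rabs_pos_eq by lra. assert (h4 := exp_m1_le x).
  assert (h5 : x * (exp x - 1) <= Rabs x * Rabs (exp x - 1)).
  { rewrite <- Rabs_mult. apply Rle_abs. }
  assert (h6 : Rabs x * Rabs x = x * x) by (unfold Rabs; destruct (Rcase_abs x); ring).
  assert (h7 := Rabs_pos x). assert (h8 := exp_pos (Rabs x)).
  apply Rle_trans with (Rabs x * (Rabs x * exp (Rabs x))); [|rewrite <- Rmult_assoc, h6; lra].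
  eapply Rle_trans; [|apply Rmult_le_compat_l; [auto|exact h4]]. lra.
Qed.

Lemma sin_abs_le u : Rabs (sin u) <= Rabs u.
Proof.
  assert (h := bounded_variation sin cos 1 0 u).
  rewrite sin_0, !Rminus_0_r, Rmult_1_l in h. apply h. intros t _. split.
  - auto_derive; auto; ring.
  - apply Rabs_le, COS_bound.
Qed.

Lemma cos_m1 u : cos u - 1 = - (2 * (sin (u / 2) * sin (u / 2))).
Proof.
  replace u with (2 * (u / 2)) at 1 by field. rewrite cos_2a_sin. ring.
Qed.

Lemma cos_m1_le1 u : Rabs (cos u - 1) <= Rabs u.
Proof.
  rewrite cos_m1, Rabs_Ropp, !Rabs_mult, (Rabs_pos_eq 2) by lra.
  assert (h1 := sin_abs_le (u / 2)). assert (h2 : Rabs (sin (u / 2)) <= 1) by apply Rabs_le, SIN_bound.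
  unfold Rdiv in h1 at 2. rewrite Rabs_mult, (Rabs_pos_eq (/ 2)) in h1 by lra.
  assert (h3 := Rabs_pos (sin (u / 2))). nra.
Qed.

Lemma cos_m1_le2 u : Rabs (cos u - 1) <= u * u / 2.
Proof.
  rewrite cos_m1, Rabs_Ropp, !Rabs_mult, (Rabs_pos_eq 2) by lra.
  assert (h1 := sin_abs_le (u / 2)).
  assert (h6 : Rabs (u / 2) * Rabs (u / 2) = u * u / 4).
  { rewrite <- Rabs_mult, Rabs_pos_eq; [field|nra]. }
  assert (h3 := Rabs_pos (sin (u / 2))). nra.
Qed.

Lemma sin_m_le u : Rabs (sin u - u) <= u * u.
Proof.
  assert (h := bounded_variation (fun t => sin t - t) (fun t => cos t - 1) (Rabs u) 0 u).
  cbv beta in h. rewrite sin_0, !Rminus_0_r in h.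
  assert (h6 : Rabs u * Rabs u = u * u) by (rewrite <- Rabs_mult, Rabs_pos_eq; [auto|nra]).
  rewrite <- h6. apply h. intros t ht. rewrite Rminus_0_r in ht. split.
  - auto_derive; auto; ring.
  - eapply Rle_trans; [apply cos_m1_le1|auto].
Qed.

Lemma cexp_m1_le z : Cmod (cexp z - 1) <= 3 * Cmod z * exp (Cmod z).
Proof.
  destruct z as [x y]. set (z := (x, y) : C).
  assert (hx : Rabs x <= Cmod z) by apply (re_le_Cmod z).
  assert (hy : Rabs y <= Cmod z) by apply (im_le_Cmod z).
  eapply Rle_trans; [apply Cmod_le_abs|]. simpl.
  assert (b1 := exp_m1_le x). assert (b2 := cos_m1_le1 y). assert (b3 := sin_abs_le y).
  assert (e1 : exp (Rabs x) <= exp (Cmod z)) by now apply exp_le.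
  assert (e2 : exp x <= exp (Cmod z)) by (apply exp_le; assert (h := Rle_abs x); lra).
  assert (p1 := Rabs_pos x). assert (p2 := Rabs_pos y). assert (p3 := exp_pos x).
  assert (p4 := exp_pos (Rabs x)).
  set (E := exp (Cmod z)) in *. set (N := Cmod z) in *.
  assert (t1 : Rabs (exp x * cos y - 1) <= 2 * N * E).
  { replace (exp x * cos y - 1) with ((exp x - 1) + exp x * (cos y - 1)) by ring.
    eapply Rle_trans; [apply Rabs_triang|]. rewrite Rabs_mult, (Rabs_pos_eq (exp x)) by lra.
    assert (Rabs x * exp (Rabs x) <= N * E) by (apply Rmult_le_compat; lra).
    assert (exp x * Rabs (cos y - 1) <= E * N).
    { apply Rmult_le_compat; try lra. apply Rabs_pos. }
    lra. }
  assert (t2 : Rabs (exp x * sin y) <= E * N).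
  { rewrite Rabs_mult, (Rabs_pos_eq (exp x)) by lra. apply Rmult_le_compat; try lra. apply Rabs_pos. }
  replace (exp x * sin y + - 0) with (exp x * sin y) by ring.
  unfold Rminus in t1. lra.
Qed.

(** The quadratic remainder gives the derivative of [cexp], and also the summable deviation of
    consecutive ratios in Gauss's limit. *)
Lemma cexp_m1_z_le z : Cmod (cexp z - 1 - z) <= 4 * (Cmod z * Cmod z) * exp (Cmod z).
Proof.
  destruct z as [x y]. set (z := (x, y) : C).
  assert (hx : Rabs x <= Cmod z) by apply (re_le_Cmod z).
  assert (hy : Rabs y <= Cmod z) by apply (im_le_Cmod z).
  eapply Rle_trans; [apply Cmod_le_abs|]. simpl.
  assert (b0 := exp_m1_x_le x). assert (b1 := exp_m1_le x).
  assert (b2 := cos_m1_le2 y). assert (b3 := sin_m_le y).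
  assert (e1 : exp (Rabs x) <= exp (Cmod z)) by now apply exp_le.
  assert (e2 : exp x <= exp (Cmod z)) by (apply exp_le; assert (h := Rle_abs x); lra).
  assert (p1 := Rabs_pos x). assert (p2 := Rabs_pos y). assert (p3 := exp_pos x).
  assert (p4 := exp_pos (Rabs x)).
  assert (sx : x * x <= Cmod z * Cmod z).
  { replace (x * x) with (Rabs x * Rabs x) by (rewrite <- Rabs_mult, Rabs_pos_eq; [auto|nra]).
    apply Rmult_le_compat; lra. }
  assert (sy : y * y <= Cmod z * Cmod z).
  { replace (y * y) with (Rabs y * Rabs y) by (rewrite <- Rabs_mult, Rabs_pos_eq; [auto|nra]).
    apply Rmult_le_compat; lra. }
  assert (sx0 : 0 <= x * x) by nra. assert (sy0 : 0 <= y * y) by nra.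
  set (E := exp (Cmod z)) in *. set (N := Cmod z) in *.
  assert (t1 : Rabs (exp x * cos y - 1 - x) <= N * N * E + E * (N * N / 2)).
  { replace (exp x * cos y - 1 - x) with ((exp x - 1 - x) + exp x * (cos y - 1)) by ring.
    eapply Rle_trans; [apply Rabs_triang|]. rewrite Rabs_mult, (Rabs_pos_eq (exp x)) by lra.
    assert (x * x * exp (Rabs x) <= N * N * E) by (apply Rmult_le_compat; lra).
    assert (exp x * Rabs (cos y - 1) <= E * (N * N / 2)).
    { apply Rmult_le_compat; try lra. apply Rabs_pos. }
    lra. }
  assert (t2 : Rabs (exp x * sin y - y) <= E * (N * N) + N * (N * E)).
  { replace (exp x * sin y - y) with (exp x * (sin y - y) + y * (exp x - 1)) by ring.
    eapply Rle_trans; [apply Rabs_triang|]. rewrite !Rabs_mult, (Rabs_pos_eq (exp x)) by lra.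
    apply Rplus_le_compat.
    - apply Rmult_le_compat; try lra. apply Rabs_pos.
    - apply Rmult_le_compat; try lra. apply Rabs_pos.
      eapply Rle_trans; [exact b1|]. apply Rmult_le_compat; lra. }
  replace (exp x * sin y + - 0 + - y) with (exp x * sin y - y) by ring.
  replace (exp x * cos y + - (1) + - x) with (exp x * cos y - 1 - x) by ring.
  assert (0 < E) by apply exp_pos. nra.
Qed.

Lemma cexp_diff a b : Cmod (cexp a - cexp b) <= exp (Re b) * (3 * Cmod (a - b) * exp (Cmod (a - b))).
Proof.
  replace (cexp a - cexp b)%C with (cexp b * (cexp (a - b) - 1))%C.
  - rewrite Cmod_mult, Cmod_cexp. apply Rmult_le_compat_l; [left; apply exp_pos|apply cexp_m1_le].
  - replace (cexp a) with (cexp (b + (a - b))) by (f_equal; ring). rewrite cexp_plus. ring.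
Qed.

Lemma holo_cexp z : holo cexp z.
Proof.
  apply holo_of_eps with (cexp z). intros e he.
  set (A := exp (Re z) * (4 * exp 1)).
  assert (hA : 0 < A) by (unfold A; assert (h1 := exp_pos (Re z)); assert (h2 := exp_pos 1); nra).
  exists (Rmin 1 (e / A)). split; [apply Rmin_pos; [lra|now apply Rdiv_lt_0_compat]|].
  intros w hw.
  destruct (lt_Rmin _ _ _ hw) as [h1 h2].
  replace (cexp w - cexp z - cexp z * (w - z))%C with (cexp z * (cexp (w - z) - 1 - (w - z)))%C.
  2:{ replace (cexp w) with (cexp (z + (w - z))) by (f_equal; ring). rewrite cexp_plus. ring. }
  rewrite Cmod_mult, Cmod_cexp.
  set (h := Cmod (w - z)) in *. assert (h0 : 0 <= h) by apply Cmod_ge_0.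
  assert (b := cexp_m1_z_le (w - z)). fold h in b.
  assert (eh : exp h <= exp 1) by (apply exp_le; lra).
  apply Rlt_le in h2. apply Rmult_le_compat_r with (r := A) in h2; [|lra].
  replace (e / A * A) with e in h2 by (field; lra).
  apply Rle_trans with (exp (Re z) * (4 * (h * h) * exp 1)).
  - apply Rmult_le_compat_l; [left; apply exp_pos|]. eapply Rle_trans; [exact b|].
    apply Rmult_le_compat_l; [nra|auto].
  - replace (exp (Re z) * (4 * (h * h) * exp 1)) with (h * A * h) by (unfold A; ring).
    now apply Rmult_le_compat_r.
Qed.

Lemma cpowR_plus x s t : cpowR x (s + t) = (cpowR x s * cpowR x t)%C.
Proof. unfold cpowR. rewrite <- cexp_plus. f_equal. ring. Qed.

Lemma cpowR_mult x y s : 0 < x -> 0 < y -> cpowR (x * y) s = (cpowR x s * cpowR y s)%C.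
Proof. intros hx hy. unfold cpowR. rewrite ln_mult, RtoC_plus, <- cexp_plus by auto. f_equal. ring. Qed.

Lemma cpowR_opp x s : cpowR x (- s) = (/ cpowR x s)%C.
Proof. unfold cpowR. rewrite <- cexp_opp. f_equal. ring. Qed.

Lemma cpowR_1_l s : cpowR 1 s = 1.
Proof. unfold cpowR. rewrite ln_1, <- cexp_0. f_equal. ring. Qed.

Lemma cpowR_1_r x : 0 < x -> cpowR x 1 = RtoC x.
Proof.
  intros hx. unfold cpowR, cexp. apply Ceq; simpl;
  replace (ln x * 1 - 0 * 0) with (ln x) by ring; replace (ln x * 0 + 0 * 1) with 0 by ring;
  rewrite ?exp_ln, ?cos_0, ?sin_0 by auto; ring.
Qed.

Lemma cpowR_neq_0 x s : cpowR x s <> 0.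
Proof. apply cexp_neq_0. Qed.

Lemma Cmod_cpowR x s : Cmod (cpowR x s) = exp (ln x * Re s).
Proof.
  unfold cpowR. rewrite Cmod_cexp. apply (f_equal exp). destruct s; simpl. ring.
Qed.

Lemma holo_cpowR x z : holo (cpowR x) z.
Proof.
  unfold cpowR. apply (holo_comp cexp); [|apply holo_cexp].
  apply holo_mult; [apply holo_const|apply holo_id].
Qed.

Lemma e_plus z w : e (z + w) = (e z * e w)%C.
Proof. unfold e. rewrite <- cexp_plus. f_equal. ring. Qed.

Lemma e_0 : e 0 = 1.
Proof. unfold e. rewrite <- cexp_0. f_equal. ring. Qed.

Lemma e_R (x : R) : e x = (cos (2 * PI * x), sin (2 * PI * x)).
Proof.
  unfold e, cexp. simpl.
  replace ((2 * PI * 0 - 0 * 1) * x - (2 * PI * 1 + 0 * 0) * 0) with 0 by ring.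
  replace ((2 * PI * 0 - 0 * 1) * 0 + (2 * PI * 1 + 0 * 0) * x) with (2 * PI * x) by ring.
  rewrite exp_0, !Rmult_1_l. reflexivity.
Qed.

Lemma Cmod_e_R (x : R) : Cmod (e x) = 1.
Proof.
  unfold e. rewrite Cmod_cexp. simpl.
  replace ((2 * PI * 0 - 0 * 1) * x - (2 * PI * 1 + 0 * 0) * 0) with 0 by ring. apply exp_0.
Qed.

Lemma e_INR (n : nat) : e (RtoC (INR n)) = 1.
Proof.
  induction n; [apply e_0|]. rewrite S_INR, RtoC_plus, e_plus, IHn, e_R.
  rewrite Rmult_1_r, cos_2PI, sin_2PI. apply Ceq; simpl; ring.
Qed.

Lemma e_IZR (n : Z) : e (RtoC (IZR n)) = 1.
Proof.
  destruct (Z_le_dec 0 n) as [h|h].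
  - rewrite <- (Z2Nat.id n h), <- INR_IZR_INZ. apply e_INR.
  - assert (h1 : (e (IZR n) * e (IZR (- n)) = 1)%C).
    { rewrite <- e_plus, <- RtoC_plus, <- plus_IZR. replace (n + - n)%Z with 0%Z by lia. apply e_0. }
    rewrite <- (Z2Nat.id (- n)%Z), <- INR_IZR_INZ, e_INR in h1 by lia. rewrite <- h1. ring.
Qed.

Lemma holo_e z : holo e z.
Proof.
  unfold e. apply (holo_comp cexp); [|apply holo_cexp].
  apply holo_mult; [apply holo_const|apply holo_id].
Qed.

(** * Calculus of limits and explicit rates *)

Lemma clim_unique u l l' : clim u l -> clim u l' -> l = l'.
Proof.
  intros h h'. apply C_eq_eps. intros e he.
  destruct (h (e/2) ltac:(lra)) as [n1 h1]. destruct (h' (e/2) ltac:(lra)) as [n2 h2].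
  specialize (h1 (Nat.max n1 n2) (Nat.le_max_l _ _)). specialize (h2 (Nat.max n1 n2) (Nat.le_max_r _ _)).
  assert (ht := Cmod_sub_tri l (u (Nat.max n1 n2)) l'). rewrite (Cmod_sub_sym l (u _)) in ht. lra.
Qed.

Lemma clim_ext_ev u v l n0 : (forall n, (n0 <= n)%nat -> u n = v n) -> clim u l -> clim v l.
Proof.
  intros h hu e he. destruct (hu e he) as [n1 h1]. exists (Nat.max n0 n1). intros n hn.
  rewrite <- h by lia. apply h1. lia.
Qed.

Lemma clim_const c : clim (fun _ => c) c.
Proof.
  intros e he. exists O. intros n _. now rewrite Cmod_diag.
Qed.

Lemma clim_plus u v l m : clim u l -> clim v m -> clim (fun n => u n + v n)%C (l + m)%C.
Proof.
  intros hu hv e he.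
  destruct (hu (e/2) ltac:(lra)) as [n1 h1]. destruct (hv (e/2) ltac:(lra)) as [n2 h2].
  exists (Nat.max n1 n2). intros n hn. specialize (h1 n ltac:(lia)). specialize (h2 n ltac:(lia)).
  replace (u n + v n - (l + m))%C with ((u n - l) + (v n - m))%C by ring.
  eapply Rle_lt_trans; [apply Cmod_triangle|lra].
Qed.

Lemma clim_cont f u l : cont f l -> clim u l -> clim (fun n => f (u n)) (f l).
Proof.
  intros hf hu e he. destruct (hf e he) as [d [hd h]]. destruct (hu d hd) as [n0 h0].
  exists n0. intros n hn. apply h, h0, hn.
Qed.

Lemma clim_scal c u l : clim u l -> clim (fun n => c * u n)%C (c * l)%C.
Proof. apply (clim_cont (fun z => c * z)%C). apply cont_mult; [apply cont_const|apply cont_id]. Qed.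

Lemma clim_mult u v l m : clim u l -> clim v m -> clim (fun n => u n * v n)%C (l * m)%C.
Proof.
  intros hu hv.
  assert (h : clim (fun n => (u n - l) * (v n - m))%C 0).
  { intros e he. destruct (hu e he) as [n1 h1]. destruct (hv 1 ltac:(lra)) as [n2 h2].
    exists (Nat.max n1 n2). intros n hn. specialize (h1 n ltac:(lia)). specialize (h2 n ltac:(lia)).
    replace ((u n - l) * (v n - m) - 0)%C with ((u n - l) * (v n - m))%C by ring.
    rewrite Cmod_mult. assert (k1 := Cmod_ge_0 (u n - l)). assert (k2 := Cmod_ge_0 (v n - m)). nra. }
  assert (h' := clim_plus _ _ _ _ h (clim_plus _ _ _ _ (clim_scal m _ _ hu)
     (clim_plus _ _ _ _ (clim_scal l _ _ hv) (clim_const (- (l * m))%C)))).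
  replace (l * m)%C with (0 + (m * l + (l * m + - (l * m))))%C by ring.
  eapply clim_ext_ev with (n0 := O); [|exact h']. intros n _; simpl; ring.
Qed.

Lemma rate_archi M eps : 0 < eps -> exists n0, (1 <= n0)%nat /\ forall n, (n0 <= n)%nat -> M / INR n < eps.
Proof.
  intros he. assert (hM := Rabs_pos M). assert (hM' := Rle_abs M).
  destruct (INR_archimed (eps / (Rabs M + 1)) 1) as [n0 hn0]; [apply Rdiv_lt_0_compat; lra|].
  assert (hnn : 0 < INR n0).
  { destruct n0; [simpl in hn0; lra|apply lt_0_INR; lia]. }
  exists (S n0). split; [lia|]. intros n hn.
  assert (hle : INR n0 < INR n) by (apply lt_INR; lia).
  apply Rmult_lt_reg_r with (INR n); [lra|].
  unfold Rdiv. rewrite Rmult_assoc, Rinv_l, Rmult_1_r by lra.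
  apply Rmult_lt_compat_r with (r := Rabs M + 1) in hn0; [|lra].
  replace (INR n0 * (eps / (Rabs M + 1)) * (Rabs M + 1)) with (INR n0 * eps) in hn0 by (field; lra).
  nra.
Qed.

Lemma clim_of_rate u l M : (forall n, (1 <= n)%nat -> Cmod (u n - l) <= M / INR n) -> clim u l.
Proof.
  intros h e he. destruct (rate_archi M e he) as [n0 [h1 h0]]. exists n0. intros n hn.
  eapply Rle_lt_trans; [apply h; lia|auto].
Qed.

Lemma clim_lim_seq u l : clim u l ->
  (real (Lim_seq (fun n => Re (u n))), real (Lim_seq (fun n => Im (u n)))) = l.
Proof.
  intros h.
  assert (h1 : is_lim_seq (fun n => Re (u n)) (Re l)).
  { apply is_lim_seq_Reals. intros e he. destruct (h e he) as [n0 h0]. exists n0. intros n hn.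
    eapply Rle_lt_trans; [apply (re_le_Cmod (u n - l))|]. apply h0; lia. }
  assert (h2 : is_lim_seq (fun n => Im (u n)) (Im l)).
  { apply is_lim_seq_Reals. intros e he. destruct (h e he) as [n0 h0]. exists n0. intros n hn.
    eapply Rle_lt_trans; [apply (im_le_Cmod (u n - l))|]. apply h0; lia. }
  rewrite (is_lim_seq_unique _ _ h1), (is_lim_seq_unique _ _ h2). destruct l; reflexivity.
Qed.

(** * The reciprocal of the Gamma function *)

(* [(-1)^n] times the binomial coefficient of [-w] over [n]: the Taylor coefficients of
   [(1 - z)^(-w)]. *)
Fixpoint bincoef (w : C) (n : nat) : C :=
  match n with
  | O => RtoC 1
  | S m => (bincoef w m * ((w + RtoC (INR m)) / RtoC (INR (S m))))%C
  end.

Definition gam (n : nat) (w : C) : C := (bincoef w n * cpowR (INR n) (1 - w))%C.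

Lemma RtoC_INR_S n : RtoC (INR (S n)) <> 0.
Proof. intros h. apply (f_equal fst) in h. simpl fst in h. apply (not_0_INR (S n)); auto. Qed.

Lemma RtoC_neq_0 x : x <> 0 -> RtoC x <> 0.
Proof. intros hx h. apply (f_equal fst) in h. simpl in h. auto. Qed.

Lemma ln_1p_bounds u : 0 <= u -> u - u * u <= ln (1 + u) <= u.
Proof.
  intros hu. split.
  - assert (h : ln (/ (1 + u)) <= / (1 + u) - 1).
    { assert (h := exp_ineq1_le (ln (/ (1 + u)))). rewrite exp_ln in h; [lra|].
      apply Rinv_0_lt_compat; lra. }
    rewrite ln_Rinv in h by lra.
    assert (h2 : / (1 + u) <= 1 - u + u * u).
    { apply Rmult_le_reg_r with (1 + u); [lra|]. rewrite Rinv_l by lra. nra. }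
    lra.
  - assert (h := exp_ineq1_le (ln (1 + u))). rewrite exp_ln in h; lra.
Qed.

(** The ratio of consecutive terms of [gam], that is (1 + w/n)(1 + 1/n)^(-w). Its first-order terms
    in 1/n cancel, which is what makes the product converge. *)
Definition rho (n : nat) (w : C) : C :=
  ((1 + w / RtoC (INR n)) * cexp (- w * RtoC (ln (1 + / INR n))))%C.

(** Turns every tail of the sum of 1/n^2 into a telescoping one, with remainder at most 2/n. *)
Lemma inv_sq_telescope x : 1 <= x -> / x * / x <= 2 * / x - 2 * / (x + 1).
Proof.
  intros hx. apply Rmult_le_reg_r with (x * x * (x + 1)); [nra|].
  replace (/ x * / x * (x * x * (x + 1))) with (x + 1) by (field; lra).
  replace ((2 * / x - 2 * / (x + 1)) * (x * x * (x + 1))) with (2 * x) by (field; lra). lra.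
Qed.

Lemma gam_S n w : (1 <= n)%nat -> gam (S n) w = (gam n w * rho n w)%C.
Proof.
  intros hn. assert (hm : 0 < INR n) by (apply lt_0_INR; lia).
  assert (hi : 0 < / INR n) by now apply Rinv_0_lt_compat.
  unfold gam, rho.
  change (bincoef w (S n)) with (bincoef w n * ((w + RtoC (INR n)) / RtoC (INR (S n))))%C.
  assert (e1 : INR (S n) = INR n * (1 + / INR n)) by (rewrite S_INR; field; lra).
  assert (e2 : cpowR (INR (S n)) (1 - w) =
    (cpowR (INR n) (1 - w) * (RtoC (1 + / INR n) * cexp (- w * RtoC (ln (1 + / INR n)))))%C).
  { rewrite e1, cpowR_mult by lra. f_equal. unfold Cminus. rewrite cpowR_plus, cpowR_1_r by lra.
    f_equal. unfold cpowR. f_equal. ring. }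
  rewrite e2, e1, RtoC_mult.
  assert (h1 : RtoC (INR n) <> 0) by (apply RtoC_neq_0; lra).
  assert (h2 : RtoC (1 + / INR n) <> 0) by (apply RtoC_neq_0; lra).
  set (X := RtoC (1 + / INR n)) in *. field. auto.
Qed.

(** The modulus of 1 + w u is computed exactly, so that only [Re w] appears at first order and
    cancels against the power. The cruder 1 + |w| u would leave an unbounded power of n in the
    product. *)
Lemma rho_bound n w : (1 <= n)%nat ->
  Cmod (rho n w) <= exp ((Cmod w + Cmod w * Cmod w) * (/ INR n * / INR n)).
Proof.
  intros hn. assert (hm : 0 < INR n) by (apply lt_0_INR; lia).
  set (u := / INR n). assert (hu : 0 < u) by now apply Rinv_0_lt_compat.
  destruct (ln_1p_bounds u ltac:(lra)) as [b1 b2].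
  unfold rho. fold u. rewrite Cmod_mult, Cmod_cexp.
  replace (w / RtoC (INR n))%C with (w * RtoC u)%C by (unfold u; rewrite RtoC_inv by lra; reflexivity).
  set (x := Cmod w).
  assert (h1 : Cmod (1 + w * RtoC u) <= exp (Re w * u + x * x * (u * u) / 2)).
  { apply Rsqr_incr_0_var; [|left; apply exp_pos]. unfold Rsqr. rewrite <- exp_plus.
    assert (hs : Cmod (1 + w * RtoC u) * Cmod (1 + w * RtoC u) = 1 + 2 * (Re w * u) + x * x * (u * u)).
    { assert (e1 := Cmod2_alt (1 + w * RtoC u)). assert (e2 := Cmod2_alt w). fold x in e2.
      replace (Cmod (1 + w * u) * Cmod (1 + w * u)) with (Cmod (1 + w * u) ^ 2) by ring.
      replace (x * x) with (x ^ 2) by ring. rewrite e1, e2. destruct w; simpl. ring. }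
    rewrite hs. eapply Rle_trans; [|apply exp_ineq1_le]. lra. }
  assert (h2 : Re (- w * RtoC (ln (1 + u)))%C = - (Re w * ln (1 + u))) by (destruct w; simpl; ring).
  rewrite h2.
  eapply Rle_trans; [apply Rmult_le_compat_r; [left; apply exp_pos|exact h1]|].
  rewrite <- exp_plus. apply exp_le.
  assert (h3 : Rabs (Re w) <= x) by apply re_le_Cmod.
  assert (h4 : Re w * (u - ln (1 + u)) <= x * (u * u)).
  { assert (h5 := Rle_abs (Re w)). assert (h6 := Cmod_ge_0 w). fold x in h6. nra. }
  assert (0 <= x * x * (u * u)) by (assert (h6 := Cmod_ge_0 w); fold x in h6; nra).
  lra.
Qed.

Lemma rho_m1_bound n w : (1 <= n)%nat ->
  Cmod (rho n w - 1) <= (exp (Cmod w) * (Cmod w + 4 * (Cmod w * Cmod w) * exp (Cmod w))) * (/ INR n * / INR n).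
Proof.
  intros hn. assert (hm : 1 <= INR n) by (apply INR_ge1; lia).
  set (u := / INR n). assert (hu : 0 < u) by (apply Rinv_0_lt_compat; lra).
  assert (hu1 : u <= 1) by (unfold u; rewrite <- Rinv_1; apply Rinv_le_contravar; lra).
  destruct (ln_1p_bounds u ltac:(lra)) as [b1 b2].
  unfold rho. fold u.
  replace (w / RtoC (INR n))%C with (w * RtoC u)%C by (unfold u; rewrite RtoC_inv by lra; reflexivity).
  set (v := ln (1 + u)) in *. assert (hv : 0 <= v) by nra.
  set (x := Cmod w). assert (hx : 0 <= x) by apply Cmod_ge_0.
  (* With the exponential factored out, both remaining pieces, w (u - v) and the quadratic remainder
     of exp(w v), are of order u^2. *)
  replace ((1 + w * u) * cexp (- w * v) - 1)%C with
    (cexp (- w * v) * (w * RtoC (u - v) - (cexp (w * v) - 1 - w * v)))%C.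
  2:{ assert (h := cexp_opp_r (w * v)). replace (- (w * v))%C with (- w * v)%C in h by ring.
      rewrite RtoC_minus. transitivity (cexp (- w * v) * (1 + w * u) - cexp (w * v) * cexp (- w * v))%C;
      [ring|rewrite h; ring]. }
  rewrite Cmod_mult, Cmod_cexp, Rmult_assoc.
  assert (hwv : Cmod (w * v) <= x * u).
  { rewrite Cmod_mult, Cmod_R, Rabs_pos_eq by auto. now apply Rmult_le_compat_l. }
  apply Rmult_le_compat; [left; apply exp_pos|apply Cmod_ge_0| |].
  - apply exp_le. eapply Rle_trans; [apply Rle_abs|].
    replace (- w * v)%C with (- (w * v))%C by ring.
    eapply Rle_trans; [apply re_le_Cmod|]. rewrite Cmod_opp. nra.
  - eapply Rle_trans; [apply Cmod_sub_le|].
    assert (t1 : Cmod (w * RtoC (u - v)) <= x * (u * u)).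
    { rewrite Cmod_mult, Cmod_R, Rabs_pos_eq by lra. apply Rmult_le_compat_l; lra. }
    assert (t2 : Cmod (cexp (w * v) - 1 - w * v) <= 4 * (x * x) * exp x * (u * u)).
    { eapply Rle_trans; [apply cexp_m1_z_le|].
      assert (p := Cmod_ge_0 (w * v)).
      replace (4 * (x * x) * exp x * (u * u)) with (4 * ((x * u) * (x * u)) * exp x) by ring.
      apply Rmult_le_compat; [nra|left; apply exp_pos|nra|]. apply exp_le. nra. }
    lra.
Qed.

(** A deliberately crude majorant of order two: it absorbs every factor exp(c |w|) met below with a
    small c, and in vertical strips it is still beaten by a Gaussian weight with constant 20. *)
Definition growth (w : C) : R := exp (10 * (1 + Cmod w * Cmod w)).

Lemma le_exp x : x <= exp x.
Proof. assert (h := exp_ineq1_le x). lra. Qed.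

(** The product of the ratios starts from the value [w] at n = 1, and the exponents from [rho_bound]
    telescope. *)
Lemma gam_bound n w : (1 <= n)%nat ->
  Cmod (gam n w) <= Cmod w * exp ((Cmod w + Cmod w * Cmod w) * (2 - 2 * / INR n)).
Proof.
  set (x := Cmod w). assert (hx : 0 <= x) by apply Cmod_ge_0.
  intros hn. induction n as [|n IH]; [lia|]. destruct (Nat.eq_dec n 0) as [->|hn0].
  - unfold gam. simpl bincoef. change (INR 1) with 1. rewrite cpowR_1_l. simpl INR.
    replace (1 * ((w + 0) / 1) * 1)%C with w.
    + replace (2 - 2 * / 1) with 0 by field. rewrite Rmult_0_r, exp_0. unfold x; lra.
    + field; apply RtoC_neq_0; lra.
  - assert (hn1 : (1 <= n)%nat) by lia. specialize (IH hn1). rewrite gam_S, Cmod_mult by auto.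
    eapply Rle_trans; [apply Rmult_le_compat; [apply Cmod_ge_0|apply Cmod_ge_0|exact IH|now apply rho_bound]|].
    fold x. rewrite Rmult_assoc, <- exp_plus. apply Rmult_le_compat_l; auto. apply exp_le.
    rewrite <- Rmult_plus_distr_l. apply Rmult_le_compat_l; [nra|].
    rewrite S_INR. assert (hi : 1 <= INR n) by (apply INR_ge1; lia).
    assert (h := inv_sq_telescope (INR n) hi). lra.
Qed.

Lemma gam_growth n w : (1 <= n)%nat -> Cmod (gam n w) <= growth w.
Proof.
  intros hn. eapply Rle_trans; [now apply gam_bound|]. unfold growth.
  set (x := Cmod w). assert (hx : 0 <= x) by apply Cmod_ge_0.
  assert (hi : 0 < / INR n) by (apply inv_INR_pos; lia).
  eapply Rle_trans; [apply Rmult_le_compat_r; [left; apply exp_pos|apply le_exp]|].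
  rewrite <- exp_plus. apply exp_le.
  assert ((x + x * x) * (2 - 2 * / INR n) <= (x + x * x) * 2) by (apply Rmult_le_compat_l; nra). nra.
Qed.

Lemma gam_step n w : (1 <= n)%nat ->
  Cmod (gam (S n) w - gam n w) <= growth w * (/ INR n * / INR n).
Proof.
  intros hn. rewrite gam_S by auto.
  replace (gam n w * rho n w - gam n w)%C with (gam n w * (rho n w - 1))%C by ring.
  rewrite Cmod_mult.
  assert (b1 := gam_bound n w hn). assert (b2 := rho_m1_bound n w hn).
  set (x := Cmod w) in *. assert (hx : 0 <= x) by apply Cmod_ge_0.
  assert (hi : 0 < / INR n) by (apply inv_INR_pos; lia).
  eapply Rle_trans; [apply Rmult_le_compat; [apply Cmod_ge_0|apply Cmod_ge_0|exact b1|exact b2]|].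
  rewrite <- Rmult_assoc. apply Rmult_le_compat_r; [nra|].
  assert (hex : x <= exp x) by apply le_exp.
  assert (he1 : 1 <= exp x) by (rewrite <- exp_0; apply exp_le; auto).
  assert (h1 : x * exp ((x + x * x) * (2 - 2 * / INR n)) <= exp (3 * x + 2 * (x * x))).
  { eapply Rle_trans; [apply Rmult_le_compat_r; [left; apply exp_pos|exact hex]|].
    rewrite <- exp_plus. apply exp_le.
    assert ((x + x * x) * (2 - 2 * / INR n) <= (x + x * x) * 2) by (apply Rmult_le_compat_l; nra). nra. }
  assert (h2 : exp x * (x + 4 * (x * x) * exp x) <= 5 * exp (4 * x)).
  { replace (exp (4 * x)) with (exp x * (exp x * exp x * exp x)) by (rewrite <- !exp_plus; f_equal; ring).
    assert (x <= exp x * exp x * exp x) by nra.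
    assert (x * x <= exp x * exp x) by nra.
    assert (x * x * exp x <= exp x * exp x * exp x) by nra. nra. }
  assert (h3 : 5 <= exp 4) by (assert (h := exp_ineq1_le 4); lra).
  eapply Rle_trans; [apply Rmult_le_compat; [| |exact h1|exact h2]|].
  - apply Rmult_le_pos; [auto|left; apply exp_pos].
  - apply Rmult_le_pos; [left; apply exp_pos|]. nra.
  - eapply Rle_trans; [apply Rmult_le_compat_l; [left; apply exp_pos|apply Rmult_le_compat_r; [left; apply exp_pos|exact h3]]|].
    rewrite <- !exp_plus. unfold growth. fold x. apply exp_le. nra.
Qed.

Lemma growth_pos w : 0 < growth w.
Proof. apply exp_pos. Qed.

Lemma telescope_bound (u : nat -> C) M n m : 0 <= M -> (1 <= n)%nat -> (n <= m)%nat ->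
  (forall j, (n <= j)%nat -> Cmod (u (S j) - u j) <= M * (/ INR j * / INR j)) ->
  Cmod (u m - u n) <= M * (2 * / INR n - 2 * / INR m).
Proof.
  intros hM hn hm h. induction m as [|m IH]; [lia|].
  destruct (Nat.eq_dec n (S m)) as [->|hne].
  - replace (u (S m) - u (S m))%C with (RtoC 0) by ring. rewrite Cmod_0. lra.
  - specialize (IH ltac:(lia)). specialize (h m ltac:(lia)).
    eapply Rle_trans; [apply (Cmod_sub_tri _ (u m))|].
    assert (hi : 1 <= INR m) by (apply INR_ge1; lia).
    assert (ht := inv_sq_telescope (INR m) hi). rewrite S_INR. nra.
Qed.

Lemma gam_dist n m w : (1 <= n)%nat -> (n <= m)%nat ->
  Cmod (gam m w - gam n w) <= 2 * growth w / INR n.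
Proof.
  intros hn hm. eapply Rle_trans.
  - apply (telescope_bound (fun n => gam n w) (growth w)); auto.
    + left; apply growth_pos.
    + intros; apply gam_step; lia.
  - assert (0 < / INR m) by (apply inv_INR_pos; lia).
    assert (h := growth_pos w). unfold Rdiv. nra.
Qed.

Lemma gam_cv w : exists l, clim (fun n => gam n w) l.
Proof.
  apply clim_cauchy. intros e he. destruct (rate_archi (4 * growth w) e he) as [n0 [h1 h0]].
  exists n0. intros n m hn hm. specialize (h0 n0 (le_n _)).
  assert (a1 := gam_dist n0 n w h1 hn). assert (a2 := gam_dist n0 m w h1 hm).
  assert (a3 := Cmod_sub_tri (gam n w) (gam n0 w) (gam m w)).
  rewrite (Cmod_sub_sym (gam n0 w) (gam m w)) in a3.
  replace (4 * growth w / INR n0) with (2 * growth w / INR n0 + 2 * growth w / INR n0) in h0; [lra|].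
  field. apply not_0_INR. lia.
Qed.

(** The entire function 1/Gamma, obtained by choice from convergence at every point; it has no poles
    to keep away from. *)
Definition rgam (w : C) : C := proj1_sig (constructive_indefinite_description _ (gam_cv w)).

Lemma rgam_lim w : clim (fun n => gam n w) (rgam w).
Proof. exact (proj2_sig (constructive_indefinite_description _ (gam_cv w))). Qed.

Lemma rgam_dist n w : (1 <= n)%nat -> Cmod (gam n w - rgam w) <= 2 * growth w / INR n.
Proof.
  intros hn. rewrite Cmod_sub_sym. apply (clim_le_dist (fun n => gam n w)); [apply rgam_lim|].
  exists n. intros m hm. now apply gam_dist.
Qed.

Lemma holo_bincoef n z : holo (fun w => bincoef w n) z.
Proof.
  induction n; [apply (holo_const (RtoC 1))|].
  apply (holo_mult (fun w => bincoef w n)); auto.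
  apply (holo_mult (fun w => w + RtoC (INR n))%C (fun _ => / RtoC (INR (S n)))%C); [|apply holo_const].
  apply holo_plus; [apply holo_id|apply holo_const].
Qed.

Lemma holo_rgam z : holo rgam z.
Proof.
  apply (holo_unif_lim (fun n w => gam (S n) w)).
  - intros n w. unfold gam. apply holo_mult; [apply holo_bincoef|].
    apply (holo_comp (cpowR _)); [|apply holo_cpowR]. apply holo_minus; [apply holo_const|apply holo_id].
  - intros S0 e he. destruct (rate_archi (2 * exp (10 * (1 + S0 * S0))) e he) as [n0 [h1 h0]].
    exists n0. intros n hn w hw. eapply Rle_trans; [apply rgam_dist; lia|].
    eapply Rle_trans; [|left; apply (h0 (S n)); lia].
    apply Rmult_le_compat_r; [apply Rlt_le, inv_INR_pos; lia|].
    apply Rmult_le_compat_l; [lra|]. apply exp_le. assert (h := Cmod_ge_0 w). nra.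
Qed.

Lemma bincoef_neq_0 w n : (forall k : nat, w <> (- RtoC (INR k))%C) -> bincoef w n <> 0.
Proof.
  intros h. induction n; [apply RtoC_neq_0; lra|].
  change (bincoef w (S n)) with (bincoef w n * ((w + RtoC (INR n)) / RtoC (INR (S n))))%C.
  apply Cmult_neq_0; auto. intros h0. apply (h n).
  assert (hs := RtoC_INR_S n).
  assert (h1 : (w + RtoC (INR n) = 0)%C).
  { transitivity ((w + RtoC (INR n)) / RtoC (INR (S n)) * RtoC (INR (S n)))%C; [field; auto|].
    rewrite h0. ring. }
  transitivity (w + RtoC (INR n) - RtoC (INR n))%C; [ring|rewrite h1; ring].
Qed.

(** Non-zero terms may still tend to 0. From the index where 4 K < n on, the deviations K/n^2 of the
    ratios from 1 have a total below 1/2, so the modulus keeps at least half of its value at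
    [n0]. *)
Lemma rgam_neq_0 w : (forall k : nat, w <> (- RtoC (INR k))%C) -> rgam w <> 0.
Proof.
  intros hw.
  set (K := exp (Cmod w) * (Cmod w + 4 * (Cmod w * Cmod w) * exp (Cmod w))).
  assert (hK : 0 <= K).
  { assert (h1 := Cmod_ge_0 w). assert (h2 := exp_pos (Cmod w)). unfold K. apply Rmult_le_pos; [lra|]. nra. }
  destruct (rate_archi (4 * K) 1 ltac:(lra)) as [n0 [h1 h0]].
  assert (hg : 0 < Cmod (gam n0 w)).
  { apply Cmod_gt_0. unfold gam. apply Cmult_neq_0; [now apply bincoef_neq_0|apply cpowR_neq_0]. }
  assert (hq : forall m, (n0 <= m)%nat -> 4 * K < INR m /\ 1 <= INR m).
  { intros m hm. assert (hi : 1 <= INR m) by (apply INR_ge1; lia).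
    specialize (h0 m hm). apply Rmult_lt_compat_r with (r := INR m) in h0; [|lra].
    unfold Rdiv in h0. rewrite Rmult_assoc, Rinv_l in h0; lra. }
  assert (key : forall m, (n0 <= m)%nat -> Cmod (gam n0 w) * (1 - 2 * K * / INR n0 + 2 * K * / INR m) <= Cmod (gam m w)).
  { intros m hm. induction m as [|m IH]; [lia|]. destruct (Nat.eq_dec n0 (S m)) as [->|hne].
    - right. ring.
    - specialize (IH ltac:(lia)). rewrite gam_S, Cmod_mult by lia.
      assert (hr := rho_m1_bound m w ltac:(lia)). fold K in hr.
      assert (hr2 := Cmod_sub_ge 1 (rho m w)). rewrite (Cmod_sub_sym 1), Cmod_1 in hr2.
      destruct (hq m ltac:(lia)) as [hq1 hq2]. destruct (hq n0 (le_n _)) as [hq3 hq4].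
      assert (hmn : INR n0 <= INR m) by (apply le_INR; lia).
      set (a := / INR m) in *. set (b := / INR n0) in *.
      assert (ha : 0 < a) by (apply Rinv_0_lt_compat; lra).
      assert (hb : 0 < b) by (apply Rinv_0_lt_compat; lra).
      assert (hab : a <= b) by (apply Rinv_le_contravar; lra).
      assert (hKa : 4 * K * a <= 1).
      { apply Rmult_le_reg_r with (INR m); [lra|]. unfold a. rewrite Rmult_assoc, Rinv_l; lra. }
      assert (ha1 : a <= 1) by (unfold a; rewrite <- Rinv_1; apply Rinv_le_contravar; lra).
      assert (hc : a * a <= 2 * a - 2 * / INR (S m)).
      { rewrite S_INR. now apply inv_sq_telescope. }
      set (c := / INR (S m)) in *.
      assert (hlow : 1 - K * (a * a) <= Cmod (rho m w)) by lra.
      assert (hpos : 0 <= 1 - K * (a * a)) by nra.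
      set (Q := 1 - 2 * K * b + 2 * K * a) in *.
      assert (hQ1 : Q <= 1) by (unfold Q; nra).
      apply Rle_trans with (Cmod (gam n0 w) * Q * (1 - K * (a * a))).
      + rewrite (Rmult_assoc (Cmod (gam n0 w)) Q). apply Rmult_le_compat_l; [lra|].
        assert (hh : K * (a * a) <= 2 * K * a - 2 * K * c) by nra.
        assert (h3 : Q * (K * (a * a)) <= K * (a * a)) by (assert (0 <= K * (a * a)) by nra; nra).
        unfold Q in *. lra.
      + apply Rmult_le_compat; auto.
        apply Rmult_le_pos; [lra|]. unfold Q.
        assert (4 * K * b <= 1).
        { apply Rmult_le_reg_r with (INR n0); [lra|]. unfold b. rewrite Rmult_assoc, Rinv_l; lra. }
        nra. }
  intros hz. destruct (rgam_lim w (Cmod (gam n0 w) / 2) ltac:(lra)) as [n1 hn1].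
  specialize (hn1 (Nat.max n0 n1) (Nat.le_max_r _ _)). specialize (key (Nat.max n0 n1) (Nat.le_max_l _ _)).
  rewrite hz in hn1. replace (gam (Nat.max n0 n1) w - 0)%C with (gam (Nat.max n0 n1) w) in hn1 by ring.
  destruct (hq n0 (le_n _)) as [hq3 hq4].
  assert (h4K : 4 * K * / INR n0 <= 1).
  { apply Rmult_le_reg_r with (INR n0); [lra|]. rewrite Rmult_assoc, Rinv_l; lra. }
  destruct (hq (Nat.max n0 n1) (Nat.le_max_l _ _)) as [_ hq5].
  assert (0 < / INR (Nat.max n0 n1)) by (apply Rinv_0_lt_compat; lra).
  assert (0 <= 2 * K * / INR (Nat.max n0 n1)) by nra. nra.
Qed.

Lemma poch_bincoef w n : poch w n = (bincoef w n * RtoC (INR (fact n)) * (w + RtoC (INR n)))%C.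
Proof.
  induction n.
  - simpl. ring.
  - change (poch w (S n)) with (poch w n * (w + RtoC (INR (S n))))%C. rewrite IHn.
    change (bincoef w (S n)) with (bincoef w n * ((w + RtoC (INR n)) / RtoC (INR (S n))))%C.
    rewrite fact_simpl, mult_INR, RtoC_mult. field. apply RtoC_INR_S.
Qed.

(** Gauss's quotient is exactly the inverse of (1 + w/n) times [gam n w], and the first factor tends
    to 1. *)
Lemma Gamma_rgam w : (forall k : nat, w <> (- RtoC (INR k))%C) -> Gamma w = (/ rgam w)%C.
Proof.
  intros hw. unfold Gamma. apply clim_lim_seq.
  assert (hi := clim_cont (fun z => / z)%C _ _ (cont_inv _ _ (cont_id _) (rgam_neq_0 w hw)) (rgam_lim w)).
  assert (h1 : clim (fun n => / (1 + w / RtoC (INR n)))%C (/ 1)%C).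
  { apply (clim_cont (fun z => / z)%C (fun n => 1 + w / RtoC (INR n))%C).
    - apply cont_inv; [apply cont_id|apply RtoC_neq_0; lra].
    - apply clim_of_rate with (Cmod w). intros n hn.
      assert (hnn : 0 < INR n) by (apply lt_0_INR; lia).
      replace (1 + w / INR n - 1)%C with (w / INR n)%C by ring.
      rewrite Cmod_div, Cmod_R, Rabs_pos_eq by (try apply RtoC_neq_0; lra). lra. }
  assert (h := clim_mult _ _ _ _ h1 hi).
  replace (/ 1 * / rgam w)%C with (/ rgam w)%C in h
    by (replace (/ 1)%C with (RtoC 1) by (field; apply RtoC_neq_0; lra); ring).
  eapply clim_ext_ev with (n0 := 1%nat); [|exact h].
  intros n hn. simpl. unfold gauss_seq. rewrite poch_bincoef.
  destruct n as [|n]; [lia|].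
  assert (hS := RtoC_INR_S n).
  assert (hb := bincoef_neq_0 w (S n) hw).
  assert (hc := cpowR_neq_0 (INR (S n)) (1 - w)).
  assert (hf : RtoC (INR (fact (S n))) <> 0) by (apply RtoC_neq_0, INR_fact_neq_0).
  assert (hwn : (w + RtoC (INR (S n)))%C <> 0).
  { intros h0. apply (hw (S n)). transitivity (w + RtoC (INR (S n)) - RtoC (INR (S n)))%C; [ring|rewrite h0; ring]. }
  assert (hp : RtoC (INR (S n)) = (cpowR (INR (S n)) w * cpowR (INR (S n)) (1 - w))%C).
  { rewrite <- cpowR_plus. replace (w + (1 - w))%C with (RtoC 1) by ring. rewrite cpowR_1_r; auto.
    apply lt_0_INR; lia. }
  unfold gam. set (N := RtoC (INR (S n))) in *. set (p := cpowR (INR (S n)) (1 - w)) in *.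
  set (B := bincoef w (S n)) in *.
  replace (cpowR (INR (S n)) w) with (N / p)%C by (rewrite hp; field; auto).
  field. auto.
Qed.

(** * Finite sums *)

Fixpoint csum (f : nat -> C) (n : nat) : C :=
  match n with O => RtoC 0 | S m => (csum f m + f m)%C end.

Lemma csum_ext f g n : (forall k, (k < n)%nat -> f k = g k) -> csum f n = csum g n.
Proof. intros h. induction n; simpl; auto. rewrite IHn, h; auto. Qed.

Lemma csum_plus f g n : csum (fun k => f k + g k)%C n = (csum f n + csum g n)%C.
Proof. induction n; simpl; [ring|rewrite IHn; ring]. Qed.

Lemma csum_scal c f n : csum (fun k => c * f k)%C n = (c * csum f n)%C.
Proof. induction n; simpl; [ring|rewrite IHn; ring]. Qed.

Lemma csum_0 n : csum (fun _ => RtoC 0) n = 0.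
Proof. induction n; simpl; auto. rewrite IHn; ring. Qed.

Lemma csum_const c n : csum (fun _ => c) n = (RtoC (INR n) * c)%C.
Proof. induction n; [simpl; ring|]. rewrite S_INR, RtoC_plus. simpl. rewrite IHn; ring. Qed.

Lemma csum_swap (f : nat -> nat -> C) n m :
  csum (fun i => csum (fun j => f i j) m) n = csum (fun j => csum (fun i => f i j) n) m.
Proof.
  induction n; simpl; [now rewrite csum_0|]. rewrite IHn, <- csum_plus. reflexivity.
Qed.

Lemma csum_swap_pairs (f : nat -> nat -> nat -> nat -> C) n m :
  csum (fun u => csum (fun v => csum (fun i => csum (fun j => f u v i j) m) m) n) n =
  csum (fun i => csum (fun j => csum (fun u => csum (fun v => f u v i j) n) n) m) m.
Proof.
  rewrite (csum_ext _ (fun u => csum (fun i => csum (fun j => csum (fun v => f u v i j) n) m) m)).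
  - rewrite csum_swap. apply csum_ext; intros i _. apply csum_swap.
  - intros u _. rewrite csum_swap. apply csum_ext; intros i _. apply csum_swap.
Qed.

Lemma csum_split f n m : csum f (n + m) = (csum f n + csum (fun k => f (n + k)%nat) m)%C.
Proof.
  induction m; [rewrite Nat.add_0_r; simpl; ring|]. rewrite Nat.add_succ_r; simpl. rewrite IHm; ring.
Qed.

Lemma csum_first f n : csum f (S n) = (f O + csum (fun k => f (S k)) n)%C.
Proof. change (S n) with (1 + n)%nat. rewrite csum_split. simpl. ring. Qed.

Lemma csum_rev f n : csum f n = csum (fun k => f (n - 1 - k)%nat) n.
Proof.
  induction n; auto. rewrite (csum_first (fun k => f (S n - 1 - k)%nat)).
  cbn [csum]. rewrite IHn, Cplus_comm.
  replace (S n - 1 - 0)%nat with n by lia. f_equal. apply csum_ext. intros k hk. f_equal. lia.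
Qed.

Lemma csum_multiples (g : nat -> C) d X : (1 <= d)%nat ->
  csum (fun n => if (n mod d =? 0)%nat then g (n / d)%nat else RtoC 0) (S X) = csum g (S (X / d)).
Proof.
  intros hd. induction X.
  - rewrite Nat.Div0.div_0_l. cbn [csum]. rewrite Nat.Div0.mod_0_l, Nat.Div0.div_0_l. reflexivity.
  - change (csum ?f (S (S X))) with (csum f (S X) + f (S X))%C. rewrite IHX. cbv beta.
    assert (h1 := Nat.div_mod_eq X d). assert (h2 := Nat.div_mod_eq (S X) d).
    assert (h3 := Nat.mod_upper_bound X d ltac:(lia)). assert (h4 := Nat.mod_upper_bound (S X) d ltac:(lia)).
    destruct (Nat.eqb_spec (S X mod d) 0) as [h0|h0].
    + assert (h5 : (S X / d = S (X / d))%nat).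
      { apply Nat.le_antisymm; [apply Nat.lt_succ_r|]; nia. }
      rewrite h5. reflexivity.
    + assert (h5 : (S X / d = X / d)%nat).
      { apply Nat.le_antisymm; [apply Nat.lt_succ_r|]; nia. }
      rewrite h5. ring.
Qed.

Fixpoint rsum (f : nat -> R) (n : nat) : R :=
  match n with O => 0 | S m => rsum f m + f m end.

Lemma csum_bound f g n : (forall k, (k < n)%nat -> Cmod (f k) <= g k) -> Cmod (csum f n) <= rsum g n.
Proof.
  intros h. induction n; simpl; [rewrite Cmod_0; lra|].
  eapply Rle_trans; [apply Cmod_triangle|]. apply Rplus_le_compat; auto.
Qed.

Lemma rsum_scal c f n : rsum (fun k => c * f k) n = c * rsum f n.
Proof. induction n; simpl; [ring|rewrite IHn; ring]. Qed.

Lemma INR_S_ge1 n : 1 <= INR (S n).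
Proof. replace 1 with (INR 1) by reflexivity. apply le_INR. lia. Qed.

Lemma rsum_sq n : rsum (fun k => / INR (S k) * / INR (S k)) n <= 2.
Proof.
  assert (h : forall n, rsum (fun k => / INR (S k) * / INR (S k)) (S n) <= 2 - / INR (S n)).
  { clear n. induction n as [|n IH].
    - simpl. rewrite Rinv_1. lra.
    - change (rsum ?f (S (S n))) with (rsum f (S n) + f (S n)). cbv beta.
      assert (h1 := INR_S_ge1 n). rewrite (S_INR (S n)). set (x := INR (S n)) in *.
      assert (/ (x + 1) * / (x + 1) <= / x - / (x + 1)); [|lra].
      apply Rmult_le_reg_r with (x * (x + 1) * (x + 1)); [nra|].
      replace (/ (x + 1) * / (x + 1) * (x * (x + 1) * (x + 1))) with x by (field; lra).
      replace ((/ x - / (x + 1)) * (x * (x + 1) * (x + 1))) with (x + 1) by (field; lra). lra. }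
  destruct n; [simpl; lra|]. eapply Rle_trans; [apply h|].
  assert (h1 := INR_S_ge1 n). assert (0 < / INR (S n)) by (apply Rinv_0_lt_compat; lra). lra.
Qed.

Lemma csum_sq_bound f M n : 0 <= M -> (forall k, (k < n)%nat -> Cmod (f k) <= M * (/ INR (S k) * / INR (S k))) ->
  Cmod (csum f n) <= 2 * M.
Proof.
  intros hM h. eapply Rle_trans; [apply csum_bound, h|]. rewrite rsum_scal.
  assert (h1 := rsum_sq n). nra.
Qed.

Lemma csum_cv f M : 0 <= M -> (forall k, Cmod (f k) <= M * (/ INR (S k) * / INR (S k))) ->
  exists l, clim (csum f) l.
Proof.
  intros hM h. apply clim_cauchy. intros e he.
  destruct (rate_archi (4 * M) e he) as [n0 [h1 h0]].
  assert (key : forall n, (n0 <= n)%nat -> Cmod (csum f n - csum f n0) <= 2 * M / INR n0).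
  { intros n hn. eapply Rle_trans.
    - apply (telescope_bound (csum f) M); auto. intros j hj. simpl csum.
      replace (csum f j + f j - csum f j)%C with (f j) by ring. eapply Rle_trans; [apply h|].
      apply Rmult_le_compat_l; auto.
      assert (hj1 : 1 <= INR j) by (apply INR_ge1; lia).
      assert (/ INR (S j) <= / INR j) by (apply Rinv_le_contravar; [lra|rewrite S_INR; lra]).
      assert (0 < / INR (S j)) by (apply Rinv_0_lt_compat; rewrite S_INR; lra). nra.
    - assert (0 < / INR n) by (apply inv_INR_pos; lia). unfold Rdiv. nra. }
  exists n0. intros n m hn hm. specialize (h0 n0 (le_n _)).
  assert (a1 := key n hn). assert (a2 := key m hm).
  assert (a3 := Cmod_sub_tri (csum f n) (csum f n0) (csum f m)).
  rewrite (Cmod_sub_sym (csum f n0) (csum f m)) in a3.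
  replace (4 * M / INR n0) with (2 * M / INR n0 + 2 * M / INR n0) in h0; [lra|].
  field. apply not_0_INR. lia.
Qed.

Lemma csum_clim (u : nat -> nat -> C) (l : nat -> C) K : (forall k, (k < K)%nat -> clim (fun n => u n k) (l k)) ->
  clim (fun n => csum (u n) K) (csum l K).
Proof.
  intros h. induction K; simpl; [apply clim_const|]. apply clim_plus; auto.
Qed.

Lemma csum_holo (f : nat -> C -> C) K z : (forall k, (k < K)%nat -> holo (f k) z) ->
  holo (fun w => csum (fun k => f k w) K) z.
Proof.
  intros h. induction K; simpl; [apply holo_const|]. apply holo_plus; auto.
Qed.

(** * The binomial series on the unit circle *)

Definition rderiv (f : R -> C) (t : R) (l : C) : Prop :=
  is_derive (fun t => Re (f t)) t (Re l) /\ is_derive (fun t => Im (f t)) t (Im l).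

Lemma rderiv_const c t : rderiv (fun _ => c) t 0.
Proof. split; apply (is_derive_const (V := R_NormedModule)). Qed.

Lemma rderiv_plus f g t l m : rderiv f t l -> rderiv g t m -> rderiv (fun t => f t + g t)%C t (l + m)%C.
Proof.
  intros [h1 h2] [h3 h4]. split.
  - apply (is_derive_plus (V := R_NormedModule) (fun t => Re (f t)) (fun t => Re (g t))); auto.
  - apply (is_derive_plus (V := R_NormedModule) (fun t => Im (f t)) (fun t => Im (g t))); auto.
Qed.

Lemma rderiv_ext f t l m : rderiv f t l -> l = m -> rderiv f t m.
Proof. now intros h <-. Qed.

Lemma rderiv_mult f g t l m : rderiv f t l -> rderiv g t m -> rderiv (fun t => f t * g t)%C t (l * g t + f t * m)%C.
Proof.
  intros [h1 h2] [h3 h4]. split.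
  - evar_last.
    + apply (is_derive_minus (V := R_NormedModule) (fun t => Re (f t) * Re (g t)) (fun t => Im (f t) * Im (g t)));
      apply Derive.is_derive_mult; eassumption.
    + unfold minus, plus, opp; simpl. unfold Re, Im. ring.
  - evar_last.
    + apply (is_derive_plus (V := R_NormedModule) (fun t => Re (f t) * Im (g t)) (fun t => Im (f t) * Re (g t)));
      apply Derive.is_derive_mult; eassumption.
    + unfold minus, plus, opp; simpl. unfold Re, Im. ring.
Qed.

Lemma rderiv_pow n t : rderiv (fun t => RtoC (t ^ n)) t (RtoC (INR n * t ^ (pred n))).
Proof.
  split.
  - change (is_derive (fun t => t ^ n) t (INR n * t ^ pred n)). auto_derive; auto. ring.
  - change (is_derive (fun _ : R => 0) t 0). apply (is_derive_const (V := R_NormedModule) 0).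
Qed.

Lemma rderiv_cexp f t l : rderiv f t l -> rderiv (fun t => cexp (f t)) t (l * cexp (f t))%C.
Proof.
  intros [h1 h2].
  set (u := fun t => Re (f t)) in *. set (v := fun t => Im (f t)) in *.
  assert (he : is_derive (fun t => exp (u t)) t (Re l * exp (u t))).
  { apply (is_derive_comp (V := R_NormedModule) exp u); auto. auto_derive; auto; ring. }
  assert (hc : is_derive (fun t => cos (v t)) t (Im l * - sin (v t))).
  { apply (is_derive_comp (V := R_NormedModule) cos v); auto. auto_derive; auto; ring. }
  assert (hs : is_derive (fun t => sin (v t)) t (Im l * cos (v t))).
  { apply (is_derive_comp (V := R_NormedModule) sin v); auto. auto_derive; auto; ring. }
  split.
  - evar_last; [apply (Derive.is_derive_mult (fun t => exp (u t)) (fun t => cos (v t))); eassumption|].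
    unfold u, v. simpl. unfold Re, Im. ring.
  - evar_last; [apply (Derive.is_derive_mult (fun t => exp (u t)) (fun t => sin (v t))); eassumption|].
    unfold u, v. simpl. unfold Re, Im. ring.
Qed.

Lemma rderiv_mean_value f df D : (forall t, 0 <= t <= 1 -> rderiv f t (df t) /\ Cmod (df t) <= D) ->
  Cmod (f 1 - f 0) <= 2 * D.
Proof.
  intros h.
  assert (key : forall g dg : R -> R, (forall t, 0 <= t <= 1 -> is_derive g t (dg t) /\ Rabs (dg t) <= D) ->
    Rabs (g 1 - g 0) <= D).
  { intros g dg hg.
    (* [bounded_variation] asks for the derivative on an interval symmetric about its base point.
       Starting at 1/2 keeps that interval inside [0,1]; the two halves add up to D, and the two
       components to 2 D. *)
    assert (hh : forall t, Rabs (t - / 2) <= / 2 -> is_derive g t (dg t) /\ Rabs (dg t) <= D).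
    { intros t ht. apply hg. apply Rabs_le_between in ht. lra. }
    assert (r1 : Rabs (1 - / 2) = / 2) by (rewrite Rabs_pos_eq; lra).
    assert (r0 : Rabs (0 - / 2) = / 2) by (rewrite Rabs_left; lra).
    assert (b1 := bounded_variation g dg D (/ 2) 1). assert (b0 := bounded_variation g dg D (/ 2) 0).
    rewrite r1 in b1. rewrite r0 in b0. specialize (b1 hh). specialize (b0 hh).
    apply Rabs_le_between in b1. apply Rabs_le_between in b0. apply Rabs_le. lra. }
  eapply Rle_trans; [apply Cmod_le_abs|].
  assert (k1 := key (fun t => Re (f t)) (fun t => Re (df t))).
  assert (k2 := key (fun t => Im (f t)) (fun t => Im (df t))).
  change (Re (f 1 - f 0)) with (Re (f 1) - Re (f 0)). change (Im (f 1 - f 0)) with (Im (f 1) - Im (f 0)).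
  cbv beta in *.
  assert (Rabs (Re (f 1) - Re (f 0)) <= D).
  { apply k1. intros t ht. destruct (h t ht) as [[h1 h2] h3]. split; auto.
    eapply Rle_trans; [apply re_le_Cmod|auto]. }
  assert (Rabs (Im (f 1) - Im (f 0)) <= D).
  { apply k2. intros t ht. destruct (h t ht) as [[h1 h2] h3]. split; auto.
    eapply Rle_trans; [apply im_le_Cmod|auto]. }
  lra.
Qed.

Definition binsum (w z : C) (X : nat) (t : R) : C :=
  csum (fun n => bincoef w n * z ^ n * RtoC (t ^ n))%C (S X).

Lemma bincoef_S w n : (RtoC (INR (S n)) * bincoef w (S n) = (w + RtoC (INR n)) * bincoef w n)%C.
Proof.
  change (bincoef w (S n)) with (bincoef w n * ((w + RtoC (INR n)) / RtoC (INR (S n))))%C.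
  field. apply RtoC_INR_S.
Qed.

(* Truncating the power series of [(1 - t z)^(-w)] violates its differential equation by a single
   monomial; no termwise differentiation or Abel summation is needed. *)
Lemma binsum_ode w z X t : exists d, rderiv (binsum w z X) t d /\
  ((1 - RtoC t * z) * d - w * z * binsum w z X t =
   - ((w + RtoC (INR X)) * bincoef w X * z ^ (S X) * RtoC (t ^ X)))%C.
Proof.
  induction X as [|X [d [hd he]]].
  - exists (RtoC 0). split.
    + unfold binsum. simpl. apply rderiv_const.
    + unfold binsum. simpl. ring.
  - exists (d + bincoef w (S X) * z ^ (S X) * RtoC (INR (S X) * t ^ X))%C. split.
    + unfold binsum in *. change (csum ?f (S (S X))) with (csum f (S X) + f (S X))%C.
      apply (rderiv_plus (fun t => csum (fun n => bincoef w n * z ^ n * RtoC (t ^ n))%C (S X))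
        (fun t => bincoef w (S X) * z ^ (S X) * RtoC (t ^ (S X)))%C); auto.
      eapply rderiv_ext; [apply rderiv_mult; [apply rderiv_const|apply rderiv_pow]|].
      change (Init.Nat.pred (S X)) with X. cbv beta. ring.
    + assert (e1 : binsum w z (S X) t = (binsum w z X t + bincoef w (S X) * z ^ (S X) * RtoC (t ^ (S X)))%C)
        by reflexivity.
      assert (hb := bincoef_S w X). rewrite e1.
      change (t ^ S X) with (t * t ^ X). rewrite !RtoC_mult.
      transitivity (((1 - t * z) * d - w * z * binsum w z X t) +
        ((1 - t * z) * z ^ S X * RtoC (t ^ X) * (RtoC (INR (S X)) * bincoef w (S X)) -
        w * z * bincoef w (S X) * z ^ S X * (t * RtoC (t ^ X))))%C; [ring|].
      rewrite he.
      transitivity ((z ^ S X * RtoC (t ^ X) * (RtoC (INR (S X)) * bincoef w (S X)) -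
        (w + RtoC (INR X)) * bincoef w X * z ^ S X * RtoC (t ^ X)) -
        (w + RtoC (INR (S X))) * bincoef w (S X) * z ^ S (S X) * (t * RtoC (t ^ X)))%C; [|rewrite hb; ring].
      change (z ^ S (S X))%C with (z * z ^ S X)%C. ring.
Qed.

Lemma bincoef_gam w n : (1 <= n)%nat -> bincoef w n = (gam n w * cpowR (INR n) (w - 1))%C.
Proof.
  intros hn. unfold gam. rewrite <- Cmult_assoc, <- cpowR_plus.
  replace (1 - w + (w - 1))%C with (RtoC 0) by ring. unfold cpowR. rewrite Cmult_0_r, cexp_0. ring.
Qed.

Lemma INR_pow_le n s k : (1 <= n)%nat -> s <= - INR k -> exp (ln (INR n) * s) <= (/ INR n) ^ k.
Proof.
  intros hn hs. assert (hi : 1 <= INR n) by (apply INR_ge1; lia).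
  assert (hl : 0 <= ln (INR n)) by (rewrite <- ln_1; destruct hi as [hi| <-]; [left; apply ln_increasing; lra|lra]).
  rewrite pow_inv, <- (exp_ln (INR n ^ k)) by (apply pow_lt; lra).
  rewrite <- exp_Ropp. apply exp_le. rewrite ln_pow by lra. nra.
Qed.

(** Coefficients of size n^(Re w - 1) are summable with room to spare: even after multiplication by
    X, the last coefficient of a truncation tends to 0. *)
Lemma bincoef_bound w n : (1 <= n)%nat -> Re w <= -1 ->
  Cmod (bincoef w n) <= growth w * (/ INR n * / INR n).
Proof.
  intros hn hw. rewrite bincoef_gam, Cmod_mult, Cmod_cpowR by auto.
  apply Rmult_le_compat; [apply Cmod_ge_0|left; apply exp_pos|now apply gam_growth|].
  replace (/ INR n * / INR n) with ((/ INR n) ^ 2) by ring. apply INR_pow_le; auto.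
  destruct w; simpl in *. lra.
Qed.

(* The principal logarithm of [1 - e th], for [0 < th < 1]. *)
Definition clog1 (th : R) : C := (ln (2 * sin (PI * th)), PI * (th - / 2)).

(** Along the radius from 0 to z, the truncated series times (1 - t z)^w starts at 1 and has a
    derivative of size O(1/X). The value at t = 1 follows directly on the unit circle, without a
    limit from inside the disc. *)
Lemma binsum_unit w th : 0 < th < 1 -> Re w <= -1 ->
  clim (fun X => csum (fun n => bincoef w n * e (RtoC (INR n * th)))%C (S X)) (cexp (- w * clog1 th)).
Proof.
  intros hth hw. set (z := e (RtoC th)).
  set (c := cos (2 * PI * th)). set (s := sin (2 * PI * th)).
  assert (hcs : c * c + s * s = 1).
  { assert (h := sin2_cos2 (2 * PI * th)). unfold Rsqr in h. fold c s in h. lra. }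
  assert (hz : z = (c, s)) by apply e_R.
  assert (hPI := PI_RGT_0).
  assert (hsin : 0 < sin (PI * th)) by (apply sin_gt_0; nra).
  assert (hc : c = 1 - 2 * (sin (PI * th) * sin (PI * th))).
  { unfold c. replace (2 * PI * th) with (2 * (PI * th)) by ring. rewrite cos_2a_sin. ring. }
  assert (hs : s = 2 * sin (PI * th) * cos (PI * th)).
  { unfold s. replace (2 * PI * th) with (2 * (PI * th)) by ring. apply sin_2a. }
  assert (hc1 : c < 1) by nra.
  assert (hcb : -1 <= c) by apply COS_bound.
  (* A positive lower bound for the real part 1 - t c of 1 - t z along the whole radius. *)
  set (mm := Rmin 1 (1 - c)). assert (hmm : 0 < mm) by (apply Rmin_pos; lra).
  assert (hre : forall t, 0 <= t <= 1 -> mm <= 1 - t * c).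
  { intros t ht. destruct (Rle_lt_dec c 0) as [h|h].
    - apply Rle_trans with 1; [apply Rmin_l|nra].
    - apply Rle_trans with (1 - c); [apply Rmin_r|nra]. }
  set (q := fun t => (1 - t * c) * (1 - t * c) + t * s * (t * s)).
  assert (hq : forall t, 0 <= t <= 1 -> mm * mm <= q t <= 4).
  { intros t ht. specialize (hre t ht). unfold q. split; [nra|].
    replace ((1 - t * c) * (1 - t * c) + t * s * (t * s)) with (1 - 2 * t * c + t * t * (c * c + s * s)) by ring.
    rewrite hcs. nra. }
  (* The logarithm of 1 - t z. Its argument is a single arctangent because the real part stays
     positive; at t = 1 the half-angle formulas turn it into [clog1 th]. *)
  set (L := fun t => ((/ 2) * ln (q t), - atan (t * s / (1 - t * c))) : C).
  assert (hL : forall t, 0 <= t <= 1 -> rderiv L t (- z / (1 - RtoC t * z))%C).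
  { intros t ht. assert (h1 := hre t ht). destruct (hq t ht) as [h2 _].
    assert (hqp : 0 < q t) by nra.
    set (P := ((t - c) / q t, - s / q t) : C).
    assert (e1 : (- z / (1 - RtoC t * z))%C = P).
    { assert (hd : (1 - RtoC t * z)%C <> 0).
      { intros h. apply (f_equal fst) in h. rewrite hz in h. simpl in h. lra. }
      assert (e2 : (- z)%C = (P * (1 - RtoC t * z))%C).
      { rewrite hz. unfold P, q in *. apply Ceq; simpl; field_simplify_eq; try lra;
         replace (s ^ 2) with (1 - c ^ 2) by lra; try ring.
        replace (s ^ 3) with (s * (1 - c ^ 2)) by (replace (s ^ 3) with (s * (s * s)) by ring;
          replace (s * s) with (1 - c * c) by lra; ring). ring. }
      rewrite e2. field. auto. }
    rewrite e1. unfold P. split; simpl.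
    - unfold q in *. auto_derive; [auto|].
      assert (e3 : t - c = - c * (1 - t * c) + t * s * s).
      { replace (t * s * s) with (t * (s * s)) by ring. replace (s * s) with (1 - c * c) by lra. ring. }
      rewrite e3. field. lra.
    - unfold q in *. auto_derive; [lra|]. field. lra. }
  assert (hL0 : L 0 = 0).
  { unfold L, q. replace ((1 - 0 * c) * (1 - 0 * c) + 0 * s * (0 * s)) with 1 by ring.
    replace (0 * s / (1 - 0 * c)) with 0 by field. rewrite ln_1, atan_0. apply Ceq; simpl; ring. }
  assert (hL1 : L 1 = clog1 th).
  { unfold L, q, clog1. apply Ceq; simpl.
    - replace ((1 - 1 * c) * (1 - 1 * c) + 1 * s * (1 * s)) with ((2 * sin (PI * th)) * (2 * sin (PI * th))).
      + rewrite ln_mult by lra. field.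
      + replace ((1 - 1 * c) * (1 - 1 * c) + 1 * s * (1 * s)) with (1 - 2 * c + (c * c + s * s)) by ring.
        rewrite hcs, hc. ring.
    - replace (1 * s / (1 - 1 * c)) with (tan (PI / 2 - PI * th)).
      + assert (hp : 0 < PI * th < PI) by (split; nra). rewrite atan_tan by lra. field.
      + unfold tan. rewrite sin_shift, cos_shift. rewrite hs, hc. field. lra. }
  set (K := exp (Cmod w * (Rabs (ln (mm * mm)) + 5)) / mm).
  assert (hK0 : 0 < K) by (apply Rdiv_lt_0_compat; [apply exp_pos|auto]).
  assert (hK : forall t, 0 <= t <= 1 -> Cmod (cexp (w * L t) / (1 - RtoC t * z)) <= K).
  { intros t ht. assert (h1 := hre t ht). destruct (hq t ht) as [h2 h3].
    assert (hd : mm <= Cmod (1 - RtoC t * z)).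
    { eapply Rle_trans; [exact h1|]. eapply Rle_trans; [|apply re_le_Cmod].
      eapply Rle_trans; [|apply Rle_abs]. rewrite hz. simpl. lra. }
    rewrite Cmod_div by (apply Cmod_gt_0; lra). rewrite Cmod_cexp.
    apply Rmult_le_compat; [left; apply exp_pos|left; apply Rinv_0_lt_compat; lra| |apply Rinv_le_contravar; lra].
    apply exp_le. eapply Rle_trans; [apply Rle_abs|]. eapply Rle_trans; [apply re_le_Cmod|].
    rewrite Cmod_mult. apply Rmult_le_compat_l; [apply Cmod_ge_0|].
    eapply Rle_trans; [apply Cmod_le_abs|]. simpl.
    assert (hmm2 : 0 < mm * mm) by nra.
    assert (b1 : ln (mm * mm) <= ln (q t)) by (destruct h2 as [h2|h2]; [left; apply ln_increasing; lra|rewrite h2; lra]).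
    assert (b2 : ln (q t) <= 3).
    { assert (h := exp_ineq1_le (ln (q t))). rewrite exp_ln in h; lra. }
    assert (b3 : Rabs (/ 2 * ln (q t)) <= Rabs (ln (mm * mm)) + 3).
    { assert (h4 := Rle_abs (- ln (mm * mm))). assert (h5 := Rabs_pos (ln (mm * mm))). rewrite Rabs_Ropp in h4.
      apply Rabs_le. lra. }
    assert (b4 : Rabs (- atan (t * s / (1 - t * c))) <= 2).
    { rewrite Rabs_Ropp. assert (h := atan_bound (t * s / (1 - t * c))). assert (h4 := PI_4).
      apply Rabs_le. lra. }
    lra. }
  assert (hzz : forall n, (z ^ n)%C = e (RtoC (INR n * th))).
  { intros n. unfold z, e. rewrite cexp_pow. f_equal. rewrite (RtoC_mult (INR n)). ring. }
  assert (hmz : forall n, Cmod (z ^ n) = 1).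
  { intros n. rewrite hzz. apply Cmod_e_R. }
  set (B := 2 * (K * (growth w * (Cmod w + 1)))).
  assert (main : clim (fun X => binsum w z X 1 * cexp (w * L 1))%C 1).
  { apply clim_of_rate with B. intros X hX.
    set (phi := fun t => (binsum w z X t * cexp (w * L t))%C).
    assert (hphi0 : phi 0 = 1).
    { unfold phi. rewrite hL0, Cmult_0_r, cexp_0, Cmult_1_r. unfold binsum. rewrite csum_first.
      rewrite (csum_ext _ (fun _ => RtoC 0)); [rewrite csum_0, pow_O; change (bincoef w 0) with (RtoC 1); change (z ^ 0)%C with (RtoC 1); ring|].
      intros k _. rewrite pow_i by lia. ring. }
    change (Cmod (phi 1 - 1) <= B / INR X). rewrite <- hphi0.
    assert (hXp : 1 <= INR X) by (apply INR_ge1; lia).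
    (* The main terms of the derivative cancel by the differential equation. The surviving monomial
       has size |w + X| times O(X^(-2)). *)
    set (dphi := fun t => (cexp (w * L t) / (1 - RtoC t * z) *
        - ((w + RtoC (INR X)) * bincoef w X * z ^ (S X) * RtoC (t ^ X)))%C).
    replace (B / INR X) with (2 * (K * (growth w * (Cmod w + 1)) / INR X)) by (unfold B; field; lra).
    apply (rderiv_mean_value phi dphi). intros t ht. split.
    - destruct (binsum_ode w z X t) as [d [hd he]].
      assert (h1t := hre t ht).
      assert (hd0 : (1 - RtoC t * z)%C <> 0).
      { intros h. apply (f_equal fst) in h. rewrite hz in h. simpl in h. lra. }
      unfold phi. eapply rderiv_ext.
      + apply rderiv_mult; [exact hd|]. apply rderiv_cexp. apply rderiv_mult; [apply rderiv_const|apply hL, ht].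
      + cbv beta. unfold dphi. rewrite <- he. field. auto.
    - unfold dphi. rewrite Cmod_mult. unfold Rdiv. rewrite Rmult_assoc.
      apply Rmult_le_compat; [apply Cmod_ge_0|apply Cmod_ge_0|now apply hK|].
      rewrite Cmod_opp, !Cmod_mult, hmz, Cmod_R.
      assert (ht1 : Rabs (t ^ X) <= 1).
      { rewrite <- RPow_abs, Rabs_pos_eq by lra. rewrite <- (pow1 X). apply pow_incr. lra. }
      assert (hb := bincoef_bound w X hX hw).
      assert (hwX : Cmod (w + RtoC (INR X)) <= (Cmod w + 1) * INR X).
      { eapply Rle_trans; [apply Cmod_triangle|]. rewrite Cmod_R, Rabs_pos_eq by lra.
        assert (h := Cmod_ge_0 w). nra. }
      assert (hg := growth_pos w). assert (hX0 : 0 < / INR X) by (apply Rinv_0_lt_compat; lra).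
      apply Rle_trans with ((Cmod w + 1) * INR X * (growth w * (/ INR X * / INR X)) * 1 * 1).
      + apply Rmult_le_compat; [|apply Rabs_pos| |auto].
        * rewrite Rmult_1_r. apply Rmult_le_pos; apply Cmod_ge_0.
        * apply Rmult_le_compat_r; [lra|]. apply Rmult_le_compat; auto; apply Cmod_ge_0.
      + right. field. lra. }
  assert (h := clim_mult _ _ _ _ main (clim_const (cexp (- w * clog1 th)))).
  rewrite Cmult_1_l in h. eapply clim_ext_ev with (n0 := O); [|exact h].
  intros X _. cbv beta. rewrite hL1.
  assert (ho := cexp_opp_r (w * clog1 th)). replace (- (w * clog1 th))%C with (- w * clog1 th)%C in ho by ring.
  rewrite <- Cmult_assoc, ho, Cmult_1_r. unfold binsum. apply csum_ext. intros n _.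
  rewrite hzz, pow1. ring.
Qed.

Lemma binsum_one w : Re w <= -1 -> clim (fun X => csum (bincoef w) (S X)) 0.
Proof.
  intros hw.
  assert (hw0 : w <> 0) by (intros ->; simpl in hw; lra).
  assert (e1 : forall X, csum (bincoef w) (S X) = (bincoef w X * (w + RtoC (INR X)) / w)%C).
  { induction X; [simpl; field; auto|].
    change (csum (bincoef w) (S (S X))) with (csum (bincoef w) (S X) + bincoef w (S X))%C.
    rewrite IHX. rewrite (Cmult_comm (bincoef w X)), <- bincoef_S. rewrite S_INR, RtoC_plus. field; auto. }
  apply clim_of_rate with (growth w * (Cmod w + 1) / Cmod w). intros X hX.
  rewrite e1. replace (bincoef w X * (w + RtoC (INR X)) / w - 0)%C with (bincoef w X * (w + RtoC (INR X)) / w)%C by ring.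
  assert (hm : 0 < Cmod w) by now apply Cmod_gt_0.
  rewrite Cmod_div, Cmod_mult by auto.
  assert (hXp : 1 <= INR X) by (apply INR_ge1; lia).
  assert (hb := bincoef_bound w X hX hw).
  assert (hwX : Cmod (w + RtoC (INR X)) <= (Cmod w + 1) * INR X).
  { eapply Rle_trans; [apply Cmod_triangle|]. rewrite Cmod_R, Rabs_pos_eq by lra. nra. }
  apply Rle_trans with (growth w * (/ INR X * / INR X) * ((Cmod w + 1) * INR X) / Cmod w).
  - apply Rmult_le_compat_r; [left; now apply Rinv_0_lt_compat|].
    apply Rmult_le_compat; auto; apply Cmod_ge_0.
  - right. field. lra.
Qed.

(** * Indicators and orthogonality of roots of unity *)

Definition indic (b : bool) : C := if b then RtoC 1 else RtoC 0.

Lemma Cmod_indic b : Cmod (indic b) <= 1.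
Proof. destruct b; simpl; rewrite ?Cmod_1, ?Cmod_0; lra. Qed.

Lemma e_neq_1 (x : R) : 0 < x < 1 -> e (RtoC x) <> 1.
Proof.
  intros hx h. rewrite e_R in h. apply (f_equal fst) in h. simpl in h.
  replace (2 * PI * x) with (2 * (PI * x)) in h by ring. rewrite cos_2a_sin in h.
  assert (hs : 0 < sin (PI * x)) by (assert (hp := PI_RGT_0); apply sin_gt_0; nra). nra.
Qed.

Lemma e_orthogonality (M : nat) (d : Z) : (1 <= M)%nat ->
  csum (fun k => e (RtoC (INR k * IZR d / INR M))) M = (RtoC (INR M) * indic (d mod Z.of_nat M =? 0)%Z)%C.
Proof.
  intros hM. assert (hm : 0 < INR M) by (apply lt_0_INR; lia).
  assert (hdm := Z.div_mod d (Z.of_nat M) ltac:(lia)).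
  assert (hb := Z.mod_pos_bound d (Z.of_nat M) ltac:(lia)).
  set (r := (d mod Z.of_nat M)%Z) in *. set (q := (d / Z.of_nat M)%Z) in *.
  assert (hx : IZR d / INR M = IZR q + IZR r / INR M).
  { rewrite hdm, plus_IZR, mult_IZR, <- INR_IZR_INZ. field. lra. }
  assert (hk : forall k, e (RtoC (INR k * IZR d / INR M)) = ((e (RtoC (IZR r / INR M))) ^ k)%C).
  { intros k. replace (INR k * IZR d / INR M) with (INR k * (IZR d / INR M)) by (field; lra).
    rewrite hx, Rmult_plus_distr_l, RtoC_plus, e_plus, (INR_IZR_INZ k), <- mult_IZR, e_IZR, Cmult_1_l.
    unfold e. rewrite cexp_pow. f_equal. rewrite <- INR_IZR_INZ, (RtoC_mult (INR k)). ring. }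
  rewrite (csum_ext _ _ _ (fun k _ => hk k)).
  destruct (Z.eqb_spec r 0) as [h0|h0]; simpl.
  - rewrite h0. replace (0 / INR M) with 0 by (field; lra). rewrite e_0.
    rewrite (csum_ext _ (fun _ => RtoC 1)); [rewrite csum_const; ring|].
    intros k _. induction k; simpl; [auto|]. rewrite IHk. ring.
  - set (z := e (RtoC (IZR r / INR M))).
    assert (hz : z <> 1).
    { apply e_neq_1. assert (h1 : 0 < IZR r) by (apply (IZR_lt 0); lia).
      assert (h2 : IZR r < INR M) by (rewrite INR_IZR_INZ; apply IZR_lt; lia).
      split; [now apply Rdiv_lt_0_compat|]. apply Rmult_lt_reg_r with (INR M); auto.
      unfold Rdiv. rewrite Rmult_assoc, Rinv_l; lra. }
    assert (hg : forall n, ((z - 1) * csum (fun k => z ^ k) n = z ^ n - 1)%C).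
    { induction n; simpl; [ring|]. rewrite Cmult_plus_distr_l, IHn. ring. }
    assert (hzM : (z ^ M)%C = 1).
    { unfold z. rewrite <- hk. replace (INR M * IZR d / INR M) with (IZR d) by (field; lra). apply e_IZR. }
    assert (hz1 : (z - 1)%C <> 0) by (intros h; apply hz, C_sub_0, h).
    specialize (hg M). rewrite hzM in hg. rewrite Cmult_0_r.
    change (csum (fun k => z ^ k)%C M = 0). set (s0 := csum (fun k => z ^ k)%C M) in *. clearbody s0.
    transitivity (/ (z - 1) * ((z - 1) * s0))%C; [field; auto|rewrite hg; ring].
Qed.

Lemma clim_sub u l (g : nat -> nat) : (forall n, (n <= g n)%nat) -> clim u l -> clim (fun n => u (g n)) l.
Proof.
  intros hg h e he. destruct (h e he) as [n0 h0]. exists n0. intros n hn. apply h0.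
  specialize (hg n). lia.
Qed.

Lemma clim_dist_le u v l l' M : clim u l -> clim v l' -> (forall n, Cmod (u n - v n) <= M) ->
  Cmod (l - l') <= M.
Proof.
  intros hu hv h.
  assert (hd := clim_plus _ _ _ _ hu (clim_scal (- (1))%C _ _ hv)).
  replace (l - l')%C with ((l + - (1) * l') - 0)%C by ring.
  eapply clim_le_dist; [exact hd|]. exists O. intros n _. cbv beta.
  replace (u n + - (1) * v n - 0)%C with (u n - v n)%C by ring. apply h.
Qed.

Lemma cpowR_sq_bound n s : Re s <= -2 -> Cmod (cpowR (INR (S n)) s) <= / INR (S n) * / INR (S n).
Proof.
  intros hs. rewrite Cmod_cpowR. replace (/ INR (S n) * / INR (S n)) with ((/ INR (S n)) ^ 2) by ring.
  apply INR_pow_le; [lia|]. simpl. lra.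
Qed.

(** * Regularised partial zeta functions *)

Section Regularised.
Variables (N u : nat).
Hypothesis hN : (1 <= N)%nat.
Hypothesis hu : (u < N)%nat.

(* With [M = N m], the bracket is the sum of the binomial coefficients of index [m n], over [n >= 1]
   congruent to [u] modulo [N], extracted from [(1 - z)^(-w)] by a discrete Fourier transform over
   the [M]-th roots of unity.  It is entire in [w]. *)
Definition regz (m : nat) (w : C) : C :=
  (cpowR (INR m) (1 - w) *
   (/ RtoC (INR (N * m)) *
      csum (fun k => cexp (- w * clog1 (INR (S k) / INR (N * m))) *
                     e (RtoC (- (INR u * INR (S k) / INR N)))) (N * m - 1)
    - indic (u =? 0)%nat))%C.

Lemma index_mult (m n : nat) : (1 <= m)%nat ->
  ((Z.of_nat n - Z.of_nat (u * m)) mod Z.of_nat (N * m) =? 0)%Z =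
  ((n mod m =? 0)%nat && ((n / m) mod N =? u)%nat)%bool.
Proof.
  intros hm.
  assert (h1 := Nat.div_mod_eq n m). assert (h2 := Nat.mod_upper_bound n m ltac:(lia)).
  assert (h3 := Nat.div_mod_eq (n / m) N). assert (h4 := Nat.mod_upper_bound (n / m) N ltac:(lia)).
  destruct (Nat.eqb_spec (n mod m) 0) as [e1|e1]; simpl.
  - destruct (Nat.eqb_spec ((n / m) mod N) u) as [e2|e2]; simpl.
    + apply Z.eqb_eq. apply Z.mod_divide; [lia|]. exists (Z.of_nat ((n / m) / N)).
      rewrite h1 at 1. rewrite e1, h3 at 1. rewrite e2. nia.
    + apply Z.eqb_neq. intros h. apply Z.mod_divide in h; [|lia]. destruct h as [c hc].
      apply e2. assert (hq : (Z.of_nat (n / m) = Z.of_nat u + c * Z.of_nat N)%Z).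
      { apply (Z.mul_reg_r _ _ (Z.of_nat m)); [lia|]. nia. }
      apply Nat2Z.inj. rewrite Nat2Z.inj_mod, hq, Z.mod_add, Z.mod_small by lia. reflexivity.
  - apply Z.eqb_neq. intros h. apply Z.mod_divide in h; [|lia]. destruct h as [c hc].
    apply e1. apply Nat2Z.inj. rewrite Nat2Z.inj_mod.
    replace (Z.of_nat n) with ((Z.of_nat u + c * Z.of_nat N) * Z.of_nat m)%Z by nia.
    rewrite Z.mod_mul by lia. reflexivity.
Qed.

(** As u k/N = (u m) k/M, the transform selects the indices n = u m mod M, which are the m n' with
    n' = u mod N. The cut-off m Y becomes n' <= Y. Index 0 has coefficient 1 and survives only for u
    = 0: it is the term removed in [regz]. *)
Lemma dft_bincoef m w Y : (1 <= m)%nat ->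
  csum (fun k => e (RtoC (- (INR u * INR k / INR N))) *
     csum (fun n => bincoef w n * e (RtoC (INR n * (INR k / INR (N * m)))))%C (S (m * Y)))%C (N * m) =
  (RtoC (INR (N * m)) * (indic (u =? 0)%nat +
     csum (fun n => indic (S n mod N =? u)%nat * bincoef w (m * S n)) Y))%C.
Proof.
  intros hm. set (M := (N * m)%nat). assert (hM : (1 <= M)%nat) by (unfold M; nia).
  assert (hMp : 0 < INR M) by (apply lt_0_INR; lia).
  assert (hNp : 0 < INR N) by (apply lt_0_INR; lia).
  assert (hmp : 0 < INR m) by (apply lt_0_INR; lia).
  rewrite (csum_ext _ (fun k => csum (fun n => bincoef w n *
     e (RtoC (INR k * IZR (Z.of_nat n - Z.of_nat (u * m)) / INR M)))%C (S (m * Y)))).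
  2:{ intros k _. rewrite <- csum_scal. apply csum_ext. intros n _.
      transitivity (bincoef w n * (e (RtoC (- (INR u * INR k / INR N))) *
        e (RtoC (INR n * (INR k / INR M)))))%C; [ring|].
      rewrite <- e_plus, <- RtoC_plus. do 3 f_equal.
      rewrite minus_IZR, <- !INR_IZR_INZ. unfold M. rewrite !mult_INR. field. lra. }
  rewrite csum_swap.
  rewrite (csum_ext _ (fun n => if (n mod m =? 0)%nat then
     (fun q => RtoC (INR M) * (indic (q mod N =? u)%nat * bincoef w (m * q)))%C (n / m)%nat else RtoC 0)).
  2:{ intros n _. rewrite csum_scal, e_orthogonality by auto. unfold M. rewrite index_mult by auto.
      assert (h1 := Nat.div_mod_eq n m).
      destruct (Nat.eqb_spec (n mod m) 0) as [e1|e1]; simpl andb; [|simpl; ring].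
      replace (m * (n / m))%nat with n by lia. ring. }
  assert (hcm := csum_multiples (fun q => RtoC (INR M) * (indic (q mod N =? u)%nat * bincoef w (m * q)))%C m (m * Y) hm).
  cbv beta in hcm. rewrite hcm, (Nat.mul_comm m Y), Nat.div_mul by lia.
  rewrite csum_first, Nat.Div0.mod_0_l, Nat.mul_0_r, csum_scal.
  rewrite (Nat.eqb_sym 0 u). simpl bincoef. ring.
Qed.

Lemma regz_series m w : (1 <= m)%nat -> Re w <= -1 ->
  clim (fun Y => csum (fun n => indic (S n mod N =? u)%nat * cpowR (INR (S n)) (w - 1) * gam (m * S n) w)%C Y)
    (regz m w).
Proof.
  intros hm hw. set (M := (N * m)%nat). assert (hM : (1 <= M)%nat) by (unfold M; nia).
  assert (hMp : 0 < INR M) by (apply lt_0_INR; lia).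
  assert (hM0 : RtoC (INR M) <> 0) by (apply RtoC_neq_0; lra).
  set (F := fun X k => (e (RtoC (- (INR u * INR k / INR N))) *
     csum (fun n => bincoef w n * e (RtoC (INR n * (INR k / INR M)))) (S X))%C).
  (* Frequency 0 tends to 0 by [binsum_one], which is why the sum in [regz] runs over k >= 1
     only. *)
  set (l := fun k => match k with O => RtoC 0 | S _ =>
     (e (RtoC (- (INR u * INR k / INR N))) * cexp (- w * clog1 (INR k / INR M)))%C end).
  assert (hF : clim (fun X => csum (F X) M) (csum l M)).
  { apply csum_clim. intros k hk. destruct k as [|k].
    - unfold l, F. eapply clim_ext_ev with (n0 := O); [|apply (binsum_one w hw)].
      intros X _. cbv beta. rewrite (csum_ext (bincoef w) (fun n => bincoef w n * e (RtoC (INR n * (INR 0 / INR M))))%C).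
      + replace (- (INR u * INR 0 / INR N)) with 0 by (simpl; unfold Rdiv; ring). rewrite e_0. ring.
      + intros n _. simpl (INR 0). replace (INR n * (0 / INR M)) with 0 by (unfold Rdiv; ring). rewrite e_0. ring.
    - unfold l, F. apply clim_scal. apply binsum_unit; auto.
      assert (h1 : 0 < INR (S k)) by (apply lt_0_INR; lia).
      assert (h2 : INR (S k) < INR M) by (apply lt_INR; lia).
      split; [now apply Rdiv_lt_0_compat|]. apply Rmult_lt_reg_r with (INR M); auto.
      unfold Rdiv. rewrite Rmult_assoc, Rinv_l; lra. }
  apply (clim_sub _ _ (fun Y => m * Y)%nat) in hF; [|intros; nia].
  apply (clim_cont (fun z => cpowR (INR m) (1 - w) * (/ RtoC (INR M) * z + - indic (u =? 0)%nat))%C) in hF.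
  2:{ apply cont_mult; [apply cont_const|]. apply cont_plus; [|apply cont_const].
      apply cont_mult; [apply cont_const|apply cont_id]. }
  replace (regz m w) with (cpowR (INR m) (1 - w) * (/ RtoC (INR M) * csum l M + - indic (u =? 0)%nat))%C.
  2:{ unfold regz. fold M. destruct M as [|M']; [lia|].
      rewrite csum_first. replace (S M' - 1)%nat with M' by lia.
      rewrite (csum_ext (fun k => l (S k)) (fun k => cexp (- w * clog1 (INR (S k) / INR (S M'))) *
         e (RtoC (- (INR u * INR (S k) / INR N))))%C); [change (l O) with (RtoC 0); ring|].
      intros k _. unfold l. ring. }
  eapply clim_ext_ev with (n0 := O); [|exact hF]. intros Y _. cbv beta.
  assert (hd := dft_bincoef m w Y hm). fold M in hd. unfold F. rewrite hd.
  transitivity (cpowR (INR m) (1 - w) * csum (fun n => indic (S n mod N =? u)%nat * bincoef w (m * S n)) Y)%C.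
  { f_equal. field. auto. }
  rewrite <- csum_scal. apply csum_ext. intros n _.
  rewrite bincoef_gam by nia. rewrite mult_INR, cpowR_mult by (apply lt_0_INR; lia).
  (* The coefficient of index m n carries (m n)^(w-1); its factor m^(w-1) is cancelled by the
     normalisation, leaving n^(w-1). *)
  assert (h1 : (cpowR (INR m) (1 - w) * cpowR (INR m) (w - 1) = 1)%C).
  { rewrite <- cpowR_plus. replace (1 - w + (w - 1))%C with (RtoC 0) by ring.
    unfold cpowR. rewrite Cmult_0_r. apply cexp_0. }
  transitivity ((cpowR (INR m) (1 - w) * cpowR (INR m) (w - 1)) *
    (indic (S n mod N =? u)%nat * cpowR (INR (S n)) (w - 1) * gam (m * S n) w))%C; [ring|].
  rewrite h1. ring.
Qed.

Definition zpart (w : C) (Y : nat) : C :=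
  csum (fun n => indic (S n mod N =? u)%nat * cpowR (INR (S n)) (w - 1))%C Y.

(** Replacing [gam (m * S n) w] by its limit costs at most 2 [growth w]/m uniformly in n, and the
    weights n^(w-1) are dominated by 1/n^2, of sum at most 2: hence the 4. The limit is identified
    later, by uniqueness. *)
Lemma regz_left w : Re w <= -1 -> exists l, clim (fun Y => rgam w * zpart w Y)%C l /\
  forall m, (1 <= m)%nat -> Cmod (regz m w - l) <= 4 * growth w / INR m.
Proof.
  intros hw.
  assert (hb : forall n, Cmod (indic (S n mod N =? u)%nat * cpowR (INR (S n)) (w - 1)) <= / INR (S n) * / INR (S n)).
  { intros n. rewrite Cmod_mult. assert (h1 := Cmod_indic (S n mod N =? u)%nat).
    assert (h2 := Cmod_ge_0 (indic (S n mod N =? u)%nat)).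
    assert (h3 := cpowR_sq_bound n (w - 1)). assert (h4 := Cmod_ge_0 (cpowR (INR (S n)) (w - 1))).
    change (Re (w - 1)) with (Re w - 1) in h3. specialize (h3 ltac:(lra)). nra. }
  destruct (csum_cv (fun n => indic (S n mod N =? u)%nat * cpowR (INR (S n)) (w - 1))%C 1) as [l hl]; [lra| |].
  { intros n. rewrite Rmult_1_l. apply hb. }
  exists (rgam w * l)%C. split; [now apply clim_scal|]. intros m hm.
  eapply clim_dist_le; [now apply regz_series|apply (clim_scal (rgam w)), hl|]. intros Y. cbv beta.
  rewrite <- csum_scal.
  replace (_ - _)%C with (csum (fun n => indic (S n mod N =? u)%nat * cpowR (INR (S n)) (w - 1) * (gam (m * S n) w - rgam w))%C Y).
  2:{ match goal with |- _ = (csum ?f ?n - csum ?g ?n)%C =>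
        replace (csum f n - csum g n)%C with (csum f n + (- (1)) * csum g n)%C by ring end.
      rewrite <- csum_scal, <- csum_plus. apply csum_ext. intros; ring. }
  assert (hm1 : 1 <= INR m) by (apply INR_ge1; lia).
  assert (hg := growth_pos w).
  replace (4 * growth w / INR m) with (2 * (2 * growth w / INR m)) by (field; lra).
  apply csum_sq_bound.
  - apply Rlt_le, Rdiv_lt_0_compat; lra.
  - intros n _. rewrite Cmod_mult, Rmult_comm. apply Rmult_le_compat; [apply Cmod_ge_0|apply Cmod_ge_0| |apply hb].
    eapply Rle_trans; [apply rgam_dist; nia|]. apply Rmult_le_compat_l; [lra|].
    apply Rinv_le_contravar; [lra|]. apply le_INR. nia.
Qed.

End Regularised.

(** * Hurwitz's formula far to the right *)

(** From x/(1 + x) <= sin x <= x, the difference lies between -ln(1 + x) and 0. *)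
Lemma ln_sin_bound x : 0 < x <= PI / 2 -> Rabs (ln (sin x) - ln x) <= x.
Proof.
  intros hx. assert (h4 := PI_4). assert (h3 := PI_RGT_0).
  assert (hs : 0 < sin x) by (apply sin_gt_0; lra).
  assert (hu : sin x <= x) by (assert (h := sin_abs_le x); rewrite !Rabs_pos_eq in h; lra).
  destruct (pre_sin_bound x 0 ltac:(lra) ltac:(lra)) as [hl _].
  unfold sin_approx, sin_term in hl. simpl in hl.
  assert (hl2 : x - x * x * x / 6 <= sin x) by lra. clear hl.
  assert (hlow : x / (1 + x) <= sin x).
  { eapply Rle_trans; [|exact hl2]. apply Rmult_le_reg_r with (1 + x); [lra|].
    unfold Rdiv at 1. rewrite Rmult_assoc, Rinv_l, Rmult_1_r by lra.
    assert (x <= 2) by lra.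
    assert (0 <= x * x * (1 - (x + x * x) / 6)) by (apply Rmult_le_pos; nra). nra. }
  assert (h1 : ln (sin x) <= ln x) by (destruct hu as [hu|hu]; [left; apply ln_increasing; lra|rewrite hu; lra]).
  assert (hd : 0 < x / (1 + x)) by (apply Rdiv_lt_0_compat; lra).
  assert (h2 : ln (x / (1 + x)) <= ln (sin x)) by (destruct hlow as [hu'|hu']; [left; apply ln_increasing; lra|rewrite hu'; lra]).
  unfold Rdiv in h2. rewrite ln_mult, ln_Rinv in h2 by (try apply Rinv_0_lt_compat; lra).
  destruct (ln_1p_bounds x ltac:(lra)) as [_ h5]. apply Rabs_le. lra.
Qed.

(** As M grows, both ends of the range contribute, since the roots of unity approach 1 from both
    sides. Folding pairs k with M - k; the strict comparison keeps a middle index 2 k = M from being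
    counted twice. *)
Lemma csum_fold (f : nat -> C) M : (1 <= M)%nat ->
  csum (fun k => f (S k)) (M - 1) =
  csum (fun k => (if (2 * S k <=? M)%nat then f (S k) else 0) +
                 (if (2 * S k <? M)%nat then f (M - S k)%nat else 0))%C (M - 1).
Proof.
  intros hM.
  rewrite (csum_ext _ (fun k => (if (2 * S k <=? M)%nat then f (S k) else 0) +
    (if (2 * S k <=? M)%nat then 0 else f (S k)))%C) by (intros k _; destruct (_ <=? _)%nat; ring).
  rewrite !csum_plus. f_equal. rewrite csum_rev. apply csum_ext. intros k hk.
  replace (S (M - 1 - 1 - k)) with (M - S k)%nat by lia.
  destruct (Nat.leb_spec (2 * (M - S k)) M), (Nat.ltb_spec (2 * S k) M); try lia; auto.
Qed.

Lemma csum_stable (f : nat -> C) n K : (n <= K)%nat -> (forall k, (n <= k)%nat -> f k = 0) -> csum f K = csum f n.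
Proof.
  intros h h0. replace K with (n + (K - n))%nat by lia. rewrite csum_split.
  rewrite (csum_ext (fun k => f (n + k)%nat) (fun _ => RtoC 0)) by (intros; apply h0; lia).
  rewrite csum_0. ring.
Qed.

Section Dual.
Variables (N u : nat).
Hypothesis hN : (1 <= N)%nat.

Definition dual (w : C) (k : nat) : C :=
  (/ RtoC (INR N) * (cpowR (2 * PI * INR (S k) / INR N) (- w) *
     (e (w / 4) * e (RtoC (- (INR u * INR (S k) / INR N))) +
      e (- (w / 4)) * e (RtoC (INR u * INR (S k) / INR N)))))%C.

(** The exponent of (2 pi k/N)^(-w) e(sg w/4), with k shifted by one. The sign [sg] is 1 for roots
    of unity near the start of the range and -1 for those near its end. *)
Let lim_arg (sg : R) (w : C) (k : nat) : C :=
  Cmult (- w)%C (ln (2 * PI * INR (S k) / INR N), - (sg * (PI / 2))).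

(** The exponent of (m (1 - zeta))^(-w), with zeta replaced by its conjugate for [sg] = -1. Here 2 m
    sin(pi k/M) tends to 2 pi k/N. *)
Let fin_arg (sg : R) (m : nat) (w : C) (k : nat) : C :=
  Cmult (- w)%C (ln (2 * INR m * sin (PI * (INR (S k) / INR (N * m)))),
                 sg * (PI * (INR (S k) / INR (N * m) - / 2))).

Lemma dual_cexp w k : dual w k = (/ RtoC (INR N) *
   (cexp (lim_arg 1 w k) * e (RtoC (- (INR u * INR (S k) / INR N))) +
    cexp (lim_arg (-1) w k) * e (RtoC (INR u * INR (S k) / INR N))))%C.
Proof.
  unfold dual. f_equal. rewrite Cmult_plus_distr_l, !Cmult_assoc.
  assert (h4 : RtoC 4 <> 0) by (apply RtoC_neq_0; lra).
  assert (i4 : (/ RtoC 4)%C = RtoC (/ 4)) by (rewrite RtoC_inv by lra; reflexivity).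
  assert (c1 : (cpowR (2 * PI * INR (S k) / INR N) (- w) * e (w / 4))%C = cexp (lim_arg 1 w k)).
  { unfold cpowR, e, lim_arg, Cdiv. rewrite <- cexp_plus, i4. f_equal. destruct w.
    apply Ceq; simpl; field; apply not_0_INR; lia. }
  assert (c2 : (cpowR (2 * PI * INR (S k) / INR N) (- w) * e (- (w / 4)))%C = cexp (lim_arg (-1) w k)).
  { unfold cpowR, e, lim_arg, Cdiv. rewrite <- cexp_plus, i4. f_equal. destruct w.
    apply Ceq; simpl; field; apply not_0_INR; lia. }
  rewrite c1, c2. reflexivity.
Qed.

Let G (S0 : R) := exp (S0 * ln (INR N)).

(** The cube explains the half-plane [3 <= Re w]: two powers of 1/k give summability and the third
    pays for the rate 1/M, both in the comparison with the finite terms and in the tail. *)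
Lemma lim_arg_bound sg w k : Rabs sg <= 1 -> 3 <= Re w ->
  Cmod (cexp (lim_arg sg w k)) <= G (Re w) * (/ INR (S k)) ^ 3 * exp (2 * Cmod w).
Proof.
  intros hsg hw. rewrite Cmod_cexp.
  assert (hk := INR_S_ge1 k). assert (hNp : 1 <= INR N) by (apply INR_ge1; lia).
  assert (h4 := PI_4). assert (hP := PI2_1).
  apply Rle_trans with (exp (Re w * ln (INR N)) * exp (ln (INR (S k)) * - Re w) * exp (2 * Cmod w)).
  - rewrite <- !exp_plus. apply exp_le. unfold lim_arg.
    replace (Re (Cmult (- w)%C (ln (2 * PI * INR (S k) / INR N), - (sg * (PI / 2))))) with
      (- Re w * ln (2 * PI * INR (S k) / INR N) - Im w * (sg * (PI / 2))) by (destruct w; simpl; ring).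
    assert (hl : ln (INR (S k)) - ln (INR N) <= ln (2 * PI * INR (S k) / INR N)).
    { unfold Rdiv. assert (0 < / INR N) by (apply Rinv_0_lt_compat; lra).
      rewrite !ln_mult, ln_Rinv by (try nra; lra).
      assert (h2 : 0 <= ln 2) by (rewrite <- ln_1; left; apply ln_increasing; lra).
      assert (h3 : 0 <= ln PI) by (rewrite <- ln_1; left; apply ln_increasing; lra). lra. }
    assert (hi : - (Im w * (sg * (PI / 2))) <= 2 * Cmod w).
    { eapply Rle_trans; [apply Rle_abs|]. rewrite Rabs_Ropp, !Rabs_mult, (Rabs_pos_eq (PI / 2)) by lra.
      assert (h5 := im_le_Cmod w). assert (h6 := Rabs_pos (Im w)). assert (h7 := Rabs_pos sg).
      assert (Rabs sg * (PI / 2) <= 2) by nra. nra. }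
    nra.
  - apply Rmult_le_compat_r; [left; apply exp_pos|]. apply Rmult_le_compat_l; [left; apply exp_pos|].
    apply INR_pow_le; [lia|]. simpl. lra.
Qed.

Let Q (w : C) := 24 * G (Re w) * exp (7 * Cmod w).

Lemma Q_pos w : 0 < Q w.
Proof. unfold Q, G. assert (h1 := exp_pos (Re w * ln (INR N))). assert (h2 := exp_pos (7 * Cmod w)). nra. Qed.

(** With x0 = pi k/M at most pi/2, the two exponents differ by w times at most 2 x0, half from ln
    sin and half from the angle. The extra factor k/M is absorbed by the cube of 1/k. *)
Lemma fin_arg_close sg m w k : (1 <= m)%nat -> Rabs sg <= 1 -> 3 <= Re w -> (2 * S k <= N * m)%nat ->
  Cmod (cexp (fin_arg sg m w k) - cexp (lim_arg sg w k)) <= Q w / INR (N * m) * (/ INR (S k) * / INR (S k)).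
Proof.
  intros hm hsg hw hk2. set (M := (N * m)%nat) in *.
  assert (hk := INR_S_ge1 k). assert (hNp : 0 < INR N) by (apply lt_0_INR; lia).
  assert (hmp : 0 < INR m) by (apply lt_0_INR; lia).
  assert (hMe : INR M = INR N * INR m) by (unfold M; apply mult_INR).
  assert (hMp : 0 < INR M) by nra.
  assert (h4 := PI_4). assert (hP := PI2_1).
  set (x0 := PI * (INR (S k) / INR M)).
  assert (hkM : 0 < INR (S k) / INR M <= / 2).
  { split; [apply Rdiv_lt_0_compat; lra|]. apply Rmult_le_reg_r with (2 * INR M); [lra|].
    replace (INR (S k) / INR M * (2 * INR M)) with (2 * INR (S k)) by (field; lra).
    replace (/ 2 * (2 * INR M)) with (INR M) by field.
    replace 2 with (INR 2) by reflexivity. rewrite <- mult_INR. now apply le_INR. }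
  assert (hx0 : 0 < x0 <= PI / 2) by (unfold x0; split; nra).
  assert (hls := ln_sin_bound x0 hx0).
  assert (hsx : 0 < sin x0) by (apply sin_gt_0; lra).
  set (x := Cmod w). assert (hx : 0 <= x) by apply Cmod_ge_0.
  assert (hd : Cmod (fin_arg sg m w k - lim_arg sg w k) <= x * (2 * x0)).
  { unfold fin_arg, lim_arg. fold M x0.
    replace (Cminus (Cmult (- w)%C (ln (2 * INR m * sin x0), sg * (PI * (INR (S k) / INR M - / 2))))
       (Cmult (- w)%C (ln (2 * PI * INR (S k) / INR N), - (sg * (PI / 2))))) with
      (Cmult (- w)%C (ln (sin x0) - ln x0, sg * x0)).
    - rewrite Cmod_mult, Cmod_opp. fold x. apply Rmult_le_compat_l; auto.
      eapply Rle_trans; [apply Cmod_le_abs|]. simpl. rewrite Rabs_mult, (Rabs_pos_eq x0) by lra.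
      assert (Rabs sg * x0 <= x0) by (assert (h5 := Rabs_pos sg); nra). lra.
    - replace (2 * PI * INR (S k) / INR N) with (2 * INR m * x0) by (unfold x0; rewrite hMe; field; lra).
      rewrite (ln_mult (2 * INR m) (sin x0)), (ln_mult (2 * INR m) x0) by lra.
      unfold x0. destruct w. apply Ceq; simpl; field; lra. }
  eapply Rle_trans; [apply cexp_diff|].
  assert (hb := lim_arg_bound sg w k hsg hw). rewrite Cmod_cexp in hb. fold x in hb.
  set (dd := Cmod (fin_arg sg m w k - lim_arg sg w k)) in *.
  assert (hdd : 0 <= dd) by apply Cmod_ge_0.
  assert (hx04 : x0 <= 4 * (INR (S k) / INR M)) by (unfold x0; nra).
  (* Here 2 x0 <= pi <= 4. *)
  assert (e1 : exp dd <= exp (4 * x)) by (apply exp_le; nra).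
  assert (hkk : 0 < / INR (S k)) by (apply Rinv_0_lt_compat; lra).
  assert (hG : 0 < G (Re w)) by apply exp_pos.
  assert (p1 := exp_pos (2 * x)). assert (p2 := exp_pos (4 * x)). assert (p3 := exp_pos x).
  apply Rle_trans with ((G (Re w) * (/ INR (S k)) ^ 3 * exp (2 * x)) *
     (3 * (exp x * (8 * (INR (S k) / INR M))) * exp (4 * x))).
  - apply Rmult_le_compat; [left; apply exp_pos| |auto|].
    + apply Rmult_le_pos; [lra|left; apply exp_pos].
    + apply Rmult_le_compat; [lra|left; apply exp_pos| |auto].
      apply Rmult_le_compat_l; [lra|]. eapply Rle_trans; [exact hd|].
      assert (hex := le_exp x). apply Rmult_le_compat; lra.
  - right. unfold Q. fold x. replace (exp (7 * x)) with (exp (2 * x) * exp x * exp (4 * x))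
      by (rewrite <- !exp_plus; f_equal; ring). field. lra.
Qed.

Lemma lim_arg_tail sg m w k : (1 <= m)%nat -> Rabs sg <= 1 -> 3 <= Re w -> (N * m <= 2 * S k)%nat ->
  Cmod (0 - cexp (lim_arg sg w k)) <= Q w / INR (N * m) * (/ INR (S k) * / INR (S k)).
Proof.
  intros hm hsg hw hk2. replace (0 - cexp (lim_arg sg w k))%C with (- cexp (lim_arg sg w k))%C by ring.
  rewrite Cmod_opp. eapply Rle_trans; [now apply lim_arg_bound|].
  assert (hk := INR_S_ge1 k). assert (hNp : 0 < INR N) by (apply lt_0_INR; lia).
  assert (hMp : 0 < INR (N * m)) by (apply lt_0_INR; nia).
  assert (hle : INR (N * m) <= 2 * INR (S k)).
  { replace 2 with (INR 2) by reflexivity. rewrite <- mult_INR. now apply le_INR. }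
  set (M := INR (N * m)) in *. set (x := Cmod w). assert (hx : 0 <= x) by apply Cmod_ge_0.
  assert (hkk : 0 < / INR (S k)) by (apply Rinv_0_lt_compat; lra).
  assert (hG : 0 < G (Re w)) by apply exp_pos.
  assert (h2 : / INR (S k) <= 24 * / M).
  { apply Rmult_le_reg_r with (INR (S k) * M); [nra|].
    replace (/ INR (S k) * (INR (S k) * M)) with M by (field; lra).
    replace (24 * / M * (INR (S k) * M)) with (24 * INR (S k)) by (field; lra). lra. }
  assert (e1 : exp (2 * x) <= exp (7 * x)) by (apply exp_le; lra).
  unfold Q. fold x.
  replace (24 * G (Re w) * exp (7 * x) / M * (/ INR (S k) * / INR (S k))) with
    (G (Re w) * (24 * / M * (/ INR (S k) * / INR (S k))) * exp (7 * x)) by (field; lra).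
  apply Rmult_le_compat; [|left; apply exp_pos| |auto].
  - apply Rmult_le_pos; [lra|]. apply pow_le; lra.
  - apply Rmult_le_compat_l; [lra|].
    replace ((/ INR (S k)) ^ 3) with (/ INR (S k) * (/ INR (S k) * / INR (S k))) by ring.
    apply Rmult_le_compat_r; [nra|exact h2].
Qed.

Let fin_term m w k : C :=
  ((if (2 * S k <=? N * m)%nat then cexp (fin_arg 1 m w k) else 0) * e (RtoC (- (INR u * INR (S k) / INR N))) +
   (if (2 * S k <? N * m)%nat then cexp (fin_arg (-1) m w k) else 0) * e (RtoC (INR u * INR (S k) / INR N)))%C.

(** At the reflected index M - k the sine is unchanged and the angle changes sign. The phase e(-u (M
    - k)/N) becomes e(u k/N), because u M/N = u m is an integer. *)
Lemma regz_fin_term m w : (1 <= m)%nat ->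
  regz N u m w = (/ RtoC (INR N) * csum (fin_term m w) (N * m - 1) - cpowR (INR m) (1 - w) * indic (u =? 0)%nat)%C.
Proof.
  intros hm. set (M := (N * m)%nat). assert (hM : (1 <= M)%nat) by (unfold M; nia).
  assert (hNp : 0 < INR N) by (apply lt_0_INR; lia).
  assert (hmp : 0 < INR m) by (apply lt_0_INR; lia).
  assert (hMe : INR M = INR N * INR m) by (unfold M; apply mult_INR).
  assert (hMp : 0 < INR M) by nra.
  unfold regz. fold M.
  rewrite (csum_fold (fun k => cexp (- w * clog1 (INR k / INR M)) * e (RtoC (- (INR u * INR k / INR N))))%C M hM).
  assert (hfac : (cpowR (INR m) (1 - w) * / RtoC (INR M))%C = (/ RtoC (INR N) * cpowR (INR m) (- w))%C).
  { unfold Cminus. rewrite cpowR_plus, cpowR_1_r, hMe, RtoC_mult by lra.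
    field. split; apply RtoC_neq_0; lra. }
  transitivity ((cpowR (INR m) (1 - w) * / RtoC (INR M)) * csum
    (fun k => (if (2 * S k <=? M)%nat then cexp (- w * clog1 (INR (S k) / INR M)) * e (RtoC (- (INR u * INR (S k) / INR N))) else 0) +
     (if (2 * S k <? M)%nat then cexp (- w * clog1 (INR (M - S k) / INR M)) * e (RtoC (- (INR u * INR (M - S k) / INR N))) else 0))%C (M - 1)
    - cpowR (INR m) (1 - w) * indic (u =? 0)%nat)%C; [ring|].
  rewrite hfac, <- Cmult_assoc, <- csum_scal. f_equal. f_equal. apply csum_ext. intros k hk.
  assert (hkp := INR_S_ge1 k).
  assert (hkM : 0 < INR (S k) / INR M < 1).
  { assert (INR (S k) < INR M) by (apply lt_INR; lia). split; [apply Rdiv_lt_0_compat; lra|].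
    apply Rmult_lt_reg_r with (INR M); auto. unfold Rdiv. rewrite Rmult_assoc, Rinv_l; lra. }
  assert (hP := PI_RGT_0).
  assert (hs : 0 < sin (PI * (INR (S k) / INR M))) by (apply sin_gt_0; nra).
  unfold fin_term. fold M. rewrite Cmult_plus_distr_l. f_equal.
  - destruct (_ <=? _)%nat; [|ring]. rewrite Cmult_assoc. f_equal.
    unfold cpowR. rewrite <- cexp_plus. f_equal. unfold fin_arg, clog1. fold M.
    replace (2 * INR m * sin (PI * (INR (S k) / INR M))) with (INR m * (2 * sin (PI * (INR (S k) / INR M)))) by ring.
    rewrite (ln_mult (INR m)) by lra. destruct w; apply Ceq; cbn -[INR]; ring.
  - destruct (_ <? _)%nat; [|ring]. rewrite Cmult_assoc.
    assert (hdiv : INR (M - S k) / INR M = 1 - INR (S k) / INR M).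
    { rewrite minus_INR by lia. field. lra. }
    f_equal.
    + unfold cpowR. rewrite <- cexp_plus. f_equal. unfold fin_arg, clog1. fold M. rewrite hdiv.
      replace (PI * (1 - INR (S k) / INR M)) with (PI - PI * (INR (S k) / INR M)) by ring.
      rewrite sin_PI_x.
      replace (2 * INR m * sin (PI * (INR (S k) / INR M))) with (INR m * (2 * sin (PI * (INR (S k) / INR M)))) by ring.
      rewrite (ln_mult (INR m)) by lra. destruct w; apply Ceq; cbn -[INR]; field; lra.
    + replace (- (INR u * INR (M - S k) / INR N)) with (- IZR (Z.of_nat (u * m)) + INR u * INR (S k) / INR N).
      * rewrite <- opp_IZR, RtoC_plus, e_plus, e_IZR. ring.
      * rewrite <- INR_IZR_INZ, mult_INR, minus_INR, hMe by lia. field. lra.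
Qed.

(** Termwise comparison with the dual series: each sign costs at most [Q w]/M times 1/k^2. The term
    m^(1-w) left over for u = 0 is at most 1/m in modulus here. *)
Lemma regz_right w : 3 <= Re w -> exists l, clim (fun Y => csum (dual w) Y) l /\
  forall m, (1 <= m)%nat -> Cmod (regz N u m w - l) <= (96 * G (Re w) * 24 + 1) * growth w / INR m.
Proof.
  intros hw.
  assert (hNp : 1 <= INR N) by (apply INR_ge1; lia).
  assert (hiN : 0 < / INR N <= 1).
  { split; [apply Rinv_0_lt_compat; lra|]. rewrite <- Rinv_1. apply Rinv_le_contravar; lra. }
  assert (cN : Cmod (/ RtoC (INR N)) <= 1).
  { rewrite <- RtoC_inv by lra. rewrite Cmod_R, Rabs_pos_eq; lra. }
  assert (s1 : Rabs 1 <= 1) by (rewrite Rabs_R1; lra).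
  assert (s2 : Rabs (-1) <= 1) by (rewrite Rabs_left; lra).
  set (x := Cmod w). assert (hx : 0 <= x) by apply Cmod_ge_0.
  assert (hG : 0 < G (Re w)) by apply exp_pos.
  destruct (csum_cv (dual w) (2 * (G (Re w) * exp (2 * x)))) as [l hl].
  { assert (h := exp_pos (2 * x)). nra. }
  { intros k. rewrite dual_cexp, Cmod_mult.
    assert (b1 := lim_arg_bound 1 w k s1 hw). assert (b2 := lim_arg_bound (-1) w k s2 hw). fold x in b1, b2.
    assert (hk := INR_S_ge1 k). assert (hkk : 0 < / INR (S k)) by (apply Rinv_0_lt_compat; lra).
    assert (hk1 : / INR (S k) <= 1) by (rewrite <- Rinv_1; apply Rinv_le_contravar; lra).
    assert (hk3 : (/ INR (S k)) ^ 3 <= / INR (S k) * / INR (S k)).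
    { replace ((/ INR (S k)) ^ 3) with (/ INR (S k) * (/ INR (S k) * / INR (S k))) by ring.
      assert (0 < / INR (S k) * / INR (S k)) by nra. nra. }
    assert (hc : Cmod (cexp (lim_arg 1 w k) * e (RtoC (- (INR u * INR (S k) / INR N))) +
      cexp (lim_arg (-1) w k) * e (RtoC (INR u * INR (S k) / INR N))) <=
      2 * (G (Re w) * exp (2 * x)) * (/ INR (S k) * / INR (S k))).
    { eapply Rle_trans; [apply Cmod_triangle|]. rewrite !Cmod_mult, !Cmod_e_R.
      assert (hh : G (Re w) * (/ INR (S k)) ^ 3 * exp (2 * x) <= G (Re w) * exp (2 * x) * (/ INR (S k) * / INR (S k))).
      { replace (G (Re w) * (/ INR (S k)) ^ 3 * exp (2 * x)) with (G (Re w) * exp (2 * x) * (/ INR (S k)) ^ 3) by ring.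
        apply Rmult_le_compat_l; auto. assert (h := exp_pos (2 * x)). nra. }
      lra. }
    eapply Rle_trans; [|exact hc]. rewrite <- (Rmult_1_l (Cmod (_ + _))) at 2.
    apply Rmult_le_compat_r; [apply Cmod_ge_0|auto]. }
  exists l. split; auto. intros m hm.
  set (M := (N * m)%nat). assert (hM : (1 <= M)%nat) by (unfold M; nia).
  assert (hmp : 1 <= INR m) by (apply INR_ge1; lia).
  assert (hMe : INR M = INR N * INR m) by (unfold M; apply mult_INR).
  assert (hMp : 0 < INR M) by nra.
  rewrite Cmod_sub_sym. apply (clim_le_dist (csum (dual w))); auto.
  exists M. intros K hK.
  rewrite regz_fin_term by auto. fold M.
  (* The finite sum is prolonged by zeros, so that tails of the dual series are compared with 0 term
     by term. *)
  assert (hst : csum (fin_term m w) K = csum (fin_term m w) (M - 1)).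
  { apply csum_stable; [lia|]. intros k hk. unfold fin_term. fold M.
    destruct (Nat.leb_spec (2 * S k) M), (Nat.ltb_spec (2 * S k) M); try lia. ring. }
  rewrite <- hst.
  set (F := fun k => (cexp (lim_arg 1 w k) * e (RtoC (- (INR u * INR (S k) / INR N))) +
    cexp (lim_arg (-1) w k) * e (RtoC (INR u * INR (S k) / INR N)))%C).
  rewrite (csum_ext (dual w) (fun k => / RtoC (INR N) * F k)%C) by (intros; apply dual_cexp).
  rewrite csum_scal.
  replace (/ RtoC (INR N) * csum F K - (/ RtoC (INR N) * csum (fin_term m w) K - cpowR (INR m) (1 - w) * indic (u =? 0)))%C
    with (/ RtoC (INR N) * csum (fun k => F k + (- (1)) * fin_term m w k) K + cpowR (INR m) (1 - w) * indic (u =? 0)%nat)%C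
    by (rewrite csum_plus, csum_scal; ring).
  eapply Rle_trans; [apply Cmod_triangle|]. rewrite !Cmod_mult.
  assert (hQ := Q_pos w).
  assert (hQM : 0 < Q w / INR M) by (apply Rdiv_lt_0_compat; lra).
  assert (b1 : Cmod (csum (fun k => F k + (- (1)) * fin_term m w k)%C K) <= 2 * (2 * (Q w / INR M))).
  { apply csum_sq_bound; [lra|]. intros k _. unfold F, fin_term. fold M.
    set (A1 := if (2 * S k <=? M)%nat then cexp (fin_arg 1 m w k) else 0).
    set (A2 := if (2 * S k <? M)%nat then cexp (fin_arg (-1) m w k) else 0).
    set (E1 := e (RtoC (- (INR u * INR (S k) / INR N)))). set (E2 := e (RtoC (INR u * INR (S k) / INR N))).
    replace (_ + _)%C with (- ((A1 - cexp (lim_arg 1 w k)) * E1 + (A2 - cexp (lim_arg (-1) w k)) * E2))%C by ring.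
    rewrite Cmod_opp. eapply Rle_trans; [apply Cmod_triangle|]. rewrite !Cmod_mult.
    unfold E1, E2. rewrite !Cmod_e_R, !Rmult_1_r.
    assert (d1 : Cmod (A1 - cexp (lim_arg 1 w k)) <= Q w / INR M * (/ INR (S k) * / INR (S k))).
    { unfold A1. destruct (Nat.leb_spec (2 * S k) M); [apply fin_arg_close|apply lim_arg_tail]; auto. unfold M in *; lia. }
    assert (d2 : Cmod (A2 - cexp (lim_arg (-1) w k)) <= Q w / INR M * (/ INR (S k) * / INR (S k))).
    { unfold A2. destruct (Nat.ltb_spec (2 * S k) M); [apply fin_arg_close|apply lim_arg_tail]; auto. unfold M in *; lia. }
    lra. }
  assert (b2 : Cmod (cpowR (INR m) (1 - w)) <= / INR m).
  { rewrite Cmod_cpowR. replace (/ INR m) with ((/ INR m) ^ 1) by ring. apply INR_pow_le; auto.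
    change (Re (1 - w)) with (1 - Re w). simpl. lra. }
  assert (b3 := Cmod_indic (u =? 0)%nat). assert (b4 := Cmod_ge_0 (indic (u =? 0)%nat)).
  assert (b5 := Cmod_ge_0 (cpowR (INR m) (1 - w))).
  assert (b6 := Cmod_ge_0 (csum (fun k => F k + (- (1)) * fin_term m w k)%C K)).
  assert (b7 := Cmod_ge_0 (/ RtoC (INR N))).
  assert (hg1 : exp (7 * x) <= growth w) by (unfold growth; fold x; apply exp_le; nra).
  assert (hg2 : 1 <= growth w) by (rewrite <- exp_0; apply exp_le; nra).
  assert (him : 0 < / INR m) by (apply Rinv_0_lt_compat; lra).
  assert (hQm : Q w / INR M <= 24 * G (Re w) * growth w * / INR m).
  { apply Rmult_le_compat; [lra|left; apply Rinv_0_lt_compat; lra| |apply Rinv_le_contravar; nra].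
    unfold Q. fold x. apply Rmult_le_compat_l; [lra|auto]. }
  apply Rle_trans with (1 * (2 * (2 * (Q w / INR M))) + / INR m * 1).
  - apply Rplus_le_compat; apply Rmult_le_compat; auto.
  - unfold Rdiv in *. assert (/ INR m <= growth w * / INR m) by nra.
    assert (0 < growth w * / INR m) by nra. nra.
Qed.

End Dual.

(** * Interpolation across the strip *)

(** Applied for a fixed m, where [regz] is a finite combination of exponentials in w. The constant
    depends on m; that is harmless, as it only serves to see that the Gaussian weight wins at the
    far ends of a strip. *)
Definition exp_type (f : C -> C) : Prop :=
  exists c, 0 <= c /\ forall w, Cmod (f w) <= exp (c * (1 + Cmod w)).

Lemma exp_type_const a : exp_type (fun _ => a).
Proof.
  exists (Cmod a). split; [apply Cmod_ge_0|]. intros w. assert (h := le_exp (Cmod a)).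
  assert (h1 := Cmod_ge_0 a). assert (h2 := Cmod_ge_0 w).
  eapply Rle_trans; [exact h|]. apply exp_le. nra.
Qed.

Lemma exp_type_mult f g : exp_type f -> exp_type g -> exp_type (fun w => f w * g w)%C.
Proof.
  intros [c [hc h]] [d [hd h']]. exists (c + d). split; [lra|]. intros w.
  rewrite Cmod_mult, Rmult_plus_distr_r, exp_plus.
  apply Rmult_le_compat; auto; apply Cmod_ge_0.
Qed.

Lemma exp_type_plus f g : exp_type f -> exp_type g -> exp_type (fun w => f w + g w)%C.
Proof.
  intros [c [hc h]] [d [hd h']]. exists (c + d + 1). split; [lra|]. intros w.
  eapply Rle_trans; [apply Cmod_triangle|]. assert (h2 := Cmod_ge_0 w).
  assert (e1 : exp (c * (1 + Cmod w)) <= exp ((c + d) * (1 + Cmod w))) by (apply exp_le; nra).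
  assert (e2 : exp (d * (1 + Cmod w)) <= exp ((c + d) * (1 + Cmod w))) by (apply exp_le; nra).
  apply Rle_trans with (exp ((c + d) * (1 + Cmod w)) * exp 1).
  - assert (h3 := exp_ineq1_le 1). assert (h4 := exp_pos ((c + d) * (1 + Cmod w))).
    specialize (h w). specialize (h' w). nra.
  - rewrite <- exp_plus. apply exp_le. nra.
Qed.

Lemma exp_type_cexp a b : exp_type (fun w => cexp (a + b * w)%C).
Proof.
  exists (Cmod a + Cmod b). assert (h1 := Cmod_ge_0 a). assert (h2 := Cmod_ge_0 b). split; [lra|].
  intros w. rewrite Cmod_cexp. apply exp_le. eapply Rle_trans; [apply Rle_abs|].
  eapply Rle_trans; [apply re_le_Cmod|]. eapply Rle_trans; [apply Cmod_triangle|].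
  rewrite Cmod_mult. assert (h3 := Cmod_ge_0 w). nra.
Qed.

Lemma exp_type_ext f g : (forall w, f w = g w) -> exp_type f -> exp_type g.
Proof. intros h. now rewrite (functional_extensionality f g h). Qed.

Lemma exp_type_csum (f : nat -> C -> C) n : (forall k, exp_type (f k)) -> exp_type (fun w => csum (fun k => f k w) n).
Proof.
  intros h. induction n; simpl; [apply exp_type_const|]. now apply exp_type_plus.
Qed.

(* The constant 20 makes the weight decay faster than [growth] increases in vertical strips. *)
Definition gauss_weight (w : C) : C := cexp (RtoC 20 * (w * w))%C.

Lemma Cmod_gauss_weight w : Cmod (gauss_weight w) = exp (20 * (Re w * Re w - Im w * Im w)).
Proof. unfold gauss_weight. rewrite Cmod_cexp. apply (f_equal exp). destruct w; simpl; ring. Qed.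

Lemma Cmod_sq w : Cmod w * Cmod w = Re w * Re w + Im w * Im w.
Proof. assert (h := Cmod2_alt w). simpl in h. rewrite !Rmult_1_r in h. exact h. Qed.

Lemma holo_gauss_weight z : holo gauss_weight z.
Proof.
  apply (holo_comp cexp); [|apply holo_cexp].
  apply holo_mult; [apply holo_const|apply holo_mult; apply holo_id].
Qed.

Section Entire.
Variables (N u : nat).
Hypothesis hN : (1 <= N)%nat.
Hypothesis hu : (u < N)%nat.

Lemma holo_regz m z : holo (regz N u m) z.
Proof.
  unfold regz. apply holo_mult.
  - apply (holo_comp (cpowR _)); [|apply holo_cpowR]. apply holo_minus; [apply holo_const|apply holo_id].
  - apply holo_minus; [|apply holo_const]. apply holo_mult; [apply holo_const|].
    apply (csum_holo (fun k w => cexp (- w * clog1 (INR (S k) / INR (N * m))) *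
                     e (RtoC (- (INR u * INR (S k) / INR N))))%C). intros k _.
    apply holo_mult; [|apply holo_const]. apply (holo_comp cexp); [|apply holo_cexp].
    apply holo_mult; [|apply holo_const]. apply holo_opp, holo_id.
Qed.

Lemma exp_type_regz m : exp_type (regz N u m).
Proof.
  unfold regz. apply exp_type_mult.
  - apply exp_type_ext with (fun w => cexp (RtoC (ln (INR m)) + (- RtoC (ln (INR m))) * w)%C).
    + intros w. unfold cpowR. f_equal. ring.
    + apply exp_type_cexp.
  - apply exp_type_plus; [|apply exp_type_const]. apply exp_type_mult; [apply exp_type_const|].
    apply (exp_type_csum (fun k w => cexp (- w * clog1 (INR (S k) / INR (N * m))) *
                     e (RtoC (- (INR u * INR (S k) / INR N))))%C). intros k.
    apply exp_type_mult; [|apply exp_type_const].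
    apply exp_type_ext with (fun w => cexp (0 + (- clog1 (INR (S k) / INR (N * m))) * w)%C).
    + intros w. f_equal. ring.
    + apply exp_type_cexp.
Qed.

(** The sum of the constants of [regz_left] and [regz_right], valid on both edges of the strip. *)
Let c0 (S0 : R) := 4 + (96 * exp (S0 * ln (INR N)) * 24 + 1).

Lemma c0_ge S0 : 4 <= c0 S0 /\ 96 * exp (S0 * ln (INR N)) * 24 + 1 <= c0 S0.
Proof. unfold c0. assert (h := exp_pos (S0 * ln (INR N))). lra. Qed.

(** Neither limit is available inside the strip, but a difference of two regularised sums is small
    on both edges, where each sum is close to a common limit. The maximum principle carries the
    smallness inwards. *)
Lemma regz_strip S0 m m' w : 3 <= S0 -> (1 <= m)%nat -> (1 <= m')%nat -> Rabs (Re w) <= S0 ->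
  Cmod (gauss_weight w * (regz N u m w - regz N u m' w)) <=
   c0 S0 * exp (30 * (S0 * S0) + 10) * (/ INR m + / INR m').
Proof.
  intros hS hm hm' hw.
  destruct (c0_ge S0) as [hc1 hc2].
  assert (him : 0 < / INR m) by (apply inv_INR_pos; lia).
  assert (him' : 0 < / INR m') by (apply inv_INR_pos; lia).
  set (K := exp (30 * (S0 * S0) + 10)). assert (hK : 0 < K) by apply exp_pos.
  set (eps := c0 S0 * K * (/ INR m + / INR m')).
  assert (heps : 0 < eps) by (unfold eps; repeat apply Rmult_lt_0_compat; lra).
  revert w hw. apply three_lines; auto; try lra.
  - intros z. apply holo_mult; [apply holo_gauss_weight|].
    apply holo_minus; apply holo_regz.
  - intros z hz. rewrite Cmod_mult, Cmod_gauss_weight.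
    assert (hz2 : Re z * Re z = S0 * S0).
    { rewrite <- hz. rewrite <- Rabs_mult, Rabs_pos_eq; [auto|nra]. }
    assert (hd : Cmod (regz N u m z - regz N u m' z) <= c0 S0 * growth z * (/ INR m + / INR m')).
    { assert (hg := growth_pos z).
      assert (key : exists l, forall m, (1 <= m)%nat -> Cmod (regz N u m z - l) <= c0 S0 * growth z / INR m).
      { destruct (Rle_lt_dec 0 (Re z)) as [h|h].
        - rewrite Rabs_pos_eq in hz by auto.
          destruct (regz_right N u hN z ltac:(lra)) as [l [_ hl]]. exists l. intros m0 hm0.
          eapply Rle_trans; [apply hl; auto|]. rewrite hz. unfold Rdiv.
          apply Rmult_le_compat_r; [apply Rlt_le, inv_INR_pos; lia|].
          apply Rmult_le_compat_r; lra.
        - rewrite Rabs_left in hz by auto.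
          destruct (regz_left N u hN hu z ltac:(lra)) as [l [_ hl]]. exists l. intros m0 hm0.
          eapply Rle_trans; [apply hl; auto|]. unfold Rdiv.
          apply Rmult_le_compat_r; [apply Rlt_le, inv_INR_pos; lia|].
          apply Rmult_le_compat_r; lra. }
      destruct key as [l hl]. assert (a1 := hl m hm). assert (a2 := hl m' hm').
      eapply Rle_trans; [apply (Cmod_sub_tri _ l)|]. rewrite (Cmod_sub_sym l). unfold Rdiv in *. lra. }
    (* With y = [Im z], the exponents 20 (S0^2 - y^2) and 10 (1 + S0^2 + y^2) add up to at most 30
       S0^2 + 10. *)
    assert (hWg : exp (20 * (Re z * Re z - Im z * Im z)) * growth z <= K).
    { unfold growth. rewrite <- exp_plus. apply exp_le. rewrite Cmod_sq, hz2. nra. }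
    eapply Rle_trans; [apply Rmult_le_compat_l; [left; apply exp_pos|exact hd]|].
    replace (exp (20 * (Re z * Re z - Im z * Im z)) * (c0 S0 * growth z * (/ INR m + / INR m'))) with
     (c0 S0 * (exp (20 * (Re z * Re z - Im z * Im z)) * growth z) * (/ INR m + / INR m')) by ring.
    unfold eps. apply Rmult_le_compat_r; [lra|]. apply Rmult_le_compat_l; lra.
  (* For large |y| the decay exp(-20 y^2) outweighs exponential type and even pushes the product
     below [eps]; [A0] gathers all terms that do not grow with y. *)
  - destruct (exp_type_plus _ _ (exp_type_regz m) (exp_type_mult _ _ (exp_type_const (- (1))%C) (exp_type_regz m'))) as [c [hc h]].
    set (A0 := 20 * (S0 * S0) + c * (1 + S0) + Rabs (ln eps)).
    assert (hA0 : 0 <= A0) by (unfold A0; assert (h1 := Rabs_pos (ln eps)); nra).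
    exists (1 + A0 + c). intros z hz1 hz2. rewrite Cmod_mult, Cmod_gauss_weight.
    specialize (h z). cbv beta in h.
    replace (regz N u m z + - (1) * regz N u m' z)%C with (regz N u m z - regz N u m' z)%C in h by ring.
    eapply Rle_trans; [apply Rmult_le_compat_l; [left; apply exp_pos|exact h]|].
    rewrite <- exp_plus, <- (exp_ln eps) by auto. apply exp_le.
    assert (hln := Rle_abs (- ln eps)). rewrite Rabs_Ropp in hln.
    assert (hzm := Cmod_le_abs z).
    assert (r2 : Re z * Re z <= S0 * S0).
    { replace (Re z * Re z) with (Rabs (Re z) * Rabs (Re z)) by (rewrite <- Rabs_mult, Rabs_pos_eq; [auto|nra]).
      assert (h1 := Rabs_pos (Re z)). nra. }
    assert (i2 : Im z * Im z = Rabs (Im z) * Rabs (Im z)) by (rewrite <- Rabs_mult, Rabs_pos_eq; [auto|nra]).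
    rewrite i2. set (y := Rabs (Im z)) in *.
    assert (h3 : c * (1 + Cmod z) <= c * (1 + S0) + c * y) by nra.
    assert (h4 : A0 + c * y <= 20 * (y * y)) by nra.
    unfold A0 in h4. lra.
Qed.

(** On the disc the modulus of the weight is at least exp(-20 S0^2); removing it turns the 30 into
    50. *)
Lemma regz_ball S0 m m' w : 3 <= S0 -> (1 <= m)%nat -> (1 <= m')%nat -> Cmod w <= S0 ->
  Cmod (regz N u m w - regz N u m' w) <=
   c0 S0 * exp (50 * (S0 * S0) + 10) * (/ INR m + / INR m').
Proof.
  intros hS hm hm' hw.
  assert (h := regz_strip S0 m m' w hS hm hm' (Rle_trans _ _ _ (re_le_Cmod w) hw)).
  rewrite Cmod_mult, Cmod_gauss_weight in h.
  set (D := Cmod (regz N u m w - regz N u m' w)) in *. assert (hD : 0 <= D) by apply Cmod_ge_0.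
  assert (hq := Cmod_sq w). assert (hw0 := Cmod_ge_0 w).
  assert (he : exp (- (20 * (S0 * S0))) <= exp (20 * (Re w * Re w - Im w * Im w))) by (apply exp_le; nra).
  apply Rmult_le_reg_l with (exp (- (20 * (S0 * S0)))); [apply exp_pos|].
  eapply Rle_trans; [apply Rmult_le_compat_r; [auto|exact he]|]. eapply Rle_trans; [exact h|]. right.
  replace (30 * (S0 * S0) + 10) with (- (20 * (S0 * S0)) + (50 * (S0 * S0) + 10)) by ring.
  rewrite exp_plus. ring.
Qed.

Lemma regz_cv w : exists l, clim (fun m => regz N u m w) l.
Proof.
  apply clim_cauchy. intros e he.
  set (S0 := Rmax 3 (Cmod w)).
  set (B := c0 S0 * exp (50 * (S0 * S0) + 10)).
  destruct (rate_archi (2 * B) e he) as [n0 [h1 h0]].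
  exists n0. intros n m hn hm. eapply Rle_lt_trans; [|apply (h0 n0 (le_n _))].
  eapply Rle_trans; [apply (regz_ball S0); [apply Rmax_l|lia|lia|apply Rmax_r]|]. fold B.
  assert (hB : 0 < B) by (unfold B; destruct (c0_ge S0); apply Rmult_lt_0_compat; [lra|apply exp_pos]).
  assert (hp : 0 < INR n0) by (apply lt_0_INR; lia).
  assert (/ INR n <= / INR n0) by (apply Rinv_le_contravar; auto; now apply le_INR).
  assert (/ INR m <= / INR n0) by (apply Rinv_le_contravar; auto; now apply le_INR).
  unfold Rdiv. nra.
Qed.

Definition regzeta (w : C) : C := proj1_sig (constructive_indefinite_description _ (regz_cv w)).

Lemma regzeta_lim w : clim (fun m => regz N u m w) (regzeta w).
Proof. exact (proj2_sig (constructive_indefinite_description _ (regz_cv w))). Qed.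

Lemma holo_regzeta z : holo regzeta z.
Proof.
  apply (holo_unif_lim (fun n => regz N u (S n))).
  - intros; apply holo_regz.
  - intros S1 eps heps. set (S0 := Rmax 3 S1).
    set (B := c0 S0 * exp (50 * (S0 * S0) + 10)).
    assert (hB : 0 < B) by (unfold B; destruct (c0_ge S0); apply Rmult_lt_0_compat; [lra|apply exp_pos]).
    destruct (rate_archi (2 * B) eps heps) as [n0 [h1 h0]].
    exists n0. intros n hn w hw. rewrite Cmod_sub_sym.
    apply (clim_le_dist (fun m => regz N u m w)); [apply regzeta_lim|].
    exists (S n). intros m hm. eapply Rle_trans; [|left; apply (h0 (S n)); lia].
    eapply Rle_trans; [apply (regz_ball S0); [apply Rmax_l|lia|lia|]|].
    + eapply Rle_trans; [exact hw|apply Rmax_r].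
    + fold B. assert (hp : 0 < INR (S n)) by (apply lt_0_INR; lia).
      assert (/ INR m <= / INR (S n)) by (apply Rinv_le_contravar; auto; now apply le_INR).
      unfold Rdiv. nra.
Qed.

Lemma regzeta_left w : Re w <= -1 -> clim (fun Y => rgam w * zpart N u w Y)%C (regzeta w).
Proof.
  intros hw. destruct (regz_left N u hN hu w hw) as [l [h1 h2]].
  replace (regzeta w) with l; auto. apply (clim_unique (fun m => regz N u m w)); [|apply regzeta_lim].
  now apply clim_of_rate with (4 * growth w).
Qed.

Lemma regzeta_right w : 3 <= Re w -> clim (csum (dual N u w)) (regzeta w).
Proof.
  intros hw. destruct (regz_right N u hN w hw) as [l [h1 h2]].
  replace (regzeta w) with l; auto. apply (clim_unique (fun m => regz N u m w)); [|apply regzeta_lim].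
  eapply clim_of_rate. exact h2.
Qed.

End Entire.

(** * From a single series to a double series over squares *)

(** * Dirichlet convolutions and residue classes *)

Lemma is_series_clim (a : nat -> C) (l : C) :
  @is_series C_AbsRing C_NormedModule a l -> clim (csum a) l.
Proof.
  intros h.
  assert (hs : forall n, sum_n (G := C_AbelianMonoid) a n = csum a (S n)).
  { induction n; [rewrite sum_O; simpl; ring|]. rewrite sum_Sn, IHn. reflexivity. }
  intros e he.
  assert (h1 := proj1 (filterlim_locally (U := C_NormedModule) _ _) h (mkposreal (e / 2) ltac:(lra))).
  destruct h1 as [n0 h1]. exists (S n0). intros n hn. destruct n as [|n]; [lia|].
  specialize (h1 n ltac:(lia)).
  rewrite <- hs. set (z := sum_n (G := C_AbelianMonoid) a n) in *.
  destruct h1 as [b1 b2].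
  assert (c1 : Rabs (Re z - Re l) < e / 2) by exact b1.
  assert (c2 : Rabs (Im z - Im l) < e / 2) by exact b2.
  eapply Rle_lt_trans; [apply Cmod_le_abs|].
  change (Rabs (Re z - Re l) + Rabs (Im z - Im l) < e). lra.
Qed.

Lemma fold_seq_csum (f : nat -> C) a n :
  fold_right Cplus (RtoC 0) (map f (seq a n)) = csum (fun k => f (a + k)%nat) n.
Proof.
  revert a. induction n; intros a; [reflexivity|].
  rewrite csum_first, Nat.add_0_r. simpl. rewrite IHn. f_equal. apply csum_ext.
  intros k _. f_equal. lia.
Qed.

Lemma csum_hyperbola (F : nat -> nat -> C) X :
  csum (fun n => csum (fun k => if (S n mod S k =? 0)%nat then F (S k) (S n / S k)%nat else 0) (S n)) X =
  csum (fun i => csum (fun j => F (S i) (S j)) (X / S i)) X.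
Proof.
  rewrite (csum_ext _ (fun n => csum (fun k => if (S n mod S k =? 0)%nat then F (S k) (S n / S k)%nat else 0) X)).
  2:{ intros n hn. symmetry. apply csum_stable; [lia|]. intros k hk.
      rewrite Nat.mod_small by lia. reflexivity. }
  rewrite csum_swap. apply csum_ext. intros i _.
  (* [csum_multiples] also counts the multiple 0, so the summand is set to 0 there before the
     leading terms are dropped. *)
  assert (h := csum_multiples (fun q => match q with O => RtoC 0 | S _ => F (S i) q end) (S i) X ltac:(lia)).
  rewrite !csum_first, Nat.Div0.mod_0_l, Nat.Div0.div_0_l in h. rewrite !Cplus_0_l in h. rewrite <- h.
  apply csum_ext. intros n _. destruct (Nat.eqb_spec (S n mod S i) 0) as [h0|]; auto.
  assert (h1 := Nat.div_mod_eq (S n) (S i)). destruct (S n / S i)%nat eqn:E; [lia|reflexivity].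
Qed.

(** The partial sums of the single series cover the region i j <= X. Completing row i to the full
    square costs B i^(-3) times a tail beyond X/i, of order i/X; the cube leaves a summable
    i^(-2)/X. *)
Lemma hyperbola_limit (F : nat -> nat -> C) B l : 0 <= B ->
  (forall i j, Cmod (F (S i) (S j)) <= B * (/ INR (S i)) ^ 3 * (/ INR (S j) * / INR (S j))) ->
  clim (csum (fun n => csum (fun k => if (S n mod S k =? 0)%nat then F (S k) (S n / S k)%nat else 0) (S n))) l ->
  clim (fun X => csum (fun i => csum (fun j => F (S i) (S j)) X) X) l.
Proof.
  intros hB hF hl.
  set (V := fun X => csum (fun i => csum (fun j => F (S i) (S j)) (X / S i)) X).
  assert (hV : clim V l).
  { eapply clim_ext_ev with (n0 := O); [|exact hl]. intros X _. apply csum_hyperbola. }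
  assert (hd : clim (fun X => csum (fun i => csum (fun j => F (S i) (S j)) X - csum (fun j => F (S i) (S j)) (X / S i))%C X) 0).
  { apply clim_of_rate with (8 * B). intros X hX.
    cbv beta. unfold Cminus at 1. rewrite Copp_0, Cplus_0_r.
    assert (hXp : 1 <= INR X) by (apply INR_ge1; lia).
    replace (8 * B / INR X) with (2 * (4 * B / INR X)) by (field; lra).
    assert (hBX : 0 <= 4 * B / INR X) by (apply Rdiv_le_0_compat; lra).
    apply csum_sq_bound; [auto|]. intros i hi.
    assert (hip := INR_S_ge1 i). assert (hii : 0 < / INR (S i)) by (apply Rinv_0_lt_compat; lra).
    set (J := (X / S i)%nat).
    assert (hJ1 : (1 <= J)%nat) by (apply Nat.div_le_lower_bound; lia).
    assert (hJX : (J <= X)%nat) by (apply Nat.Div0.div_le_upper_bound; nia).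
    (* The factor 2 makes up for rounding X/i down, the quotient being at least 1. *)
    assert (hJ2 : INR X <= 2 * INR (S i) * INR J).
    { replace 2 with (INR 2) by reflexivity. rewrite <- !mult_INR. apply le_INR.
      assert (h1 := Nat.div_mod_eq X (S i)). assert (h2 := Nat.mod_upper_bound X (S i) ltac:(lia)). fold J in h1. nia. }
    assert (hJp : 1 <= INR J) by (apply INR_ge1; lia).
    set (M := B * (/ INR (S i)) ^ 3).
    assert (hM : 0 <= M) by (apply Rmult_le_pos; [auto|apply pow_le; lra]).
    eapply Rle_trans.
    - apply (telescope_bound (csum (fun j => F (S i) (S j))) M J X); auto. intros j hj.
      cbn [csum]. replace (csum (fun j => F (S i) (S j)) j + F (S i) (S j) - csum (fun j => F (S i) (S j)) j)%C
        with (F (S i) (S j)) by ring. eapply Rle_trans; [apply hF|]. fold M.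
      assert (hj1 : 1 <= INR j) by (apply INR_ge1; lia).
      assert (hjs := INR_S_ge1 j). assert (0 < / INR (S j)) by (apply Rinv_0_lt_compat; lra).
      assert (/ INR (S j) <= / INR j) by (apply Rinv_le_contravar; [lra|rewrite S_INR; lra]).
      apply Rmult_le_compat_l; auto. nra.
    - assert (0 < / INR X) by (apply Rinv_0_lt_compat; lra).
      apply Rle_trans with (M * (2 * / INR J)); [apply Rmult_le_compat_l; lra|].
      assert (hiJ : / INR J <= 2 * INR (S i) * / INR X).
      { apply Rmult_le_reg_r with (INR J * INR X); [nra|].
        replace (/ INR J * (INR J * INR X)) with (INR X) by (field; lra).
        replace (2 * INR (S i) * / INR X * (INR J * INR X)) with (2 * INR (S i) * INR J) by (field; lra). auto. }
      apply Rle_trans with (M * (2 * (2 * INR (S i) * / INR X))); [apply Rmult_le_compat_l; lra|].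
      right. unfold M. field. lra. }
  assert (h := clim_plus _ _ _ _ hV hd). rewrite Cplus_0_r in h.
  eapply clim_ext_ev with (n0 := O); [|exact h]. intros X _. cbv beta. unfold V.
  rewrite <- csum_plus. apply csum_ext. intros; ring.
Qed.

Lemma csum_pick (f : nat -> C) r n : (r < n)%nat -> csum (fun u => indic (r =? u)%nat * f u)%C n = f r.
Proof.
  intros hr. rewrite (csum_stable _ (S r) n); [|lia|].
  - cbn [csum]. rewrite Nat.eqb_refl, (csum_ext _ (fun _ => RtoC 0)), csum_0; [simpl; ring|].
    intros k hk. destruct (Nat.eqb_spec r k); [lia|simpl; ring].
  - intros k hk. destruct (Nat.eqb_spec r k); [lia|simpl; ring].
Qed.

(** A coefficient depending only on residue classes splits a sum over a square into products of
    one-variable sums. The region i j <= X would not split in this way. *)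
Lemma csum_residues (N : nat) (phi : nat -> nat -> C) (a b : nat -> C) X : (1 <= N)%nat ->
  csum (fun u => csum (fun v => phi u v * (csum (fun i => indic (S i mod N =? u)%nat * a i) X *
      csum (fun j => indic (S j mod N =? v)%nat * b j) X)) N)%C N =
  csum (fun i => csum (fun j => phi (S i mod N)%nat (S j mod N)%nat * (a i * b j)) X)%C X.
Proof.
  intros hN.
  transitivity (csum (fun u => csum (fun v => csum (fun i => csum (fun j =>
     indic (S i mod N =? u)%nat * (indic (S j mod N =? v)%nat * (phi u v * (a i * b j)))) X) X) N) N)%C.
  { apply csum_ext; intros u _. apply csum_ext; intros v _.
    rewrite Cmult_assoc, (Cmult_comm (phi u v)), <- Cmult_assoc, (Cmult_comm (csum _ X)), <- csum_scal.
    apply csum_ext; intros i _. rewrite Cmult_comm, Cmult_assoc, <- csum_scal. apply csum_ext; intros j _. ring. }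
  transitivity (csum (fun i => csum (fun j => csum (fun u => csum (fun v =>
     indic (S i mod N =? u)%nat * (indic (S j mod N =? v)%nat * (phi u v * (a i * b j)))) N) N) X) X)%C.
  { apply csum_swap_pairs. }
  apply csum_ext; intros i _. apply csum_ext; intros j _.
  rewrite (csum_ext _ (fun u => indic (S i mod N =? u)%nat * (phi u (S j mod N)%nat * (a i * b j)))%C).
  - rewrite (csum_pick (fun u => phi u (S j mod N)%nat * (a i * b j))%C); auto.
    apply Nat.mod_upper_bound. lia.
  - intros u _. rewrite csum_scal. f_equal.
    rewrite (csum_pick (fun v => phi u v * (a i * b j))%C); auto.
    apply Nat.mod_upper_bound. lia.
Qed.

Definition eN (N : nat) (z : Z) : C := e (RtoC (IZR z / INR N)).

Section AdditiveCharacter.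
Variable N : nat.
Hypothesis hN : (1 <= N)%nat.

Lemma INR_N_pos : 0 < INR N.
Proof. apply lt_0_INR. lia. Qed.

Lemma eN_plus a b : eN N (a + b) = (eN N a * eN N b)%C.
Proof.
  unfold eN. rewrite <- e_plus, <- RtoC_plus, plus_IZR. do 2 f_equal. field.
  assert (h := INR_N_pos). lra.
Qed.

Lemma eN_mod a b : (a mod Z.of_nat N = b mod Z.of_nat N)%Z -> eN N a = eN N b.
Proof.
  intros h. assert (hp := INR_N_pos).
  assert (h1 := Z.div_mod a (Z.of_nat N) ltac:(lia)). assert (h2 := Z.div_mod b (Z.of_nat N) ltac:(lia)).
  set (c := (a / Z.of_nat N - b / Z.of_nat N)%Z).
  assert (hc : a = (b + Z.of_nat N * c)%Z) by (unfold c; lia).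
  rewrite hc, eN_plus. unfold eN at 2. rewrite mult_IZR, <- INR_IZR_INZ.
  replace (INR N * IZR c / INR N) with (IZR c) by (field; lra). rewrite e_IZR. ring.
Qed.

Lemma eN_orthogonality d : csum (fun k => eN N (Z.of_nat k * d)) N = (RtoC (INR N) * indic (d mod Z.of_nat N =? 0)%Z)%C.
Proof.
  rewrite <- e_orthogonality by auto. apply csum_ext. intros k _. unfold eN.
  rewrite mult_IZR, <- INR_IZR_INZ. reflexivity.
Qed.

Lemma Cmod_eN z : Cmod (eN N z) = 1.
Proof. apply Cmod_e_R. Qed.

End AdditiveCharacter.

(** * Dirichlet characters and the Estermann double series *)

Section Character.
Variables (q : Z) (psi : Z -> C).
Hypothesis hpsi : dirichlet_char q psi.

Lemma psi_mult a b : psi (a * b)%Z = (psi a * psi b)%C.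
Proof. apply hpsi. Qed.

Lemma psi_add_mult a c : psi (a + c * q)%Z = psi a.
Proof.
  destruct hpsi as [hq [_ [_ [hper _]]]].
  assert (hn : forall (n : nat) a, psi (a + Z.of_nat n * q)%Z = psi a).
  { induction n; intros a0; [f_equal; lia|]. rewrite <- (IHn a0), <- (hper (a0 + Z.of_nat n * q)%Z).
    f_equal. lia. }
  destruct (Z_le_dec 0 c) as [h|h].
  - rewrite <- (Z2Nat.id c h). apply hn.
  - rewrite <- (hn (Z.to_nat (- c)) (a + c * q)%Z). f_equal. lia.
Qed.

Lemma psi_mod N a b : (q | N)%Z -> N <> 0%Z -> (a mod N = b mod N)%Z -> psi a = psi b.
Proof.
  intros [c hc] hN h. assert (h1 := Z.div_mod a N hN). assert (h2 := Z.div_mod b N hN).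
  replace a with (b + ((a / N - b / N) * c) * q)%Z; [apply psi_add_mult|].
  rewrite <- Z.mul_assoc, <- hc. lia.
Qed.

Lemma psi_bounded : exists B, 0 <= B /\ forall a, Cmod (psi a) <= B.
Proof.
  assert (hq : (0 < q)%Z) by apply hpsi.
  assert (h : forall n : nat, exists B, 0 <= B /\ forall k, (k < n)%nat -> Cmod (psi (Z.of_nat k)) <= B).
  { induction n as [|n [B [hB h]]]; [exists 0; split; [lra|intros; lia]|].
    exists (B + Cmod (psi (Z.of_nat n))). assert (h1 := Cmod_ge_0 (psi (Z.of_nat n))). split; [lra|].
    intros k hk. destruct (Nat.eq_dec k n) as [->|hne]; [lra|]. specialize (h k ltac:(lia)). lra. }
  destruct (h (Z.to_nat q)) as [B [hB hb]]. exists B. split; auto. intros a.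
  assert (hm := Z.mod_pos_bound a q hq).
  rewrite (psi_mod q a (Z.of_nat (Z.to_nat (a mod q)))).
  - apply hb. lia.
  - apply Z.divide_refl.
  - lia.
  - rewrite Z2Nat.id by lia. symmetry. apply Z.mod_mod. lia.
Qed.

Variables (N : nat) (xi : C).
Hypothesis hN : (1 <= N)%nat.
Hypothesis hqN : (q | Z.of_nat N)%Z.

(** Square partial sums of the Estermann series, with i the divisor carrying the character and j the
    cofactor. *)
Definition est_double (a : Z) (s : C) (X : nat) : C :=
  csum (fun i => csum (fun j => psi (Z.of_nat (S i)) * eN N (a * Z.of_nat (S i) * Z.of_nat (S j)) *
     (cpowR (INR (S i)) (xi - s) * cpowR (INR (S j)) (- s))) X)%C X.

Lemma est_coeff_divisors a s n :
  (est_coeff psi xi a (Z.of_nat N) (S n) * cpowR (INR (S n)) (- s))%C =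
  csum (fun k => if (S n mod S k =? 0)%nat then
    psi (Z.of_nat (S k)) * eN N (a * Z.of_nat (S k) * Z.of_nat (S n / S k)) *
     (cpowR (INR (S k)) (xi - s) * cpowR (INR (S n / S k)) (- s)) else 0)%C (S n).
Proof.
  unfold est_coeff, sigma_tw. rewrite fold_seq_csum.
  match goal with |- (?A * ?B * ?D)%C = _ => transitivity ((B * D) * A)%C; [ring|] end.
  rewrite <- csum_scal. apply csum_ext. intros k _. cbn [Nat.add].
  destruct (Nat.eqb_spec (S n mod S k) 0) as [h|h]; [|ring].
  assert (h1 := Nat.div_mod_eq (S n) (S k)). rewrite h, Nat.add_0_r in h1.
  set (m := (S n / S k)%nat) in *. assert (hm : (1 <= m)%nat) by nia.
  assert (he : e (RtoC (IZR a * INR (S n) / IZR (Z.of_nat N))) = eN N (a * Z.of_nat (S k) * Z.of_nat m)).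
  { unfold eN. rewrite <- INR_IZR_INZ. do 3 f_equal. rewrite h1, !mult_IZR, mult_INR, <- !INR_IZR_INZ. ring. }
  rewrite he, h1, mult_INR, cpowR_mult by (apply lt_0_INR; lia).
  unfold Cminus. rewrite cpowR_plus. ring.
Qed.

Lemma estermann_double a D : estermann_continuation psi xi a (Z.of_nat N) D ->
  exists R0, forall s, R0 < Re s -> clim (est_double a s) (D s).
Proof.
  intros [_ [s0 hs]]. exists (Rmax s0 (Rmax 2 (Re xi + 3))). intros s hR.
  assert (m1 := Rmax_l s0 (Rmax 2 (Re xi + 3))). assert (m2 := Rmax_r s0 (Rmax 2 (Re xi + 3))).
  assert (m3 := Rmax_l 2 (Re xi + 3)). assert (m4 := Rmax_r 2 (Re xi + 3)).
  specialize (hs s ltac:(lra)). apply is_series_clim in hs.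
  destruct psi_bounded as [B [hB hb]].
  apply (hyperbola_limit (fun i j => psi (Z.of_nat i) * eN N (a * Z.of_nat i * Z.of_nat j) *
     (cpowR (INR i) (xi - s) * cpowR (INR j) (- s)))%C B); auto.
  - intros i j. rewrite !Cmod_mult, Cmod_eN, Rmult_1_r, Rmult_assoc.
    apply Rmult_le_compat; [apply Cmod_ge_0| |apply hb|].
    + apply Rmult_le_pos; apply Cmod_ge_0.
    + apply Rmult_le_compat; [apply Cmod_ge_0|apply Cmod_ge_0| |].
      * rewrite Cmod_cpowR. apply INR_pow_le; [lia|]. change (Re (xi - s)) with (Re xi - Re s). simpl (INR 3). lra.
      * apply cpowR_sq_bound. change (Re (- s)) with (- Re s). lra.
  - eapply clim_ext_ev with (n0 := O); [|exact hs]. intros X _. apply csum_ext. intros n _.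
    apply est_coeff_divisors.
Qed.

(** * The bridge between both sides of the functional equation *)

(** [regzeta] takes a proof of [u < N], while [csum] needs a function of all naturals; the value 0
    is never met in sums over u < N. *)
Definition regzeta_ext (u : nat) (w : C) : C :=
  match lt_dec u N with left hu => regzeta N u hN hu w | right _ => RtoC 0 end.

Lemma holo_regzeta_ext u z : holo (regzeta_ext u) z.
Proof.
  unfold regzeta_ext. destruct (lt_dec u N); [apply holo_regzeta|apply holo_const].
Qed.

Lemma regzeta_ext_left u w : (u < N)%nat -> Re w <= -1 -> clim (fun X => rgam w * zpart N u w X)%C (regzeta_ext u w).
Proof. intros hu hw. unfold regzeta_ext. destruct (lt_dec u N); [now apply regzeta_left|lia]. Qed.

Lemma regzeta_ext_right u w : (u < N)%nat -> 3 <= Re w -> clim (csum (dual N u w)) (regzeta_ext u w).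
Proof. intros hu hw. unfold regzeta_ext. destruct (lt_dec u N); [now apply regzeta_right|lia]. Qed.

Variables (h hbar : Z).
Hypothesis hinv : ((h * hbar) mod Z.of_nat N = 1 mod Z.of_nat N)%Z.

Definition bridge (s : C) : C :=
  csum (fun u => csum (fun v => psi (Z.of_nat u) * eN N (h * Z.of_nat u * Z.of_nat v) *
     (regzeta_ext u (1 + xi - s) * regzeta_ext v (1 - s))) N)%C N.

Lemma holo_bridge s : holo bridge s.
Proof.
  apply (csum_holo (fun u s => csum (fun v => psi (Z.of_nat u) * eN N (h * Z.of_nat u * Z.of_nat v) *
     (regzeta_ext u (1 + xi - s) * regzeta_ext v (1 - s))) N)%C). intros u _.
  apply (csum_holo (fun v s => psi (Z.of_nat u) * eN N (h * Z.of_nat u * Z.of_nat v) *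
     (regzeta_ext u (1 + xi - s) * regzeta_ext v (1 - s)))%C). intros v _.
  apply holo_mult; [apply holo_const|].
  apply holo_mult; (apply (holo_comp (regzeta_ext _)); [|apply holo_regzeta_ext]);
  apply holo_minus; try apply holo_const; apply holo_id.
Qed.

(** The exponents are w1 - 1 = xi - s and w2 - 1 = - s, those of divisor and cofactor, so
    recombining the residue classes gives [est_double]. The two bounds on [Re s] place both
    arguments in the half-plane [Re w <= -1]. *)
Lemma bridge_right s l : Re s >= 2 -> Re s >= Re xi + 2 -> clim (est_double h s) l ->
  bridge s = (rgam (1 + xi - s) * rgam (1 - s) * l)%C.
Proof.
  intros h1 h2 hl. set (w1 := (1 + xi - s)%C). set (w2 := (1 - s)%C).
  assert (hw1 : Re w1 <= -1) by (change (Re w1) with (1 + Re xi - Re s); lra).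
  assert (hw2 : Re w2 <= -1) by (change (Re w2) with (1 - Re s); lra).
  apply (clim_unique (fun X => csum (fun u => csum (fun v => psi (Z.of_nat u) * eN N (h * Z.of_nat u * Z.of_nat v) *
     ((rgam w1 * zpart N u w1 X) * (rgam w2 * zpart N v w2 X))) N)%C N)).
  - apply (csum_clim (fun X u => csum (fun v => psi (Z.of_nat u) * eN N (h * Z.of_nat u * Z.of_nat v) *
     ((rgam w1 * zpart N u w1 X) * (rgam w2 * zpart N v w2 X))) N)%C). intros u hu.
    apply (csum_clim (fun X v => psi (Z.of_nat u) * eN N (h * Z.of_nat u * Z.of_nat v) *
     ((rgam w1 * zpart N u w1 X) * (rgam w2 * zpart N v w2 X)))%C). intros v hv.
    apply clim_scal. apply clim_mult; apply regzeta_ext_left; auto.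
  - eapply clim_ext_ev with (n0 := O); [|apply (clim_scal (rgam w1 * rgam w2)), hl].
    intros X _. cbv beta. unfold est_double.
    assert (hr := csum_residues N (fun u v => psi (Z.of_nat u) * eN N (h * Z.of_nat u * Z.of_nat v))%C
      (fun i => cpowR (INR (S i)) (w1 - 1)) (fun j => cpowR (INR (S j)) (w2 - 1)) X hN).
    cbv beta in hr. symmetry.
    transitivity (rgam w1 * rgam w2 * csum (fun u => csum (fun v => psi (Z.of_nat u) * eN N (h * Z.of_nat u * Z.of_nat v) *
       (zpart N u w1 X * zpart N v w2 X)) N) N)%C.
    { rewrite <- csum_scal. apply csum_ext; intros u _. rewrite <- csum_scal. apply csum_ext; intros v _. ring. }
    f_equal. unfold zpart. rewrite hr. apply csum_ext; intros i _. apply csum_ext; intros j _.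
    f_equal; [f_equal|f_equal].
    + apply (psi_mod (Z.of_nat N)); auto; [lia|]. rewrite Nat2Z.inj_mod. apply Z.mod_mod. lia.
    + apply eN_mod; auto. rewrite !Nat2Z.inj_mod.
      set (a := Z.of_nat (S i)). set (b := Z.of_nat (S j)). set (NZ := Z.of_nat N).
      rewrite Z.mul_mod_idemp_r by (unfold NZ; lia).
      replace (h * (a mod NZ) * b)%Z with (h * b * (a mod NZ))%Z by ring.
      rewrite Z.mul_mod_idemp_r by (unfold NZ; lia). f_equal. ring.
    + f_equal. unfold w1. ring.
    + f_equal. unfold w2. ring.
Qed.

(** [ep] and [de] are the signs of the two dual phases. Summing over v forces h u = -de j mod N,
    whose only solution is u = -de hbar j. The character thus moves from u to j, so that i and j
    exchange the roles of divisor and cofactor. *)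
Lemma character_sum (ep de : Z) (i j : Z) : (ep * ep = 1)%Z -> (de * de = 1)%Z ->
  csum (fun u => csum (fun v => psi (Z.of_nat u) * eN N (h * Z.of_nat u * Z.of_nat v) *
    (eN N (ep * (Z.of_nat u * i)) * eN N (de * (Z.of_nat v * j)))) N)%C N =
  (RtoC (INR N) * (psi (- de * hbar * j) * eN N (- (ep * de) * hbar * (i * j))))%C.
Proof.
  intros hep hde. set (NZ := Z.of_nat N). assert (hNZ : (0 < NZ)%Z) by (unfold NZ; lia).
  set (r := ((- de * hbar * j) mod NZ)%Z). assert (hr := Z.mod_pos_bound (- de * hbar * j) NZ hNZ). fold r in hr.
  assert (hrm : (r mod NZ = (- de * hbar * j) mod NZ)%Z) by (unfold r; apply Z.mod_mod; lia).
  assert (h1 : exists c, (h * hbar = 1 + c * NZ)%Z).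
  { assert (a1 := Z.div_mod (h * hbar) NZ ltac:(lia)). assert (a2 := Z.div_mod 1 NZ ltac:(lia)).
    exists ((h * hbar) / NZ - 1 / NZ)%Z. unfold NZ in *. lia. }
  destruct h1 as [c hc].
  assert (hr2 : exists c', r = (- de * hbar * j + c' * NZ)%Z).
  { assert (a1 := Z.div_mod (- de * hbar * j) NZ ltac:(lia)). exists (- ((- de * hbar * j) / NZ))%Z. unfold r. lia. }
  destruct hr2 as [c' hc'].
  rewrite (csum_ext _ (fun u => indic (Z.to_nat r =? u)%nat *
     (RtoC (INR N) * (psi (Z.of_nat u) * eN N (ep * (Z.of_nat u * i)))))%C).
  - rewrite csum_pick by (unfold NZ in *; lia). rewrite Z2Nat.id by lia. f_equal. f_equal.
    + apply (psi_mod NZ); auto. lia.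
    + apply eN_mod; auto. fold NZ.
      replace (ep * (r * i))%Z with (- (ep * de) * hbar * (i * j) + (ep * c' * i) * NZ)%Z by (rewrite hc'; ring).
      apply Z.mod_add. lia.
  - intros u hu.
    (* All dependence on v is gathered into one additive character, ready for orthogonality. *)
    rewrite (csum_ext _ (fun v => (psi (Z.of_nat u) * eN N (ep * (Z.of_nat u * i))) *
       eN N (Z.of_nat v * (h * Z.of_nat u + de * j)))%C).
    2:{ intros v _. replace (Z.of_nat v * (h * Z.of_nat u + de * j))%Z with
          (h * Z.of_nat u * Z.of_nat v + de * (Z.of_nat v * j))%Z by ring. rewrite eN_plus by auto. ring. }
    rewrite csum_scal, eN_orthogonality by auto. fold NZ.
    replace ((h * Z.of_nat u + de * j) mod NZ =? 0)%Z with (Z.to_nat r =? u)%nat; [ring|].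
    destruct (Nat.eqb_spec (Z.to_nat r) u) as [e1|e1]; symmetry.
    + apply Z.eqb_eq, Z.mod_divide; [lia|]. rewrite <- e1, Z2Nat.id, hc' by lia.
      exists (- de * j * c + h * c')%Z.
      replace (h * (- de * hbar * j + c' * NZ) + de * j)%Z with (- de * j * (h * hbar) + h * c' * NZ + de * j)%Z by ring.
      rewrite hc. ring.
    + apply Z.eqb_neq. intros h0. apply Z.mod_divide in h0; [|lia]. destruct h0 as [d hd].
      apply e1. apply Nat2Z.inj. rewrite Z2Nat.id by lia.
      rewrite <- (Z.mod_small (Z.of_nat u) NZ), <- (Z.mod_small r NZ) by (unfold NZ; lia).
      assert (hu2 : (Z.of_nat u = r + (hbar * d - c * Z.of_nat u - c') * NZ)%Z).
      { rewrite hc'. replace (- de * hbar * j + c' * NZ + (hbar * d - c * Z.of_nat u - c') * NZ)%Z with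
          (hbar * (d * NZ - de * j) - c * NZ * Z.of_nat u)%Z by ring. rewrite <- hd.
        replace (hbar * (h * Z.of_nat u + de * j - de * j) - c * NZ * Z.of_nat u)%Z with
          ((h * hbar - c * NZ) * Z.of_nat u)%Z by ring. rewrite hc. ring. }
      rewrite hu2 at 1. rewrite Z.mod_add by lia. reflexivity.
Qed.

End Character.

(** * The product of two dual series *)

Lemma e_half : e (RtoC (/ 2)) = (- (1))%C.
Proof.
  rewrite e_R. replace (2 * PI * / 2) with PI by field. rewrite cos_PI, sin_PI.
  apply Ceq; simpl; ring.
Qed.

Lemma e_opp_half : e (- RtoC (/ 2)) = (- (1))%C.
Proof.
  assert (h : (e (RtoC (/ 2)) * e (- RtoC (/ 2)) = 1)%C).
  { rewrite <- e_plus, <- e_0. f_equal. ring. }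
  rewrite e_half in h. transitivity (- (- (1) * e (- RtoC (/ 2))))%C; [ring|now rewrite h].
Qed.

Lemma RtoC4_neq0 : RtoC 4 <> 0.
Proof. apply RtoC_neq_0. lra. Qed.

Section Left.
Variables (q : Z) (psi : Z -> C).
Hypothesis hpsi : dirichlet_char q psi.
Variables (N : nat) (xi : C).
Hypothesis hN : (1 <= N)%nat.
Hypothesis hqN : (q | Z.of_nat N)%Z.
Variables (h hbar : Z).
Hypothesis hinv : ((h * hbar) mod Z.of_nat N = 1 mod Z.of_nat N)%Z.

Lemma dual_eN u w k : dual N u w k = (/ RtoC (INR N) * cpowR (2 * PI / INR N) (- w) * cpowR (INR (S k)) (- w) *
  (e (w / 4) * eN N (-1 * (Z.of_nat u * Z.of_nat (S k))) + e (- (w / 4)) * eN N (1 * (Z.of_nat u * Z.of_nat (S k)))))%C.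
Proof.
  assert (hNp : 0 < INR N) by (apply lt_0_INR; lia). assert (hk := INR_S_ge1 k). assert (hP := PI_RGT_0).
  unfold dual. replace (2 * PI * INR (S k) / INR N) with (2 * PI / INR N * INR (S k)) by (field; lra).
  rewrite cpowR_mult by (try apply Rdiv_lt_0_compat; lra).
  unfold eN. rewrite !mult_IZR, <- !INR_IZR_INZ.
  replace (-1 * (INR u * INR (S k)) / INR N) with (- (INR u * INR (S k) / INR N)) by (field; lra).
  replace (1 * (INR u * INR (S k)) / INR N) with (INR u * INR (S k) / INR N) by (field; lra). ring.
Qed.

(** Each dual series brings a factor 1/N and orthogonality returns one N. The remaining 1/N lowers
    the exponent of N from xi - 2s + 2 to xi - 2s + 1. *)
Lemma dual_constant s :
  (/ RtoC (INR N) * (cpowR (2 * PI / INR N) (- (1 + xi - s)) * cpowR (2 * PI / INR N) (- (1 - s))))%C =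
  (cpowR (2 * PI) (2 * s - xi - 2) * cpowR (INR N) (xi - 2 * s + 1))%C.
Proof.
  assert (hNp : 0 < INR N) by (apply lt_0_INR; lia). assert (hP := PI_RGT_0).
  rewrite <- cpowR_plus. replace (- (1 + xi - s) + - (1 - s))%C with (2 * s - xi - 2)%C by ring.
  unfold Rdiv at 1. rewrite cpowR_mult by (try apply Rinv_0_lt_compat; lra).
  assert (e1 : cpowR (/ INR N) (2 * s - xi - 2) = cpowR (INR N) (- (2 * s - xi - 2))).
  { unfold cpowR. rewrite ln_Rinv by auto. f_equal. rewrite RtoC_opp. ring. }
  assert (e2 : (/ RtoC (INR N))%C = cpowR (INR N) (- (1))).
  { rewrite cpowR_opp, cpowR_1_r by auto. reflexivity. }
  rewrite e1, e2. transitivity (cpowR (2 * PI) (2 * s - xi - 2) * (cpowR (INR N) (- (1)) * cpowR (INR N) (- (2 * s - xi - 2))))%C; [ring|].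
  rewrite <- cpowR_plus. do 2 f_equal. ring.
Qed.

(** Multiplying out two dual series gives four sign patterns. By [character_sum], opposite signs
    produce the phase of [hbar] and equal signs that of [- hbar]; each pair collapses to one
    Estermann series at 1 + xi - s. *)
Lemma bridge_left s l2 l3 : 3 <= 1 - Re s -> 3 <= 1 + Re xi - Re s ->
  clim (est_double psi N xi hbar (1 + xi - s)) l2 -> clim (est_double psi N xi (- hbar) (1 + xi - s)) l3 ->
  bridge psi N xi hN h s =
  (psi (- hbar)%Z * cpowR (2 * PI) (2 * s - xi - 2) * cpowR (INR N) (xi - 2 * s + 1) *
   ((e (xi / 4) + psi (-1)%Z * e (- (xi / 4))) * l2 -
    (e ((2 * s - xi) / 4) + psi (-1)%Z * e (- ((2 * s - xi) / 4))) * l3))%C.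
Proof.
  intros h2 h1 hl2 hl3. set (w1 := (1 + xi - s)%C) in *. set (w2 := (1 - s)%C).
  apply (clim_unique (fun X => csum (fun u => csum (fun v => psi (Z.of_nat u) * eN N (h * Z.of_nat u * Z.of_nat v) *
     (csum (dual N u w1) X * csum (dual N v w2) X)) N)%C N)).
  { apply (csum_clim (fun X u => csum (fun v => psi (Z.of_nat u) * eN N (h * Z.of_nat u * Z.of_nat v) *
     (csum (dual N u w1) X * csum (dual N v w2) X)) N)%C). intros u hu.
    apply (csum_clim (fun X v => psi (Z.of_nat u) * eN N (h * Z.of_nat u * Z.of_nat v) *
     (csum (dual N u w1) X * csum (dual N v w2) X))%C). intros v hv.
    apply clim_scal. apply clim_mult; apply regzeta_ext_right; auto. }
  set (a1 := e (w1 / 4)). set (b1 := e (- (w1 / 4))). set (a2 := e (w2 / 4)). set (b2 := e (- (w2 / 4))).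
  assert (h4 := RtoC4_neq0). assert (hc2 := RtoC2_neq0).
  assert (hh : (/ 2)%C = RtoC (/ 2)) by (rewrite RtoC_inv by lra; reflexivity).
  (* Opposite signs see w1 - w2 = xi. Equal signs see w1 + w2 = 2 + xi - 2s, and the 2 contributes
     e(1/2) or e(-1/2), both -1: this is the minus sign in front of the second bracket. *)
  assert (c1 : (a1 * b2)%C = e (xi / 4)).
  { unfold a1, b2. rewrite <- e_plus. f_equal. unfold w1, w2. field; auto. }
  assert (c2 : (b1 * a2)%C = e (- (xi / 4))).
  { unfold b1, a2. rewrite <- e_plus. f_equal. unfold w1, w2. field; auto. }
  assert (c3 : (b1 * b2)%C = (- e ((2 * s - xi) / 4))%C).
  { unfold b1, b2. rewrite <- e_plus.
    replace (- (w1 / 4) + - (w2 / 4))%C with ((2 * s - xi) / 4 + - RtoC (/ 2))%C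
      by (unfold w1, w2; rewrite <- hh; field; auto).
    rewrite e_plus, e_opp_half. ring. }
  assert (c4 : (a1 * a2)%C = (- e (- ((2 * s - xi) / 4)))%C).
  { unfold a1, a2. rewrite <- e_plus.
    replace (w1 / 4 + w2 / 4)%C with (- ((2 * s - xi) / 4) + RtoC (/ 2))%C
      by (unfold w1, w2; rewrite <- hh; field; auto).
    rewrite e_plus, e_half. ring. }
  set (K := (/ RtoC (INR N) * (cpowR (2 * PI / INR N) (- w1) * cpowR (2 * PI / INR N) (- w2)))%C).
  assert (hK : K = (cpowR (2 * PI) (2 * s - xi - 2) * cpowR (INR N) (xi - 2 * s + 1))%C) by apply dual_constant.
  assert (hlim := clim_scal (psi (- hbar)%Z * K)%C _ _ (clim_plus _ _ _ _
     (clim_scal (a1 * b2 + psi (-1)%Z * (b1 * a2))%C _ _ hl2) (clim_scal (b1 * b2 + psi (-1)%Z * (a1 * a2))%C _ _ hl3))).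
  rewrite c1, c2, c3, c4 in hlim.
  replace (psi (- hbar)%Z * cpowR (2 * PI) (2 * s - xi - 2) * cpowR (INR N) (xi - 2 * s + 1) *
   ((e (xi / 4) + psi (-1)%Z * e (- (xi / 4))) * l2 -
    (e ((2 * s - xi) / 4) + psi (-1)%Z * e (- ((2 * s - xi) / 4))) * l3))%C with
   (psi (- hbar)%Z * K * ((e (xi / 4) + psi (-1)%Z * e (- (xi / 4))) * l2 +
      (- e ((2 * s - xi) / 4) + psi (-1)%Z * - e (- ((2 * s - xi) / 4))) * l3))%C by (rewrite hK; ring).
  eapply clim_ext_ev with (n0 := O); [|exact hlim]. intros X _. cbv beta.
  rewrite <- c1, <- c2, <- c3, <- c4.
  assert (hNp : 0 < INR N) by (apply lt_0_INR; lia).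
  assert (hNC : RtoC (INR N) <> 0) by (apply RtoC_neq_0; lra).
  (* The order is exchanged because the dual index j is now the divisor; its exponent is xi - w1 = -
     w2. *)
  unfold est_double. rewrite (csum_swap _ X X). rewrite (csum_swap (fun i j => (psi (Z.of_nat (S i)) * eN N (- hbar * Z.of_nat (S i) * Z.of_nat (S j)) *
      (cpowR (INR (S i)) (xi - w1) * cpowR (INR (S j)) (- w1)))%C) X X).
  rewrite <- !csum_scal, <- csum_plus, <- csum_scal. symmetry.
  transitivity (csum (fun i => csum (fun j => csum (fun u => csum (fun v =>
     psi (Z.of_nat u) * eN N (h * Z.of_nat u * Z.of_nat v) * (dual N u w1 i * dual N v w2 j)) N) N) X) X)%C.
  { transitivity (csum (fun u => csum (fun v => csum (fun i => csum (fun j =>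
     psi (Z.of_nat u) * eN N (h * Z.of_nat u * Z.of_nat v) * (dual N u w1 i * dual N v w2 j)) X) X) N) N)%C.
    - apply csum_ext; intros u _. apply csum_ext; intros v _.
      rewrite (Cmult_comm (csum _ X)), <- csum_scal, <- csum_scal.
      apply csum_ext; intros i _. rewrite Cmult_comm, Cmult_comm, (Cmult_comm (csum _ X)), Cmult_assoc, <- csum_scal.
      apply csum_ext; intros j _. ring.
    - apply csum_swap_pairs. }
  apply csum_ext; intros i _. rewrite <- !csum_scal, <- csum_plus, <- csum_scal. apply csum_ext; intros j _.
  set (I := Z.of_nat (S i)). set (J := Z.of_nat (S j)).
  assert (cs := fun ep de => character_sum q psi hpsi N hN hqN h hbar hinv ep de I J).
  assert (s1 := cs (-1)%Z (-1)%Z eq_refl eq_refl). assert (s2 := cs (-1)%Z 1%Z eq_refl eq_refl).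
  assert (s3 := cs 1%Z (-1)%Z eq_refl eq_refl). assert (s4 := cs 1%Z 1%Z eq_refl eq_refl). clear cs.
  set (k1 := (/ RtoC (INR N) * cpowR (2 * PI / INR N) (- w1) * cpowR (INR (S i)) (- w1))%C).
  set (k2 := (/ RtoC (INR N) * cpowR (2 * PI / INR N) (- w2) * cpowR (INR (S j)) (- w2))%C).
  transitivity (k1 * k2 * ((a1 * a2) * csum (fun u => csum (fun v => psi (Z.of_nat u) * eN N (h * Z.of_nat u * Z.of_nat v) *
    (eN N (-1 * (Z.of_nat u * I)) * eN N (-1 * (Z.of_nat v * J)))) N) N +
    ((a1 * b2) * csum (fun u => csum (fun v => psi (Z.of_nat u) * eN N (h * Z.of_nat u * Z.of_nat v) *
    (eN N (-1 * (Z.of_nat u * I)) * eN N (1 * (Z.of_nat v * J)))) N) N +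
    ((b1 * a2) * csum (fun u => csum (fun v => psi (Z.of_nat u) * eN N (h * Z.of_nat u * Z.of_nat v) *
    (eN N (1 * (Z.of_nat u * I)) * eN N (-1 * (Z.of_nat v * J)))) N) N +
    (b1 * b2) * csum (fun u => csum (fun v => psi (Z.of_nat u) * eN N (h * Z.of_nat u * Z.of_nat v) *
    (eN N (1 * (Z.of_nat u * I)) * eN N (1 * (Z.of_nat v * J)))) N) N))))%C.
  { rewrite <- !csum_scal, <- !csum_plus, <- csum_scal. apply csum_ext; intros u _.
    rewrite <- !csum_scal, <- !csum_plus, <- csum_scal. apply csum_ext; intros v _.
    rewrite !dual_eN. fold I J a1 a2 b1 b2 k1 k2. fold k1. unfold k1, k2. ring. }
  rewrite s1, s2, s3, s4.
  (* With de = -1 the character is evaluated at hbar j instead of - hbar j; factoring out psi(-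
     hbar) accounts for the coefficients psi(-1). *)
  assert (pp : psi (hbar * J)%Z = (psi (-1)%Z * (psi (- hbar)%Z * psi J))%C).
  { rewrite <- !(psi_mult q psi hpsi). f_equal. ring. }
  replace (- (-1) * hbar * J)%Z with (hbar * J)%Z by ring.
  replace (- (1) * hbar * J)%Z with (- hbar * J)%Z by ring.
  replace (- (-1 * -1) * hbar * (I * J))%Z with (- hbar * J * I)%Z by ring.
  replace (- (-1 * 1) * hbar * (I * J))%Z with (hbar * J * I)%Z by ring.
  replace (- (1 * -1) * hbar * (I * J))%Z with (hbar * J * I)%Z by ring.
  replace (- (1 * 1) * hbar * (I * J))%Z with (- hbar * J * I)%Z by ring.
  rewrite pp, (psi_mult q psi hpsi (- hbar)).
  replace (xi - w1)%C with (- w2)%C by (unfold w1, w2; ring).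
  unfold K, k1, k2. field. auto.
Qed.

End Left.

(** * The functional equation by analytic continuation *)

Lemma locally_finite_poles : locally_finite (fun w => exists k : nat, w = (- RtoC (INR k))%C).
Proof.
  intros z. exists 1. split; [lra|].
  destruct (INR_unbounded (Cmod z + 1)) as [K hK].
  exists (map (fun k => (- RtoC (INR k))%C) (seq 0 K)). intros w hw [k hk].
  rewrite hk. apply (in_map (fun k => (- RtoC (INR k))%C)). apply in_seq. split; [lia|].
  cbn [Nat.add]. apply INR_lt. apply Rle_lt_trans with (2 := hK).
  assert (h1 := Cmod_sub_ge w z). rewrite hk in h1 at 1. rewrite Cmod_opp, Cmod_R, Rabs_pos_eq in h1 by apply pos_INR. lra.
Qed.

Theorem theorem2p1 :
  forall (q l h hbar : Z) (psi : Z -> C) (xi : C) (D1 D2 D3 : C -> C),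
    (0 < q)%Z -> primitive_char q psi ->
    (0 < l)%Z ->
    Z.gcd h (l * q) = 1%Z ->
    ((h * hbar) mod (l * q) = 1 mod (l * q))%Z ->
    estermann_continuation psi xi h (l * q) D1 ->
    estermann_continuation psi xi hbar (l * q) D2 ->
    estermann_continuation psi xi (- hbar) (l * q) D3 ->
    exists E : C -> Prop, locally_finite E /\
      forall s : C, ~ E s ->
        D1 s =
        (psi (- hbar)%Z
         * cpowR (2 * PI) (2 * s - xi - 2)
         * cpowR (IZR (l * q)) (xi - 2 * s + 1)
         * Gamma (1 - s) * Gamma (1 + xi - s)
         * ( (e (xi / 4) + psi (-1)%Z * e (- (xi / 4))) * D2 (1 + xi - s)
           - (e ((2 * s - xi) / 4) + psi (-1)%Z * e (- ((2 * s - xi) / 4)))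
             * D3 (1 + xi - s) ))%C.
Proof.
  intros q l h hbar psi xi D1 D2 D3 hq [hpsi _] hl _ hinv hD1 hD2 hD3.
  set (N := Z.to_nat (l * q)). assert (hNZ : Z.of_nat N = (l * q)%Z) by (unfold N; nia).
  assert (hN : (1 <= N)%nat) by nia.
  assert (hqN : (q | Z.of_nat N)%Z) by (rewrite hNZ; exists l; reflexivity).
  assert (hNR : IZR (l * q) = INR N) by (rewrite <- hNZ, <- INR_IZR_INZ; reflexivity).
  rewrite <- hNZ in hinv, hD1, hD2, hD3. rewrite hNR.
  destruct (estermann_double q psi hpsi N xi hN h D1 hD1) as [R1 hR1].
  destruct (estermann_double q psi hpsi N xi hN hbar D2 hD2) as [R2 hR2].
  destruct (estermann_double q psi hpsi N xi hN (- hbar) D3 hD3) as [R3 hR3].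
  destruct hD1 as [[P1 [hP1 hd1]] _]. destruct hD2 as [[P2 [hP2 hd2]] _]. destruct hD3 as [[P3 [hP3 hd3]] _].
  set (T := bridge psi N xi hN h).
  set (A := fun s : C => (psi (- hbar)%Z * cpowR (2 * PI) (2 * s - xi - 2) * cpowR (INR N) (xi - 2 * s + 1) *
   ((e (xi / 4) + psi (-1)%Z * e (- (xi / 4))) * D2 (1 + xi - s) -
    (e ((2 * s - xi) / 4) + psi (-1)%Z * e (- ((2 * s - xi) / 4))) * D3 (1 + xi - s)))%C).
  assert (hT : forall s, holo T s) by apply holo_bridge.
  assert (haff : forall a b z : C, holo (fun s => a * s + b)%C z).
  { intros a b z. apply holo_plus; [apply holo_mult; [apply holo_const|apply holo_id]|apply holo_const]. }
  (* Stated with the entire factors [rgam] multiplied onto [D1], so that only the exceptional set of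
     [D1] has to be avoided. *)
  assert (right : forall s, ~ P1 s -> (rgam (1 + xi - s) * rgam (1 - s) * D1 s - T s)%C = 0).
  { apply (identity_right P1 _ (Rmax R1 (Rmax 2 (Re xi + 2)))); auto.
    - intros s hs. apply holo_minus; auto. apply holo_mult; [|now apply ex_derive_holo, hd1].
      apply holo_mult; (apply (holo_comp rgam); [|apply holo_rgam]);
      apply holo_minus; try apply holo_const; apply holo_id.
    - intros s hs _. assert (m1 := Rmax_l R1 (Rmax 2 (Re xi + 2))). assert (m2 := Rmax_r R1 (Rmax 2 (Re xi + 2))).
      assert (m3 := Rmax_l 2 (Re xi + 2)). assert (m4 := Rmax_r 2 (Re xi + 2)).
      unfold T. rewrite (bridge_right q psi hpsi N xi hN hqN h s (D1 s)); [ring|lra|lra|]. apply hR1. lra. }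
  set (Q2 := fun s : C => P2 (1 + xi - s)%C \/ P3 (1 + xi - s)%C).
  assert (hQ2 : locally_finite Q2).
  { apply (locally_finite_or (fun s => P2 (1 + xi - s)%C) (fun s => P3 (1 + xi - s)%C));
    apply locally_finite_reflect; auto. }
  assert (left : forall s, ~ Q2 s -> (T s - A s)%C = 0).
  (* The first two bounds put 1 - s and 1 + xi - s in the half-plane of the dual series; the last
     two put 1 + xi - s where the series of [D2] and [D3] converge. *)
  { set (R0 := Rmin (Rmin (-2) (Re xi - 2)) (Rmin (1 + Re xi - R2) (1 + Re xi - R3))).
    apply (identity_left Q2 _ R0); auto.
    - intros s hs. apply holo_minus; auto.
      assert (g2 : holo (fun s => D2 (1 + xi - s)%C) s).
      { apply (holo_reflect D2). apply ex_derive_holo, hd2. intros hp; apply hs; now left. }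
      assert (g3 : holo (fun s => D3 (1 + xi - s)%C) s).
      { apply (holo_reflect D3). apply ex_derive_holo, hd3. intros hp; apply hs; now right. }
      unfold A. apply holo_mult; [apply holo_mult; [apply holo_mult; [apply holo_const|]|]|].
      + apply (holo_comp (cpowR _)); [|apply holo_cpowR].
        apply holo_ext with (fun s => 2 * s + (- xi - 2))%C; [intros; ring|apply haff].
      + apply (holo_comp (cpowR _)); [|apply holo_cpowR].
        apply holo_ext with (fun s => (-2) * s + (xi + 1))%C; [|apply haff].
        intros w. replace (RtoC (-2)) with (- RtoC 2)%C by (rewrite <- RtoC_opp; reflexivity). ring.
      + apply holo_minus; apply holo_mult; auto; [apply holo_const|].
        assert (hcc : holo (fun s => (2 * s - xi) / 4)%C s).
        { apply holo_ext with (fun s => (2 / 4) * s + (- xi / 4))%C; [intros; unfold Cdiv; ring|apply haff]. }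
        apply holo_plus; [apply (holo_comp e); [auto|apply holo_e]|].
        apply holo_mult; [apply holo_const|]. apply (holo_comp e); [now apply holo_opp|apply holo_e].
    - intros s hs _.
      assert (m1 := Rmin_l (Rmin (-2) (Re xi - 2)) (Rmin (1 + Re xi - R2) (1 + Re xi - R3))).
      assert (m2 := Rmin_r (Rmin (-2) (Re xi - 2)) (Rmin (1 + Re xi - R2) (1 + Re xi - R3))).
      assert (m3 := Rmin_l (-2) (Re xi - 2)). assert (m4 := Rmin_r (-2) (Re xi - 2)).
      assert (m5 := Rmin_l (1 + Re xi - R2) (1 + Re xi - R3)). assert (m6 := Rmin_r (1 + Re xi - R2) (1 + Re xi - R3)).
      fold R0 in m1, m2. assert (hre : Re (1 + xi - s)%C = 1 + Re xi - Re s) by reflexivity.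
      unfold T, A.
      rewrite (bridge_left q psi hpsi N xi hN hqN h hbar hinv s (D2 (1 + xi - s)%C) (D3 (1 + xi - s)%C)); [ring|lra|lra| |].
      + apply hR2. rewrite hre. lra.
      + apply hR3. rewrite hre. lra. }
  set (poles := fun w : C => exists k : nat, w = (- RtoC (INR k))%C).
  (* Besides the exceptional sets of the three continuations, the poles of both Gamma factors are
     excluded: there [Gamma] takes a default value and is not the inverse of [rgam]. *)
  exists (fun s => (P1 s \/ Q2 s) \/ (poles (1 - s)%C \/ poles (1 + xi - s)%C)). split.
  - apply (locally_finite_or (fun s => P1 s \/ Q2 s) (fun s => poles (1 - s)%C \/ poles (1 + xi - s)%C)).
    + now apply locally_finite_or.
    + apply (locally_finite_or (fun s => poles (1 - s)%C) (fun s => poles (1 + xi - s)%C));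
      apply (locally_finite_reflect poles), locally_finite_poles.
  - intros s hs.
    assert (p1 : forall k : nat, (1 - s)%C <> (- RtoC (INR k))%C).
    { intros k hk. apply hs. right; left. now exists k. }
    assert (p2 : forall k : nat, (1 + xi - s)%C <> (- RtoC (INR k))%C).
    { intros k hk. apply hs. right; right. now exists k. }
    rewrite (Gamma_rgam _ p1), (Gamma_rgam _ p2).
    assert (n1 := rgam_neq_0 _ p1). assert (n2 := rgam_neq_0 _ p2).
    assert (r := right s ltac:(tauto)). assert (r' := left s ltac:(tauto)).
    apply C_sub_0 in r. apply C_sub_0 in r'. rewrite r' in r.
    transitivity (/ rgam (1 - s) * / rgam (1 + xi - s) * (rgam (1 + xi - s) * rgam (1 - s) * D1 s))%C.
    + field; auto.
    + rewrite r. unfold A. ring.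
Qed.
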